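(* Let $L\subset S^3$ be an oriented link, let $i_1<i_2$ be integers, and let $s\in\mathbb{Z}$. Suppose that: (1) $H(L)$ is thin over $[i_1,i_2]$ with witnessing integer $s$, so that $H^{[i_1,i_2]}(L)$ is supported in bigradings $(i,j)$ with $2i-j=s\pm 1$; (2) $\dim_{\mathbb{Q}}H^{i_1,*}(L;\mathbb{Q})=\dim_{\mathbb{Z}_p} H^{i_1,*}(L;\mathbb{Z}_p)$ for each odd prime $p$; (3) $H^{i_1,*}(L)$ is torsion-free; and (4) $H^{i_1-1,j}(L)$ is trivial when $j\leq 2i_1-s-3$. Then all torsion in $H^{i,*}(L)$ is $\mathbb{Z}_2$ torsion for every integer $i$ with $i_1\le i\le i_2$; that is, $H^{[i_1,i_2]}(L)\cong\mathbb{Z}^k\oplus \mathbb{Z}_2^\ell$ for some $k,\ell\geq 0$.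
   Context: $\mathbb{Z}_m=\mathbb{Z}/m\mathbb{Z}$. For a commutative ring $R$, $H(L;R)=\bigoplus_{i,j\in\mathbb{Z}}H^{i,j}(L;R)$ is the Khovanov homology of the oriented link $L$ with coefficients in $R$ ($i$ is the homological grading, $j$ the polynomial grading), and $H(L)=H(L;\mathbb{Z})$. Conventions: let $D$ be a diagram of $L$ with $n$ crossings, $n_+$ positive and $n_-$ negative. Let $\mathcal{A}=R[X]/X^2$ with $1$ in polynomial grading $1$ and $X$ in polynomial grading $-1$. For $I\in\{0,1\}^n$, with $h(I)$ the number of $1$'s, let $D(I)$ be the collection of circles obtained by $0$- or $1$-smoothing each crossing according to $I$ (the $0$-smoothing of a positive crossing and the $1$-smoothing of a negative crossing are the oriented smoothings). The cochain complex is $C(D;R)=\bigoplus_I \mathcal{A}^{\otimes |D(I)|}[h(I)-n_-]\{h(I)+n_+-2n_-\}$, where $(M[r])^{i,j}=M^{i-r,j}$ and $(M\{t\})^{i,j}=M^{i,j-t}$. The differential $d$, of bidegree $(1,0)$, is the usual signed sum over edges of the cube of the maps induced by $m(1\otimes1)=1$, $m(1\otimes X)=m(X\otimes 1)=X$, $m(X\otimes X)=0$ when circles merge and $\Delta(1)=1\otimes X+X\otimes 1$, $\Delta(X)=X\otimes X$ when a circle splits. $H^{i,*}(L;R)=\bigoplus_j H^{i,j}(L;R)$ and $H^{[i_1,i_2]}(L;R)=\bigoplus_{i=i_1}^{i_2}H^{i,*}(L;R)$; $R$ is omitted when $R=\mathbb{Z}$. Thinness: for integers $i_1<i_2$, $H(L)$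 is thin over $[i_1,i_2]$ if there is an $s\in\mathbb{Z}$ (a witnessing integer) such that, for all primes $p$ and all $i$ with $i_1\le i\le i_2$, $H^{i,j}(L;\mathbb{Z}_p)=0$ unless $2i-j=s\pm1$. ''$\mathbb{Z}_{p^r}$ torsion'' means a direct summand isomorphic to $\mathbb{Z}_{p^r}$ in the primary decomposition of the integral Khovanov homology. *)

(* Defs.v *)
From HB Require Import structures.
From mathcomp Require Import all_boot all_order all_algebra generic_quotient.
From mathcomp Require Import ring_quotient.
From mathcomp Require Import boolp classical_sets cardinality.

Set Implicit Arguments.
Unset Strict Implicit.
Unset Printing Implicit Defensive.

Import Order.TTheory GRing.Theory Num.Theory.
Local Open Scope ring_scope.

(** * Algebra: homology, direct sums, dimension, torsion *)

(** Homology at [V] of U -> V -> W.  The definition makes sense without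
    assuming [g \o f = 0]: it is then ker g / (im f inter ker g). *)
Section Homology.
Variables (R : nzRingType) (U V W : lmodType R).
Variables (f : {linear U -> V}) (g : {linear V -> W}).

Definition ker_pred : {pred V} := [pred x | g x == 0].

Fact ker_submod_closed : submod_closed ker_pred.
Proof.
split=> [|a x y]; rewrite !inE ?linear0 // => /eqP gx /eqP gy.
by rewrite linearP gx gy scaler0 addr0.
Qed.
HB.instance Definition _ := GRing.isSubmodClosed.Build R V ker_pred
  ker_submod_closed.

Record cocycle := Cocycle {
  cocycle_val : V;
  cocycle_closed : cocycle_val \in ker_pred
}.
HB.instance Definition _ := [isSub for cocycle_val].
HB.instance Definition _ := [Choice of cocycle by <:].
HB.instance Definition _ := [SubChoice_isSubLmodule of cocycle by <:].

Definition coboundary_pred : {pred cocycle} :=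
  [pred z : cocycle | `[< exists u, f u = val z >]].

Fact coboundary_submod_closed : submod_closed coboundary_pred.
Proof.
split=> [|a x y]; first by apply/asboolP; exists 0; rewrite linear0.
move=> /asboolP[u fu] /asboolP[v fv]; apply/asboolP; exists (a *: u + v).
by rewrite linearP fu fv.
Qed.
HB.instance Definition _ := GRing.isSubmodClosed.Build R cocycle
  coboundary_pred coboundary_submod_closed.

Definition homology := Quotient.quot coboundary_pred.
HB.instance Definition _ := GRing.Zmodule.on homology.

Definition homology_class (z : cocycle) : homology := \pi_homology%qT z.

Definition homology_scale (a : R) (x : homology) : homology :=
  homology_class (a *: repr x).

Fact homology_class_eq z z' :
  z - z' \in coboundary_pred -> homology_class z = homology_class z'.
Proof. by rewrite Quotient.idealrBE => /eqP. Qed.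

Fact homology_class_repr x : homology_class (repr x) = x.
Proof. exact: reprK. Qed.

Fact homology_repr_class z :
  repr (homology_class z) - z \in coboundary_pred.
Proof. by rewrite Quotient.idealrBE reprK. Qed.

Fact homology_classD z z' :
  homology_class (z + z') = homology_class z + homology_class z'.
Proof. by rewrite /homology_class !raddfD. Qed.

Fact homology_classZ a z :
  homology_class (a *: z) = homology_scale a (homology_class z).
Proof.
apply/esym/homology_class_eq; rewrite -scalerBr.
exact/rpredZ/homology_repr_class.
Qed.

Fact homology_scalerA a b x :
  homology_scale a (homology_scale b x) = homology_scale (a * b) x.
Proof. by rewrite -(homology_class_repr x) -!homology_classZ scalerA. Qed.

Fact homology_scale1r : left_id 1 homology_scale.
Proof.
by move=> x; rewrite -(homology_class_repr x) -homology_classZ scale1r.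
Qed.

Fact homology_scalerDr : right_distributive homology_scale +%R.
Proof.
move=> a x y; rewrite -(homology_class_repr x) -(homology_class_repr y).
by rewrite -homology_classD -!homology_classZ scalerDr homology_classD.
Qed.

Fact homology_scalerDl x :
  {morph homology_scale^~ x : a b / a + b}.
Proof.
move=> a b; rewrite -(homology_class_repr x).
by rewrite -!homology_classZ scalerDl homology_classD.
Qed.

HB.instance Definition _ := GRing.Zmodule_isLmodule.Build R homology
  homology_scalerA homology_scale1r homology_scalerDr homology_scalerDl.

End Homology.

Section DirectSum.
Variables (R : nzRingType) (K : Type) (M : K -> lmodType R).

Record dsum := DSum {
  dsum_fun :> forall k, M k;
  dsum_finite : finite_set [set k | dsum_fun k != 0]%classic
}.

HB.instance Definition _ := gen_eqMixin dsum.
HB.instance Definition _ := gen_choiceMixin dsum.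

Fact dsumP (x y : dsum) : (forall k, x k = y k) -> x = y.
Proof.
case: x y => [x xf] [y yf] /= xy.
have exy : x = y by apply: functional_extensionality_dep.
by case: _ / exy yf => yf; congr DSum; apply: Prop_irrelevance.
Qed.

Fact dsum_finite0 : finite_set [set k | (0 : M k) != 0]%classic.
Proof. by apply: (sub_finite_set _ (finite_set0 K)) => k /=; rewrite eqxx. Qed.
Definition dsum_zero := DSum dsum_finite0.

Fact dsum_finiteN (x : dsum) : finite_set [set k | - x k != 0]%classic.
Proof.
by apply: sub_finite_set (dsum_finite x) => k /=; rewrite oppr_eq0.
Qed.
Definition dsum_opp x := DSum (dsum_finiteN x).

Fact dsum_finiteD (x y : dsum) : finite_set [set k | x k + y k != 0]%classic.
Proof.
have xyf : finite_set ([set k | x k != 0] `|` [set k | y k != 0])%classic.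
  by rewrite finite_setU; split; apply: dsum_finite.
apply: sub_finite_set xyf => k /= xy0.
by have [x0|] := eqVneq (x k) 0; [right; rewrite x0 add0r in xy0 | left].
Qed.
Definition dsum_add x y := DSum (dsum_finiteD x y).

Fact dsum_finiteZ a (x : dsum) : finite_set [set k | a *: x k != 0]%classic.
Proof.
apply: sub_finite_set (dsum_finite x) => k /=.
by apply: contraNN => /eqP->; rewrite scaler0.
Qed.
Definition dsum_scale a x := DSum (dsum_finiteZ a x).

Fact dsum_addA : associative dsum_add.
Proof. by move=> x y z; apply: dsumP => k /=; rewrite addrA. Qed.
Fact dsum_addC : commutative dsum_add.
Proof. by move=> x y; apply: dsumP => k /=; rewrite addrC. Qed.
Fact dsum_add0 : left_id dsum_zero dsum_add.
Proof. by move=> x; apply: dsumP => k /=; rewrite add0r. Qed.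
Fact dsum_addN : left_inverse dsum_zero dsum_opp dsum_add.
Proof. by move=> x; apply: dsumP => k /=; rewrite addNr. Qed.
HB.instance Definition _ := GRing.isZmodule.Build dsum
  dsum_addA dsum_addC dsum_add0 dsum_addN.

Fact dsum_scaleA a b x : dsum_scale a (dsum_scale b x) = dsum_scale (a * b) x.
Proof. by apply: dsumP => k /=; rewrite scalerA. Qed.
Fact dsum_scale1 : left_id 1 dsum_scale.
Proof. by move=> x; apply: dsumP => k /=; rewrite scale1r. Qed.
Fact dsum_scaleDr : right_distributive dsum_scale +%R.
Proof. by move=> a x y; apply: dsumP => k /=; rewrite scalerDr. Qed.
Fact dsum_scaleDl x : {morph dsum_scale^~ x : a b / a + b}.
Proof. by move=> a b; apply: dsumP => k /=; rewrite scalerDl. Qed.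
HB.instance Definition _ := GRing.Zmodule_isLmodule.Build R dsum
  dsum_scaleA dsum_scale1 dsum_scaleDr dsum_scaleDl.

End DirectSum.

(** [dimension V] is only meaningful when [V] has finite dimension; it is [0]
    otherwise. *)
Definition dimension (F : fieldType) (V : lmodType F) : nat :=
  xget 0%N [set n | inhabited (vector_axiom_def n V)]%classic.

Definition trivial_module (M : zmodType) := forall x : M, x = 0.

Definition isomorphic (A B : zmodType) :=
  exists f : {additive A -> B}, bijective f.

Definition torsion_free (M : zmodType) :=
  forall (n : nat) (x : M), (0 < n)%N -> x *+ n = 0 -> x = 0.

(** A finitely generated abelian group has a direct summand Z/p^r iff Z/p^r
    occurs in its (unique) primary decomposition. *)
Definition has_torsion_summand (M : zmodType) (p r : nat) :=
  exists N : zmodType, isomorphic M ('Z_(p ^ r) * N)%type.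

(** * Link diagrams *)

(** A half-edge [(c, k)] is one of the four ends meeting at the crossing [c].
    The ends are numbered counterclockwise by [k], starting from the incoming
    end of the under-strand, as in planar diagram codes; so the under-strand
    runs from end 0 to end 2, and the over-strand runs from end 3 to end 1 if
    [c] is positive and from end 1 to end 3 if it is negative. *)
Definition half_edge (n : nat) := ('I_n * 'Z_4)%type.

Definition incoming n (positive : {set 'I_n}) (x : half_edge n) : bool :=
  (x.2 == 0) || (x.2 == if x.1 \in positive then 3 else 1).

Definition turn n (x : half_edge n) : half_edge n := (x.1, x.2 + 1).

(** [arc] glues the half-edges in pairs, from an outgoing to an incoming one.
    The underlying 4-valent graph with the cyclic orders at the crossings is
    a combinatorial map; it is drawn on a disjoint union of spheres, one for
    each connected component, iff V - E + F = 2 C, where V = n, E = 2 n, the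
    faces are the orbits of [turn \o arc] and C is the number of components.
    [unknots] counts the components of the diagram without crossings. *)
Record link_diagram := LinkDiagram {
  crossings : nat;
  positive : {set 'I_crossings};
  arc : half_edge crossings -> half_edge crossings;
  unknots : nat;
  arcK : involutive arc;
  arc_oriented : forall x, incoming positive (arc x) = ~~ incoming positive x;
  planar :
    (crossings + fcard (@turn crossings \o arc) predT =
     2 * crossings +
     2 * n_comp [rel x y | (y == arc x) || (y == turn x)] predT)%N
}.

(** * The Khovanov complex *)

Section Khovanov.
Variable D : link_diagram.
Local Notation n := (crossings D).

Definition n_plus : nat := #|positive D|.
Definition n_minus : nat := #|~: positive D|.

(** A vertex of the cube is given by its set of 1-smoothed crossings. *)
Definition smoothing := {set 'I_n}.

(** The 0-smoothing joins the ends 0-1 and 2-3, the 1-smoothing joins the ends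
    0-3 and 1-2.  The former is the oriented one iff the crossing is
    positive. *)
Definition smooth (I : smoothing) (x : half_edge n) : half_edge n :=
  (x.1, if x.1 \in I then 3 - x.2 else 1 - x.2).

Definition point := (half_edge n + 'I_(unknots D))%type.

(** The circles of D(I) are the connected components of this relation. *)
Definition circle_rel (I : smoothing) : rel point := fun x y =>
  match x, y with
  | inl a, inl b => (b == arc a) || (b == smooth I a)
  | _, _ => false
  end.

(** The basis of the tensor power of [A = R[X]/X^2] indexed by the circles of
    D(I) consists of the labellings of the circles by 1 or X.  A labelling is
    encoded as a boolean function on points, constant on each circle, with
    [false] standing for the label 1 and [true] for the label X. *)
Definition labelling := {ffun point -> bool}.

Definition is_labelling (I : smoothing) (v : labelling) : bool :=
  [forall x, forall y, circle_rel I x y ==> (v x == v y)].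

Definition label_degree (I : smoothing) (v : labelling) : int :=
  (n_comp (circle_rel I) [pred x | ~~ v x])%:Z
  - (n_comp (circle_rel I) [pred x | v x])%:Z.

Definition hom_degree (I : smoothing) : int := #|I|%:Z - n_minus%:Z.

Definition poly_degree (I : smoothing) (v : labelling) : int :=
  label_degree I v + #|I|%:Z + n_plus%:Z - 2 * n_minus%:Z.

Definition generator (i j : int) :=
  {x : smoothing * labelling | [&& is_labelling x.1 x.2,
     hom_degree x.1 == i & poly_degree x.1 x.2 == j]}.

(** In terms of exponents, m(X^a (x) X^b) = X^(a+b) with X^2 = 0, and
    Delta(X^a) is the sum of the X^b (x) X^c with b + c = a + 1. *)
Definition m_coef (a b c : bool) : bool := (a + b == c)%N.
Definition Delta_coef (a b c : bool) : bool := (b + c == a.+1)%N.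

(** The coefficient of [w] in the image of [v] under the map along the edge of
    the cube from [I] to [c |: I].  At [c], D(I) has the strands 0-1 and 2-3,
    and D(c |: I) has the strands 0-3 and 1-2; so in both cases ends 0 and 2
    represent the two strands. *)
Definition edge_coef (I : smoothing) (c : 'I_n) (v w : labelling) : bool :=
  let e0 : point := inl (c, 0) in
  let e2 : point := inl (c, 2) in
  [forall x, [|| connect (circle_rel I) e0 x, connect (circle_rel I) e2 x
                | w x == v x]] &&
  (if connect (circle_rel I) e0 e2
   then Delta_coef (v e0) (w e0) (w e2)
   else m_coef (v e0) (v e2) (w e0)).

Variable R : comNzRingType.

Definition differential_coef (x y : smoothing * labelling) : R :=
  \sum_(c | (c \notin x.1) && (y.1 == c |: x.1))
    (-1) ^+ #|[set b in x.1 | (b < c)%N]| * (edge_coef x.1 c x.2 y.2)%:R.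

Definition cochain (i j : int) := {ffun generator i j -> R^o}.

(** [differential i i' j] is the component C^{i,j} -> C^{i',j} of d; it is
    zero unless i' = i + 1. *)
Definition differential (i i' j : int) (f : cochain i j) : cochain i' j :=
  [ffun y => \sum_x f x * differential_coef (val x) (val y)].

Fact differential_linear i i' j : linear (@differential i i' j).
Proof.
move=> a f g; apply/ffunP => y; rewrite !ffunE scaler_sumr -big_split /=.
by apply: eq_bigr => x _; rewrite !ffunE mulrDl scalerAl.
Qed.
HB.instance Definition _ i i' j :=
  GRing.isLinear.Build R (cochain i j) (cochain i' j) *:%R
    (@differential i i' j) (@differential_linear i i' j).

Definition Kh (i j : int) : lmodType R :=
  homology (@differential (i - 1) i j) (@differential i (i + 1) j).

Definition Kh_row (i : int) : lmodType R := dsum (Kh i).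

Definition Kh_range (i1 i2 : int) : lmodType R :=
  dsum (fun i : {i : int | i1 <= i <= i2} => Kh_row (val i)).

End Khovanov.

Definition thin_over_with (D : link_diagram) (i1 i2 s : int) :=
  forall p : nat, prime p -> forall i j : int, i1 <= i <= i2 ->
  2 * i - j != s + 1 -> 2 * i - j != s - 1 -> trivial_module (Kh D 'F_p i j).

(* Main.v *)
(* Over Z, deform the Khovanov differential d to d + Psi by replacing the
   relation X^2 = 0 with X^2 = X.  In the basis of idempotents X, 1 - X the
   deformed complex splits into cubes, so its homology is torsion free.  If a
   cocycle x on a thin strip satisfies p x = d y, the vanishing of homology
   modulo p off the diagonals allows one to correct y until
   p Z = (d + Psi) Y with Z = x + higher terms.  Torsion-freeness gives
   Z = (d + Psi) t, thinness lets t be pushed up to the diagonals, and comparing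
   degrees x becomes a coboundary plus a value of Psi.  For a first-order operator
   N one has [d, N] = 2 Psi, so Psi is killed at odd p.  At p = 2 the argument is
   run in the reduced complex, which modulo 2 is supported on a single diagonal,
   and yields that 2 x is a coboundary. *)
From HB Require Import structures.
From mathcomp Require Import boolp classical_sets cardinality.
From mathcomp Require Import all_boot all_order all_algebra all_fingroup.
From mathcomp Require Import generic_quotient ring_quotient zify ring.
Require Import Defs.

Set Implicit Arguments.
Unset Strict Implicit.
Unset Printing Implicit Defensive.

Import Order.TTheory GRing.Theory Num.Theory.
Local Open Scope ring_scope.

(** * Checkerboard colouring of a planar diagram *)

(** The roots 0 and 1 of [X^2 = X] differ by a unit, so the idempotents form a basis over the
    integers and torsion-freeness holds at every prime, 2 included. The price is a sign: a split
    acts on [1 - X] by -1, and these signs have to be trivialised on every cube. The operator [N]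
    comes from the automorphism exchanging X and [1 - X]. Composed with a sign that depends on the
    polynomial degree, it intertwines [d - Psi] with [d + Psi]; its leading term is 1 and [N] is the
    next one. With [j = 2i - s - 1], the strip meets row [i] in degrees [j] and [j + 2], and row
    [i - 1] in [j - 2] and [j]. Hence only the lower diagonal can carry torsion, and the obstacle is
    the surviving group in degree [j + 2], where the first error term [y Psi] falls. At odd primes
    [N] removes that term. At 2 it cannot, because [N] enters only through [2 Psi]; in the reduced
    complex modulo 2 the group in degree [j + 2] is absent. Acyclicity modulo [p] does not see
    integral classes of order prime to [p], so each use of it on integral cocycles costs a factor
    [1 + p c]. These factors are removed at the end, as [p x] bounds too. *)

Section InvariantVectors.
Variables (F : fieldType) (T : finType).
Implicit Types (f : T -> T) (v : 'rV[F]_#|T|).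

Definition entry v (x : T) : F := v 0 (enum_rank x).

Lemma entry_row (g : T -> F) x : entry (\row_i g (enum_val i)) x = g x.
Proof. by rewrite /entry mxE enum_rankK. Qed.

Lemma entryD v w x : entry (v + w) x = entry v x + entry w x.
Proof. by rewrite /entry mxE. Qed.

Lemma entry_inj v w : entry v =1 entry w -> v = w.
Proof.
move=> vw; apply/rowP => i; have := vw (enum_val i).
by rewrite /entry enum_valK.
Qed.

(** The matrix of [v |-> v \o f]: here, as for all differentials below, matrices act on row vectors
    from the right. *)
Definition pull_mx f : 'M[F]_#|T| :=
  \matrix_(i, j) (enum_val i == f (enum_val j))%:R.

Lemma entry_pull f v x : entry (v *m pull_mx f) x = entry v (f x).
Proof.
rewrite /entry mxE (bigD1 (enum_rank (f x))) //= mxE !enum_rankK eqxx mulr1.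
rewrite big1 ?addr0 // => i /negPf iN; rewrite mxE enum_rankK.
case: eqP => [e|_]; last by rewrite mulr0.
by rewrite -e enum_valK eqxx in iN.
Qed.

Lemma pull_mxM f g : pull_mx (f \o g) = pull_mx f *m pull_mx g.
Proof.
apply/row_matrixP => i; rewrite !rowE mulmxA.
by apply: entry_inj => x; rewrite !entry_pull.
Qed.

Lemma pull_mx_tr f g : cancel f g -> cancel g f -> (pull_mx f)^T = pull_mx g.
Proof.
move=> fK gK; apply/matrixP => i j; rewrite !mxE; congr (_%:R).
by congr nat_of_bool; apply/eqP/eqP => [->|->]; rewrite ?fK ?gK.
Qed.

(** The indicator functions of the components form a basis; evaluation at the canonical roots, [C'],
    is a right inverse of their matrix [C]. *)
Lemma rank_invariants (e : rel T) k (K : 'M[F]_(k, #|T|)) :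
  connect_sym e ->
  (forall v, (v <= K)%MS <-> (forall x y, e x y -> entry v x = entry v y)) ->
  \rank K = n_comp e predT.
Proof.
move=> eC KP.
have KP' v : (v <= K)%MS <-> (forall x, entry v (fingraph.root e x) = entry v x).
  rewrite KP; split=> [H x|H x y /connect1].
    have /connectP[p + ->] : connect e x (fingraph.root e x) by exact: connect_root.
    elim: p x => //= y p IHp x /andP[exy py].
    by rewrite IHp // (H _ _ exy).
  by rewrite -(root_connect eC) => /eqP rxy; rewrite -H rxy H.
pose r := [set x | fingraph.roots e x].
pose C : 'M[F]_(#|r|, #|T|) :=
  \matrix_(i, j) (fingraph.root e (enum_val j) == enum_val i)%:R.
pose C' : 'M[F]_(#|T|, #|r|) := \matrix_(j, i) (enum_val j == enum_val i)%:R.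
have CC' : C *m C' = 1%:M.
  apply/matrixP => i j; rewrite !mxE (bigD1 (enum_rank (enum_val j))) //=.
  rewrite big1 => [|l /negPf lN]; rewrite !mxE ?enum_rankK ?eqxx ?mulr1 ?addr0.
    have /[!inE]/eqP -> := enum_valP j.
    by rewrite (inj_eq enum_val_inj) eq_sym.
  case: (enum_val l =P _) => [e'|_]; last by rewrite mulr0.
  by rewrite -e' enum_valK eqxx in lN.
have rC : \rank C = #|r|.
  apply/eqP; rewrite -[_ == _]/(row_free C); apply/row_freeP.
  by exists C'.
suff KC : (K :=: C)%MS by rewrite KC rC; apply: eq_card => x; rewrite !inE andbT.
apply/eqmxP/andP; split; last first.
  apply/row_subP => i; apply/KP' => x.
  by rewrite /entry !mxE !enum_rankK root_root.
apply/rV_subP => v /KP' Kv; suff -> : v = v *m C' *m C by apply: submxMl.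
apply: entry_inj => x; rewrite /entry mxE.
have rx : fingraph.root e x \in r by rewrite inE; apply: roots_root.
rewrite (bigD1 (enum_rank_in rx (fingraph.root e x))) //= big1 => [|i iN].
  rewrite mxE addr0 [X in _ * X]mxE !enum_rankK enum_rankK_in // eqxx mulr1.
  rewrite (bigD1 (enum_rank (fingraph.root e x))) //= mxE enum_rankK enum_rankK_in //.
  rewrite eqxx mulr1 big1 ?addr0 => [|j jN]; first by rewrite -[LHS]Kv.
  rewrite mxE enum_rankK_in //; case: eqP => [je|_]; last by rewrite mulr0.
  by rewrite -je enum_valK eqxx in jN.
rewrite [X in _ * X]mxE enum_rankK; case: eqP => [ie|_]; last by rewrite mulr0.
case/eqP: iN; apply: enum_val_inj; by rewrite enum_rankK_in.
Qed.

End InvariantVectors.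

Lemma Z4_ind (P : 'Z_4 -> Prop) : P 0 -> P 1 -> P 2 -> P 3 -> forall k, P k.
Proof.
move=> P0 P1 P2 P3 [[|[|[|[|m]]]] lt] //.
- by rewrite (_ : Ordinal _ = 0) //; apply: val_inj.
- by rewrite (_ : Ordinal _ = 1) //; apply: val_inj.
- by rewrite (_ : Ordinal _ = 2) //; apply: val_inj.
- by rewrite (_ : Ordinal _ = 3) //; apply: val_inj.
Qed.

Section Checkerboard.
Variable D : link_diagram.
Local Notation n := (crossings D).
Local Notation T := (half_edge n).
Local Notation a := (@Defs.arc D).
Local Notation t := (@turn n).
Local Notation F := 'F_2.

Definition turnV (x : T) : T := (x.1, x.2 - 1).
Lemma turnK : cancel t turnV.
Proof. by case=> c k; rewrite /turn /turnV /= addrK. Qed.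
Lemma turnVK : cancel turnV t.
Proof. by case=> c k; rewrite /turn /turnV /= subrK. Qed.

Lemma arc_neq x : a x != x.
Proof.
apply/eqP => ax; have := arc_oriented x; rewrite ax.
by case: (incoming _ _).
Qed.

Lemma card_half_edge : #|{: T}| = (4 * n)%N.
Proof. by rewrite card_prod !card_ord mulnC. Qed.

Lemma fcard_arc : fcard a predT = (2 * n)%N.
Proof.
have aI := can_inj (@arcK D).
apply/eqP; rewrite -(@eqn_pmul2r 2) //.
rewrite (@fcard_order_set _ _ aI 2) // ?card_half_edge ?[(_ * 2)%N]mulnC ?mulnA //.
apply/subsetP => x _; rewrite inE; apply/eqP.
apply: (@order_cycle _ a [:: x; a x]); rewrite /= ?arcK ?eqxx ?inE ?eqxx //.
by rewrite eq_sym arc_neq.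
Qed.

Lemma fcard_turn : fcard t predT = n.
Proof.
have tI := can_inj turnK.
apply/eqP; rewrite -(@eqn_pmul2r 4) //.
rewrite (@fcard_order_set _ _ tI 4) // ?card_half_edge ?[(_ * 4)%N]mulnC //.
apply/subsetP => -[c k] _; rewrite inE; apply/eqP.
apply: (@order_cycle _ t [:: (c, k); (c, k+1); (c, k+1+1); (c, k+1+1+1)]).
- by rewrite /= /turn /= !eqxx /= xpair_eqE eqxx andbT; elim/Z4_ind: k.
- by rewrite /= !inE /= !xpair_eqE !eqxx /=; elim/Z4_ind: k.
- by rewrite inE eqxx.
Qed.

Lemma addrr_F2 (x : F) : x + x = 0.
Proof. by apply/val_inj; case: x => [[|[|]]]. Qed.

Lemma addmm_F2 m k (M : 'M[F]_(m, k)) : M + M = 0.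
Proof. by apply/matrixP => i j; rewrite !mxE addrr_F2. Qed.

Lemma sub_ker_pull (f : T -> T) (v : 'rV[F]_#|{: T}|) :
  (v <= kermx (1%:M + pull_mx F f))%MS <-> (forall x, entry v (f x) = entry v x).
Proof.
split=> [/sub_kermxP|H].
  rewrite mulmxDr mulmx1 => vf x.
  have /eqP : entry (v + v *m pull_mx F f) x = 0 by rewrite vf /entry mxE.
  rewrite entryD entry_pull addr_eq0 => /eqP ->.
  by apply/eqP; rewrite -addr_eq0 addrr_F2.
apply/sub_kermxP; rewrite mulmxDr mulmx1; apply: entry_inj => x.
by rewrite entryD entry_pull H addrr_F2 /entry mxE.
Qed.

Lemma rank_ker_pull (f : T -> T) : injective f ->
  \rank (kermx (1%:M + pull_mx F f)) = fcard f predT.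
Proof.
move=> fI; apply: rank_invariants => [|v]; first exact: fconnect_sym.
rewrite sub_ker_pull; split=> [H x y /eqP <-|H x]; first by rewrite H.
by rewrite (H x (f x)) //= eqxx.
Qed.

(* Checkerboard colouring of the faces, by a dimension count over F_2: the
   boundaries of sets of faces form a space of dimension F - C, the cycles of
   the 4-valent graph one of dimension E - V + C, and the two agree in genus 0.
   As every vertex has even degree, the set of all edges is a cycle. *)
Lemma checkerboard : exists s : T -> bool,
  (forall x, s (a x) = ~~ s x) /\ (forall x, s (t x) = ~~ s x).
Proof.
have aI := can_inj (@arcK D); have tI := can_inj turnK.
pose e : rel T := [rel x y | (y == a x) || (y == t x)].
have eC : connect_sym e.
  have ee : e =2 relU (frel a) (frel t) by move=> u v /=; rewrite ![_ == v]eq_sym.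
  move=> x y; rewrite !(eq_connect ee).
  by apply: relU_sym; apply: fconnect_sym.
have eA x : e x (a x) by rewrite /e /= eqxx.
have eT x : e x (t x) by rewrite /e /= eqxx orbT.
pose A := pull_mx F a; pose tau := pull_mx F t; pose Phi := pull_mx F (t \o a).
pose L := 1%:M + A; pose R := 1%:M + tau; pose K := kermx (1%:M + Phi).
have AA : A *m A = 1%:M.
  apply/row_matrixP => i; rewrite !rowE mulmxA mulmx1.
  by apply: entry_inj => x; rewrite !entry_pull arcK.
have LL : L *m L = 0.
  by rewrite mulmxDl mul1mx mulmxDr mulmx1 AA [A + _]addrC addmm_F2.
have rkL : \rank (kermx L) = (2 * n)%N by rewrite rank_ker_pull ?fcard_arc.
have rankE r k m : k = (#|{: T}| - r)%N -> (r <= #|{: T}|)%N -> k = (m * n)%N ->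
    r = (4 * n - m * n)%N.
  by rewrite card_half_edge; lia.
have rL : \rank L = (2 * n)%N.
  by rewrite (rankE _ _ _ (mxrank_ker L) (rank_leq_col L) rkL) -mulnBl.
have rR : \rank R = (3 * n)%N.
  rewrite (rankE _ _ 1 (mxrank_ker R) (rank_leq_col R)) -?mulnBl // mul1n.
  by rewrite rank_ker_pull ?fcard_turn.
have rK : \rank K = fcard (t \o a) predT by apply/rank_ker_pull/inj_comp.
have K_L : \rank (K :&: kermx L)%MS = n_comp e predT.
  apply: rank_invariants => // v; rewrite sub_capmx; split.
    move=> /andP[/sub_ker_pull vK /sub_ker_pull vL] x y /orP[] /eqP-> //.
    by rewrite -(vL x) -(vK (a x)) /= arcK.
  move=> H; apply/andP; split; apply/sub_ker_pull => x /=.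
    by rewrite -(H _ _ (eT (a x))) -(H _ _ (eA x)).
  by rewrite -(H _ _ (eA x)).
(* [L] squares to 0, so its image consists of functions invariant under [arc]; those killed by [R^T]
   are invariant under [turn] as well, hence constant on components. *)
have L_R : (\rank (L :&: kermx R^T) <= n_comp e predT)%N.
  have -> : R^T = 1%:M + pull_mx F turnV.
    by rewrite linearD /= tr_scalar_mx (pull_mx_tr F turnK turnVK).
  rewrite -(@rank_invariants F T e _ (kermx L :&: kermx (1%:M + pull_mx F turnV))%MS) //.
    by apply/mxrankS/capmxS => //; apply/sub_kermxP.
  move=> v; rewrite sub_capmx; split.
    move=> /andP[/sub_ker_pull vL /sub_ker_pull vR] x y /orP[] /eqP-> //.
    by rewrite -[RHS]vR turnK.
  move=> H; apply/andP; split; apply/sub_ker_pull => x /=.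
    by rewrite -(H _ _ (eA x)).
  by rewrite (H _ _ (eT (turnV x))) turnVK.
have LT : L^T = L.
  by rewrite linearD /= tr_scalar_mx (pull_mx_tr F (@arcK D) (@arcK D)).
have := mxrank_mul_ker K L; rewrite K_L rK => rKL.
have := mxrank_mul_ker R L; rewrite rR => rRL.
have := mxrank_mul_ker L R^T; rewrite rL.
rewrite -{1}LT -trmx_mul mxrank_tr => rLR.
(* A function constant on faces satisfies [v \o turn = v \o arc], so its boundary [v *m L] is also
   [v *m R] and therefore a cycle. *)
have KLZ : (K *m L <= R :&: kermx L)%MS.
  rewrite sub_capmx; apply/andP; split; last first.
    by apply/sub_kermxP; rewrite -mulmxA LL mulmx0.
  have -> : K *m L = K *m R; last exact: submxMl.
  have KPhi : K *m Phi = K.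
    apply/row_matrixP => i; rewrite row_mul; apply: entry_inj => x.
    rewrite entry_pull; move: x; apply/sub_ker_pull; exact: row_sub.
  have tA : tau *m A = Phi by rewrite -pull_mxM.
  by rewrite !mulmxDr -{2}KPhi -tA -!mulmxA AA !mulmx1.
(* With C components and F faces, the cycles have dimension at most [n + C] and the boundaries
   exactly [F - C]; [planar] makes the two numbers equal. *)
have count : forall f c rRL lR kl z : nat, (kl + c = f -> rRL + z = 3 * n ->
    rRL + lR = 2 * n -> lR <= c -> n + f = 2 * n + 2 * c -> z <= kl)%N by lia.
have pl : (n + fcard (t \o a) predT = 2 * n + 2 * n_comp e predT)%N := planar D.
have ZKL : (R :&: kermx L <= K *m L)%MS.
  rewrite -(geq_leqif (mxrank_leqif_sup KLZ)).
  by apply: (@count (fcard (t \o a) predT) (n_comp e predT) (\rank (R *m L))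
                   (\rank (L :&: kermx R^T))).
have : ((const_mx 1 : 'rV[F]_#|{: T}|) <= K *m L)%MS.
  apply: submx_trans ZKL; rewrite sub_capmx; apply/andP; split; last first.
    by apply/sub_ker_pull => x; rewrite /entry !mxE.
  (* Consecutive ends have numbers of opposite parity, so [g + g \o turn = 1]. *)
  pose g (x : T) : F := (odd x.2)%:R.
  apply/submxP; exists (\row_i g (enum_val i)).
  apply: entry_inj => -[c k].
  rewrite mulmxDr mulmx1 entryD entry_pull.
  by rewrite !entry_row /entry mxE /g /=; elim/Z4_ind: k; apply: val_inj.
case/submxP => w; rewrite mulmxA; set v := w *m K => wv.
have vK x : entry v (t (a x)) = entry v x.
  by move: x; apply/sub_ker_pull; apply: submxMl.
have vA x : entry v (a x) = 1 + entry v x.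
  have : entry (const_mx 1) x = entry (v *m L) x by rewrite wv.
  rewrite mulmxDr mulmx1 entryD entry_pull.
  by rewrite /entry mxE => ->; rewrite addrAC addrr_F2 add0r.
have F2E (x : F) : (1 + x != 0) = ~~ (x != 0).
  by case: x => [[|[|]]].
exists (fun x => entry v x != 0); split=> x; first by rewrite vA F2E.
by rewrite -(arcK x) vK [in RHS]vA F2E negbK.
Qed.
End Checkerboard.

(** * The circles of a smoothing as orbits of a permutation *)

Section Circles.
Variable D : link_diagram.
Local Notation n := (crossings D).
Local Notation T := (half_edge n).
Local Notation a := (@Defs.arc D).
Implicit Types (I : smoothing D) (x y : T) (c : 'I_n).

Lemma smoothK I : involutive (@smooth D I).
Proof.
by case=> c k; rewrite /smooth /=; case: (c \in I); rewrite subKr.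
Qed.

Lemma circle_rel_sym I : symmetric (@circle_rel D I).
Proof.
case=> [x|u] [y|v] //=; congr orb; apply/eqP/eqP => ->;
  by rewrite ?arcK ?smoothK.
Qed.

Lemma circle_connect_sym I : connect_sym (@circle_rel D I).
Proof. exact/sym_connect_sym/circle_rel_sym. Qed.

Section Alternating.
Variables (s : T -> bool).
Hypotheses (sa : forall x, s (a x) = ~~ s x) (st : forall x, s (turn x) = ~~ s x).

Lemma alternating_odd c k : s (c, k) = odd k (+) s (c, 0).
Proof.
have st' j : s (c, j + 1) = ~~ s (c, j) by rewrite -st.
have s1 : s (c, 1) = ~~ s (c, 0) by rewrite -st' add0r.
have s2 : s (c, 2) = s (c, 0) by rewrite -[RHS]negbK -s1 -st'.
have s3 : s (c, 3) = ~~ s (c, 0) by rewrite -s2 -st' (_ : 2 + 1 = 3) //; apply: val_inj.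
by elim/Z4_ind: k.
Qed.

Lemma alternating_smooth I x : s (smooth I x) = ~~ s x.
Proof.
case: x => c k; rewrite /smooth /=.
case: (c \in I); rewrite alternating_odd [in RHS]alternating_odd;
  by elim/Z4_ind: k; rewrite /= ?negbK.
Qed.

(* Going around a circle, [s] alternates; following the circles through two
   half-edges at a time gives a permutation of the half-edges on which [s] has
   a given value, and changing the smoothing of a crossing composes this
   permutation with a transposition. *)
Variable b : bool.
Definition two_steps I x : T := if s x == b then a (smooth I x) else x.

Lemma two_steps_inj I : injective (two_steps I).
Proof.
have sab x : s (a (smooth I x)) = s x by rewrite sa alternating_smooth negbK.
move=> x y; rewrite /two_steps; case: eqP => xb; case: eqP => yb // xy.
- by move: (congr1 a xy); rewrite !arcK => /(congr1 (smooth I)); rewrite !smoothK.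
- by case: yb; rewrite -xy sab.
- by case: xb; rewrite xy sab.
Qed.

Definition circle_perm I : {perm T} := perm (@two_steps_inj I).

Lemma connect_porbit I x y : s x = b -> s y = b ->
  connect (@circle_rel D I) (inl x) (inl y) = (y \in porbit (circle_perm I) x).
Proof.
move=> xb yb; set t := circle_perm I.
have tE z : s z = b -> t z = a (smooth I z).
  by move=> zb; rewrite permE /two_steps zb eqxx.
have pt z : (t z \in porbit t x) = (z \in porbit t x).
  by rewrite -!eq_porbit_mem (porbit_perm t 1).
apply/idP/idP; last first.
  case/porbitP=> i yE; rewrite {y}yE in yb *.
  elim: i yb => [|i IHi]; first by rewrite perm1.
  have [zb|zb] := eqVneq (s ((t ^+ i)%g x)) b; last first.
    rewrite expgSr permM permE /two_steps (negPf zb) => e; by rewrite e eqxx in zb.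
  rewrite expgSr permM tE // => _; apply: connect_trans (IHi zb) _.
  apply: (@connect_trans _ _ (inl (smooth I ((t ^+ i)%g x)))); apply: connect1 => /=.
    by rewrite eqxx orbT.
  by rewrite eqxx.
(* The orbit only sees half-edges of colour [b]; the others join it through their partner under
   [smooth], which has colour [b] and lies on the same circle. *)
pose O := [pred z : point D | if z is inl z then
  (if s z == b then z else smooth I z) \in porbit t x else false].
have clO : closed (@circle_rel D I) O.
  apply: (intro_closed (@circle_connect_sym I)) => -[z|//] [w|//] /=; rewrite !inE.
  have nbb : (~~ b == b) = false by case: (b).
  have [zb|zb] := eqVneq (s z) b => /orP[] /eqP->;
    rewrite ?sa ?alternating_smooth ?zb ?nbb ?smoothK //.
  - by move=> Oz; rewrite -pt tE ?smoothK ?arcK // alternating_smooth sa zb negbK.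
  - have -> : ~~ s z == b by move: zb; case: (s z); case: (b).
    by rewrite -pt tE ?smoothK // alternating_smooth; move: zb; case: (s z); case: (b).
  - by have -> : ~~ s z == b by move: zb; case: (s z); case: (b).
move=> /(closed_connect clO); rewrite !inE xb yb eqxx => <-.
exact: porbit_id.
Qed.

End Alternating.

(** Planarity enters the rest of the proof only here: no edge of the cube turns one circle into one
    circle. Ends 0 and 2 have the same colour, and the circle permutations of the two smoothings
    differ by the transposition of these ends, which raises or lowers the number of orbits by one
    according to whether the ends share an orbit. *)
Lemma surgery_circles I c : c \notin I ->
  connect (@circle_rel D (c |: I)) (inl (c, 0)) (inl (c, 2)) =
  ~~ connect (@circle_rel D I) (inl (c, 0)) (inl (c, 2)).
Proof.
move=> cI; have [s [sa st]] := checkerboard D.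
have s2 : s (c, 2) = s (c, 0) by rewrite (alternating_odd st).
rewrite !(connect_porbit sa st _ (erefl (s (c, 0))) s2).
set t := circle_perm _ _ _ I; set t' := circle_perm _ _ _ _.
have tt' : t' = (tperm (c, 0) (c, 2) * t)%g.
  apply/permP => x; rewrite permM [t' x]permE [t _]permE /two_steps.
  have [->|x0] := eqVneq x (c, 0).
    by rewrite tpermL s2 eqxx /smooth /= setU11 (negPf cI); congr (a (c, _)); apply: val_inj.
  have [->|x2] := eqVneq x (c, 2).
    by rewrite tpermR s2 eqxx /smooth /= setU11 (negPf cI); congr (a (c, _)); apply: val_inj.
  rewrite tpermD ?[_ == x]eq_sym //.
  case: eqP => // sx; congr (a _); rewrite /smooth in_setU1.
  have [xc|//] := eqVneq x.1 c; case: x xc sx x0 x2 => _ k /= ->.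
  rewrite (alternating_odd st); elim/Z4_ind: k => //=.
  - by rewrite eqxx.
  - by case: (s _).
  - by rewrite eqxx.
  - by case: (s _).
have t2 : t = (tperm (c, 0) (c, 2) * t')%g by rewrite tt' mulgA tperm2 mul1g.
have := porbits_mul_tperm t (c, 0) (c, 2); rewrite /= -tt'.
have := porbits_mul_tperm t' (c, 0) (c, 2); rewrite /= -t2.
have -> : (c, 0) != (c, 2) :> T by rewrite xpair_eqE eqxx.
by rewrite ![(c, 2) \in _]porbit_sym; do 2![case: (_ \in porbit _ _)] => //=; lia.
Qed.

End Circles.

(** * Labellings of the classes of an equivalence relation *)

Section Labels.
Variables (T : finType) (e : rel T).
Hypothesis eC : connect_sym e.
Implicit Types (u v w : {ffun T -> bool}) (x y z : T).

Definition lab v : bool := [forall x, forall y, e x y ==> (v x == v y)].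

Lemma labP v : reflect (forall x y, connect e x y -> v x = v y) (lab v).
Proof.
apply: (iffP idP) => [/forallP vL x y /connectP[p + ->]|vL].
  elim: p x => //= z p IHp x /andP[exz pz]; rewrite -(IHp z) //.
  by have /forallP/(_ z)/implyP/(_ exz)/eqP := vL x.
apply/forallP => x; apply/forallP => y; apply/implyP => /connect1 exy.
by apply/eqP/vL.
Qed.

Definition sublab w v : bool := [forall x, w x ==> v x].

Lemma sublabP w v : reflect (forall x, w x -> v x) (sublab w v).
Proof. by apply: (iffP forallP) => H x; apply/implyP; apply: H. Qed.

Lemma n_comp_imset (S : finType) (f : T -> S) (A : {pred T}) :
  (forall x y, connect e x y -> x \in A -> y \in A) ->
  (forall x y, x \in A -> y \in A -> connect e x y = (f x == f y)) ->
  n_comp e A = #|f @: A|.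
Proof.
move=> Acl fA; have rA x : x \in A -> fingraph.root e x \in A.
  by apply: Acl; apply: connect_root.
have -> : f @: A = f @: [set x in A | fingraph.roots e x].
  apply/setP => s; apply/imsetP/imsetP => -[x].
    move=> xA ->; exists (fingraph.root e x).
      by rewrite inE rA // roots_root.
    by apply/eqP; rewrite -fA ?rA // connect_root.
  by rewrite inE => /andP[xA _] ->; exists x.
rewrite card_in_imset => [|x y].
  by apply: eq_card => x; rewrite !inE andbC.
rewrite !inE => /andP[xA /eqP rx] /andP[yA /eqP ry] /eqP.
by rewrite -fA // => /(fingraph.rootP eC); rewrite rx ry.
Qed.

Definition num_true w : nat := n_comp e [pred x | w x].

Lemma num_trueE w : lab w -> num_true w = #|fingraph.root e @: [set x | w x]|.
Proof.
move/labP => wL; rewrite /num_true (@n_comp_imset _ (fingraph.root e)).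
- by apply: eq_card => x; apply/imsetP/imsetP => -[y]; rewrite inE => yw ->;
     exists y; rewrite ?inE.
- by move=> x y /wL; rewrite !inE => ->.
by move=> x y _ _; rewrite (root_connect eC).
Qed.

Lemma num_true_add w u z : lab w -> lab u -> ~~ w z ->
  (forall x, u x = w x || connect e z x) -> num_true u = (num_true w).+1.
Proof.
move=> wL uL wz uE; rewrite !num_trueE //.
have -> : fingraph.root e @: [set x | u x] =
          fingraph.root e z |: fingraph.root e @: [set x | w x].
  apply/setP => y; rewrite !inE; apply/imsetP/idP => [[x]|].
    rewrite inE uE => /orP[wx|zx] ->; last first.
      by rewrite eq_sym root_connect // zx.
    by rewrite imset_f ?orbT ?inE.
  case/orP => [/eqP->|/imsetP[x]].
    by exists z => //; rewrite inE uE connect0 orbT.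
  by rewrite inE => wx ->; exists x => //; rewrite inE uE wx.
rewrite cardsU1; case: imsetP => // -[x]; rewrite inE => wx /eqP.
by rewrite root_connect // => /((labP _ wL) _ _) wzx; rewrite wzx wx in wz.
Qed.

Lemma num_true0 w : (forall x, ~~ w x) -> num_true w = 0%N.
Proof.
move=> w0; apply: eq_card0 => x; rewrite !inE; apply/negP => /andP[_].
by apply/negP/w0.
Qed.

(* Flipping the circle of a point where [u] and [w] differ is a
   sign-reversing involution. *)
Lemma alternating_sum w u : lab w -> lab u -> sublab w u ->
  \sum_(v | [&& lab v, sublab w v & sublab v u]) (-1) ^+ num_true v
  = (-1) ^+ num_true w *+ (w == u) :> int.
Proof.
move=> wL uL wu; have [<-|neq] := eqVneq w u.
  rewrite (big_pred1 w) ?mulr1n // => v; apply/idP/eqP => [/and3P[_ /sublabP H1 /sublabP H2]|->].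
    apply/ffunP => x; apply/idP/idP; first by move/H2.
    by move/H1.
  by rewrite wL /=; apply/andP; split; apply/sublabP.
have [z uz wz] : exists2 z, u z & ~~ w z.
  case: (pickP (fun z => u z && ~~ w z)) => [z /andP[]|no]; first by exists z.
  case/eqP: neq; apply/ffunP => x; have := no x.
  by have /sublabP/(_ x) := wu; case: (w x) (u x) => [] []// ->.
pose h v : {ffun T -> bool} := [ffun x => v x (+) connect e z x].
have hK : involutive h by move=> v; apply/ffunP => x; rewrite !ffunE addbK.
have hL v : lab v -> lab (h v).
  move=> /labP vL; apply/labP => x y xy; rewrite !ffunE (vL _ _ xy).
  by rewrite (same_connect_r eC xy).
have hP v : [&& lab (h v), sublab w (h v) & sublab (h v) u] =
            [&& lab v, sublab w v & sublab v u].
  suff H v' : [&& lab v', sublab w v' & sublab v' u] ->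
              [&& lab (h v'), sublab w (h v') & sublab (h v') u].
    by apply/idP/idP => [/H|/H //]; rewrite hK.
  move=> {v} /and3P[vL /sublabP wv /sublabP vu]; rewrite hL //=.
  apply/andP; split; apply/sublabP => x; rewrite ffunE.
    move=> wx; rewrite wv //=; apply/negP => /((labP _ wL) _ _) e'.
    by rewrite e' wx in wz.
  have [zx _|_] := boolP (connect e z x); last by rewrite addbF; apply: vu.
  by rewrite -((labP _ uL) _ _ zx).
set S := \sum_(_ | _) _.
have hS : S = - S.
  rewrite {1}/S (reindex_inj (inv_inj hK)) /= (eq_bigl _ _ hP) -sumrN.
  apply: eq_bigr => v /and3P[vL _ _]; have [vz|vz] := boolP (v z).
    rewrite (@num_true_add (h v) v z) ?hL ?exprS ?mulN1r ?opprK //.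
      by rewrite ffunE vz connect0.
    move=> x; rewrite ffunE; case: (boolP (connect e z x)) => [/((labP _ vL) _ _)<-|_].
      by rewrite vz.
    by rewrite addbF orbF.
  rewrite (@num_true_add v (h v) z) ?hL ?exprS ?mulN1r //.
  move=> x; rewrite ffunE; case: (boolP (connect e z x)) => [/((labP _ vL) _ _)<-|_].
    by rewrite (negPf vz).
  by rewrite addbF orbF.
rewrite mulr0n; lia.
Qed.

End Labels.

Section Merge.
Variables (T : finType) (e e' : rel T) (a b : T).
Hypotheses (eC : connect_sym e) (eC' : connect_sym e').
Hypothesis ab : ~~ connect e a b.
Definition merged x := connect e a x || connect e b x.
Hypothesis mergeP : forall x y,
  connect e' x y = connect e x y || (merged x && merged y).
Implicit Types (u v w : {ffun T -> bool}) (x y z : T).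

Definition agree w u := [forall x, merged x || (u x == w x)].

Lemma merged_a : merged a. Proof. by rewrite /merged connect0. Qed.
Lemma merged_b : merged b. Proof. by rewrite /merged connect0 orbT. Qed.
Lemma merged_connect x y : connect e x y -> merged x = merged y.
Proof. by move=> xy; rewrite /merged !(same_connect_r eC xy). Qed.

Lemma lab_coarse v : lab e' v = lab e v && (v a == v b).
Proof.
apply/labP/andP => [vL|[/labP vL /eqP vab] x y].
  split; first by apply/labP => x y xy; apply: vL; rewrite mergeP xy.
  by apply/eqP/vL; rewrite mergeP merged_a merged_b orbT.
rewrite mergeP => /orP[/vL//|/andP[]].
by move=> /orP[]/vL <- /orP[]/vL <-.
Qed.

Lemma lab_merged v x : lab e' v -> merged x -> v x = v a.
Proof.
by rewrite lab_coarse => /andP[/labP vL /eqP vab] /orP[]/vL <-.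
Qed.

Lemma num_true_coarse v : lab e' v -> num_true e v = (num_true e' v + v a)%N.
Proof.
move=> vL'; have /andP[vL _] : lab e v && (v a == v b) by rewrite -lab_coarse.
rewrite (num_trueE eC vL).
pose f x := if merged x then fingraph.root e a else fingraph.root e x.
rewrite /num_true (@n_comp_imset _ _ eC' _ f); first last.
- move=> x y _ _; rewrite mergeP /f -(root_connect eC).
  case: ifP => mx; case: ifP => my; rewrite ?andbT ?andbF ?orbF ?orbT ?eqxx //.
    rewrite (root_connect eC) (root_connect eC); apply/idP/idP => xy.
      by rewrite (merged_connect xy) my in mx.
    by rewrite -(merged_connect xy) merged_a in my.
  rewrite (root_connect eC) (root_connect eC); apply/idP/idP => xy.
    by rewrite (merged_connect xy) my in mx.
  by rewrite (merged_connect xy) merged_a in mx.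
- by move=> x y /((labP _ _ vL') _ _); rewrite !inE => ->.
have [va|va] := boolP (v a); last first.
  rewrite addn0; apply: eq_card => y.
  suff fE x : v x -> f x = fingraph.root e x.
    by apply/imsetP/imsetP => -[x]; rewrite inE => vx ->; exists x; rewrite ?inE ?fE.
  move=> vx; rewrite /f; case: ifP => // /(lab_merged vL') e1.
  by rewrite e1 (negPf va) in vx.
have vb : v b by rewrite (lab_merged vL' merged_b).
rewrite (cardsD1 (fingraph.root e b)) addnC imset_f ?inE //; congr addn.
apply: eq_card => y; rewrite !inE; apply/andP/imsetP => [[yb /imsetP[x]]|[x]].
  rewrite inE => vx yE; rewrite yE in yb *.
  rewrite /f; have [/orP[]|mx] := boolP (merged x); last 2 first.
  - by rewrite -(root_connect eC) eq_sym (negPf yb).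
  - by exists x; rewrite ?inE // (negPf mx).
  move=> ax; exists a; rewrite ?inE // merged_a.
  by apply/eqP; rewrite (root_connect eC) eC.
rewrite inE => vx ->; rewrite /f; case: ifP => mx.
  by rewrite (root_connect eC) ab; split=> //; apply: imset_f; rewrite inE.
split; last by apply: imset_f; rewrite inE.
by rewrite (root_connect eC) eC; apply/negP => bx; rewrite /merged bx orbT in mx.
Qed.

Lemma num_true_remove w z : lab e w ->
  num_true e w = (num_true e [ffun x => w x && ~~ connect e z x] + w z)%N.
Proof.
move=> wL; have [wz|wz] := boolP (w z); last first.
  rewrite addn0; congr num_true; apply/ffunP => x; rewrite ffunE.
  case: (boolP (connect e z x)) => [/((labP _ _ wL) _ _)<-|_]; last by rewrite andbT.
  by rewrite (negPf wz).
rewrite addn1; apply: (@num_true_add _ _ eC _ _ z) => //.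
- apply/labP => x y xy; rewrite !ffunE ((labP _ _ wL) _ _ xy).
  by rewrite (same_connect_r eC xy).
- by rewrite ffunE connect0 andbF.
move=> x; rewrite ffunE; case: (boolP (connect e z x)) => [/((labP _ _ wL) _ _)<-|_].
  by rewrite wz.
by rewrite andbT orbF.
Qed.

Lemma num_true_outside w : lab e w ->
  num_true e w = (num_true e [ffun x => w x && ~~ merged x] + w a + w b)%N.
Proof.
move=> wL; rewrite (num_true_remove b wL).
rewrite (@num_true_remove [ffun x => w x && ~~ connect e b x] a); last first.
  apply/labP => x y xy; rewrite !ffunE ((labP _ _ wL) _ _ xy).
  by rewrite (same_connect_r eC xy).
rewrite ffunE [connect e b a]eC ab andbT; congr (num_true e _ + _ + _)%N.
by apply/ffunP => x; rewrite !ffunE /merged negb_or -andbA [(~~ _) && (~~ _)]andbC.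
Qed.

(** Both sides count the true classes away from [a] and [b], plus the same three labels. This is the
    degree bookkeeping of an edge, for a merge and, read backwards, for a split. *)
Lemma num_true_merge w u : lab e w -> lab e' u -> agree w u ->
  (num_true e w + u a = num_true e' u + w a + w b)%N.
Proof.
move=> wL uL' /forallP wu; have := uL'; rewrite lab_coarse => /andP[uL /eqP uab].
have := num_true_coarse uL'; rewrite (num_true_outside uL) (num_true_outside wL).
have -> : [ffun x => u x && ~~ merged x] = [ffun x => w x && ~~ merged x].
  apply/ffunP => x; rewrite !ffunE; have /orP[->|/eqP->//] := wu x.
  by rewrite !andbF.
by rewrite -uab; lia.
Qed.

(* The Frobenius algebra Z[X]/(X^2 - X): here [m (X * X) = X] and
   [Delta 1 = 1 * X + X * 1 - 1 * 1]. *)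
Definition m_deformed (x y z : bool) : int := ((x || y) == z)%:R.
Definition Delta_deformed (x y z : bool) : int :=
  if x then (y && z)%:R else (y != z)%:R - (~~ y && ~~ z)%:R.

(** A monomial [w] evaluated at a colouring [v] of the circles by roots is 1 iff all circles
    labelled X have colour 1, that is, iff [sublab w v]. Evaluation is multiplicative, so the
    product evaluates as its two factors do at the same colouring. *)
Lemma merge_sum w v : lab e w -> lab e' v ->
  \sum_(u | lab e' u) (agree w u)%:R * m_deformed (w a) (w b) (u a)
     * (sublab u v)%:R = (sublab w v)%:R :> int.
Proof.
move=> wL vL'; pose u0 : {ffun T -> bool} :=
  [ffun x => if merged x then w a || w b else w x].
have u0L : lab e' u0.
  rewrite lab_coarse !ffunE merged_a merged_b eqxx andbT.
  by apply/labP => x y xy; rewrite !ffunE (merged_connect xy) ((labP _ _ wL) _ _ xy).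
have wu0 : agree w u0 by apply/forallP => x; rewrite ffunE; case: (merged x) => //=.
rewrite (bigD1 u0) //= wu0 /m_deformed [u0 a]ffunE merged_a eqxx !mul1r.
rewrite big1 ?addr0 => [|u /andP[uL uu0]].
  congr (nat_of_bool _)%:R; apply/sublabP/sublabP => H x.
    move=> wx; apply: H; rewrite ffunE; case: ifP => // /orP[]/((labP _ _ wL) _ _).
      by rewrite wx => ->.
    by rewrite wx => ->; rewrite orbT.
  rewrite ffunE; case: ifP => [mx|_]; last exact: H.
  rewrite (lab_merged vL' mx) => /orP[/H//|/H].
  by rewrite (lab_merged vL' merged_b).
have [wu|] := boolP (agree w u); last by rewrite !mul0r.
case: eqP => [e1|]; last by rewrite !(mulr0, mul0r).
case/eqP: uu0; apply/ffunP => x; rewrite ffunE; case: ifP => mx.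
  by rewrite (lab_merged uL mx) e1.
by have /forallP/(_ x) := wu; rewrite mx => /eqP.
Qed.

(** [Delta] is multiplication by [x + y - 1]. At a pair of roots this is 0 if they differ and the
    derivative [2x - 1] of [x^2 - x] if they agree: 1 for colour 1 and -1 for colour 0. *)
Lemma split_sum w v : lab e' w -> lab e v ->
  \sum_(u | lab e u) (agree w u)%:R * Delta_deformed (w a) (u a) (u b)
     * (sublab u v)%:R
  = (lab e' v)%:R * (sublab w v)%:R * (if v a then 1 else -1) :> int.
Proof.
move=> wL' vL; have := wL'; rewrite lab_coarse => /andP[wL /eqP wab].
(* A labelling agreeing with [w] off the two new circles is determined by its labels there, so the
   sum becomes one over pairs of labels. *)
pose U (p : bool * bool) : {ffun T -> bool} := [ffun x =>
  if connect e a x then p.1 else if connect e b x then p.2 else w x].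
have Ua p : U p a = p.1 by rewrite ffunE connect0.
have Ub p : U p b = p.2 by rewrite ffunE (negPf ab) connect0.
have UL p : lab e (U p).
  apply/labP => x y xy; rewrite !ffunE !(same_connect_r eC xy).
  by rewrite ((labP _ _ wL) _ _ xy).
have wU p : agree w (U p).
  apply/forallP => x; rewrite ffunE /merged.
  by case: (connect e a x) => //=; case: (connect e b x) => /=.
pose out := [forall x, (w x && ~~ merged x) ==> v x].
have outP : reflect (forall x, w x -> ~~ merged x -> v x) out.
  apply: (iffP forallP) => H x; first by move=> wx mx; have := H x; rewrite wx mx.
  by apply/implyP => /andP[]; apply: H.
have subU p : sublab (U p) v = [&& p.1 ==> v a, p.2 ==> v b & out].
  apply/sublabP/and3P => [H|[/implyP pa /implyP pb /outP po] x].
    split; [apply/implyP => p1; apply: H | apply/implyP => p2; apply: H |].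
    - by rewrite Ua.
    - by rewrite Ub.
    apply/outP => x wx; rewrite negb_or => /andP[/negPf ax /negPf bx].
    by apply: H; rewrite ffunE ax bx.
  rewrite ffunE; case: ifP => [/((labP _ _ vL) _ _) <-//|ax].
  case: ifP => [/((labP _ _ vL) _ _) <-//|bx] /po.
  by rewrite /merged ax bx; apply.
have subw : sublab w v = [&& w a ==> v a, w a ==> v b & out].
  have wx0 x : merged x -> w x = w a by exact: lab_merged.
  apply/sublabP/and3P => [H|[/implyP pa /implyP pb /outP po] x].
    split; [apply/implyP | apply/implyP; rewrite wab |]; try exact: H.
    by apply/outP => x wx _; apply: H.
  case: (boolP (merged x)) => mx; last by move/po; apply.
  by rewrite wx0 //; case/orP: mx => /((labP _ _ vL) _ _) <-.
transitivity (\sum_(p : bool * bool) Delta_deformed (w a) p.1 p.2 *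
    (sublab (U p) v)%:R).
  rewrite (partition_big (fun u : {ffun T -> bool} => (u a, u b)) predT) //=.
  apply: eq_bigr => p _; rewrite (bigD1 (U p)) /=; last first.
    by rewrite UL Ua Ub; case: p => p1 p2 /=.
  rewrite wU mul1r Ua Ub big1 ?addr0 // => u /andP[/andP[uL /eqP pE] uU].
  have [/forallP wu|] := boolP (agree w u); last by rewrite !mul0r.
  case/eqP: uU; apply/ffunP => x; rewrite ffunE -pE /=.
  case: ifP => [/((labP _ _ uL) _ _) //|ax].
  case: ifP => [/((labP _ _ uL) _ _) //|bx].
  by have := wu x; rewrite /merged ax bx => /eqP.
rewrite (eq_bigr (fun p => Delta_deformed (w a) p.1 p.2 *
   [&& p.1 ==> v a, p.2 ==> v b & out]%:R)); last by move=> p _; rewrite subU.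
rewrite subw lab_coarse vL /= -(pair_bigA _ (fun y z : bool => Delta_deformed (w a) y z *
   [&& y ==> v a, z ==> v b & out]%:R)) /= !big_bool /=.
rewrite /Delta_deformed.
by case: (w a); case: (v a); case: (v b); case: (out).
Qed.

End Merge.

(** * Surgery at a crossing *)

Section Edges.
Variable D : link_diagram.
Local Notation n := (crossings D).
Local Notation a := (@Defs.arc D).
Local Notation cr := (@circle_rel D).
Local Notation e0 c := (inl (c, 0) : point D).
Local Notation e2 c := (inl (c, 2) : point D).
Implicit Types (I J : smoothing D) (c : 'I_n) (w u v : labelling D).

Lemma connect_arc I x : connect (cr I) (inl x) (inl (a x)).
Proof. by apply: connect1; rewrite /= eqxx. Qed.

Lemma connect_smooth I x : connect (cr I) (inl x) (inl (smooth I x)).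
Proof. by apply: connect1; rewrite /= eqxx orbT. Qed.

Lemma merged_end I c k : merged (cr I) (e0 c) (e2 c) (inl (c, k)).
Proof.
rewrite /merged; have h0 := connect_smooth I (c, 0).
have h2 := connect_smooth I (c, 2).
have E (i j : 'Z_4) : i = j -> (c, i) = (c, j) by move->.
elim/Z4_ind: k; rewrite ?connect0 ?orbT //.
  move: h0 h2; rewrite /smooth /=; case: (c \in I) => h0 h2; apply/orP.
    by right; rewrite -(E (3 - 2) 1) //; apply: val_inj.
  by left; rewrite -(E (1 - 0) 1) //; apply: val_inj.
move: h0 h2; rewrite /smooth /=; case: (c \in I) => h0 h2; apply/orP.
  by left; rewrite -(E (3 - 0) 3) //; apply: val_inj.
by right; rewrite -(E (1 - 2) 3) //; apply: val_inj.
Qed.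

(** Symmetric in the direction of the edge, so that it serves a merge with [J = c |: I] and a split
    with the roles exchanged. All four ends at [c] lie on one circle of [J], so passing from [I] to
    [J] just glues the circles of [I] through [c]. *)
Lemma surgery_merge I J c : (forall d, d != c -> (d \in I) = (d \in J)) ->
  connect (cr J) (e0 c) (e2 c) ->
  forall x y, connect (cr J) x y = connect (cr I) x y ||
    (merged (cr I) (e0 c) (e2 c) x && merged (cr I) (e0 c) (e2 c) y).
Proof.
move=> IJ cJ x y; set m := merged (cr I) (e0 c) (e2 c).
have sIJ z : z.1 != c -> smooth I z = smooth J z by move=> zc; rewrite /smooth IJ.
have endJ k : connect (cr J) (e0 c) (inl (c, k)).
  by have /orP[//|] := merged_end J c k; apply: connect_trans.
have IsubJ : subrel (connect (cr I)) (connect (cr J)).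
  apply: connect_sub => -[z|//] [z'|//] /orP[] /eqP->; first exact: connect_arc.
  have [|zc] := eqVneq z.1 c; last by rewrite sIJ //; apply: connect_smooth.
  case: z => _ k /= ->; rewrite /smooth /=.
  by apply: connect_trans (endJ _); rewrite circle_connect_sym.
have mJ z : m z -> connect (cr J) (e0 c) z.
  by case/orP => /IsubJ //; apply: connect_trans.
apply/idP/orP => [xy|[/IsubJ//|/andP[/mJ mx /mJ my]]]; last first.
  by apply: connect_trans my; rewrite circle_connect_sym.
pose S := [pred y | connect (cr I) x y || (m x && m y)].
suff clS : closed (cr J) S.
  have := closed_connect clS xy; rewrite !inE connect0 /= => /esym/orP[]; by [left|right].
apply: (intro_closed (@circle_connect_sym D J)) => -[z|//] [z'|//] /=.
have mC := @merged_connect _ (cr I) (e0 c) (e2 c) (@circle_connect_sym D I).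
rewrite !inE => zz'.
have [zz'I|nI] := boolP (connect (cr I) (inl z) (inl z')).
  rewrite -(same_connect_r (@circle_connect_sym D I) zz'I).
  by rewrite /m -(mC _ _ zz'I).
have mzz' : m (inl z) && m (inl z').
  case/orP: zz' nI => /eqP->; first by rewrite connect_arc.
  have [|zc] := eqVneq z.1 c; last by rewrite -sIJ // connect_smooth.
  by case: z => _ k /= ->; rewrite /m !merged_end.
case/andP: mzz' => mz mz'; rewrite mz mz' !andbT.
case/orP => [xz|->]; last by rewrite orbT.
by rewrite /m (mC _ _ xz) -/m mz orbT.
Qed.

Definition conn_ends I c := connect (cr I) (e0 c) (e2 c).

Lemma in_addC I c d : d != c -> (d \in I) = (d \in c |: I).
Proof. by move=> dc; rewrite in_setU1 (negPf dc). Qed.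

Lemma merge_edge I c : c \notin I -> ~~ conn_ends I c ->
  forall x y, connect (cr (c |: I)) x y = connect (cr I) x y ||
    (merged (cr I) (e0 c) (e2 c) x && merged (cr I) (e0 c) (e2 c) y).
Proof.
move=> cI nc; apply: surgery_merge; first exact: in_addC.
by rewrite surgery_circles.
Qed.

Lemma split_edge I c : conn_ends I c ->
  forall x y, connect (cr I) x y = connect (cr (c |: I)) x y ||
    (merged (cr (c |: I)) (e0 c) (e2 c) x && merged (cr (c |: I)) (e0 c) (e2 c) y).
Proof.
by move=> nc; apply: surgery_merge => // d dc; rewrite -in_addC.
Qed.

Definition agree_off I c w u : bool :=
  [forall x, [|| connect (cr I) (e0 c) x, connect (cr I) (e2 c) x | u x == w x]].

Definition edge_deformed I c w u : int := (agree_off I c w u)%:R *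
  (if conn_ends I c then Delta_deformed (w (e0 c)) (u (e0 c)) (u (e2 c))
   else m_deformed (w (e0 c)) (w (e2 c)) (u (e0 c))).

Lemma agree_merge I c w u : agree_off I c w u = agree (cr I) (e0 c) (e2 c) w u.
Proof. by apply: eq_forallb => x; rewrite orbA. Qed.

Lemma agree_split I c w u : conn_ends I c ->
  agree_off I c w u = agree (cr (c |: I)) (e0 c) (e2 c) w u.
Proof.
move=> nc; rewrite agree_merge; apply: eq_forallb => x; congr orb.
have H y z := split_edge nc y z.
rewrite {1}/merged -(same_connect (@circle_connect_sym D I) nc) orbb H.
rewrite merged_a /=; apply/orP/idP => [[xa|//]|]; last by right.
by rewrite /merged xa.
Qed.

Definition num_circles I : nat := n_comp (cr I) predT.

Lemma label_degreeE I w :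
  label_degree I w = (num_circles I)%:Z - 2 * (num_true (cr I) w)%:Z.
Proof.
rewrite /label_degree /num_circles (n_compC [pred x | w x]) /num_true.
have -> : n_comp (cr I) [predC [pred x | w x]] = n_comp (cr I) [pred x | ~~ w x].
  by apply: eq_n_comp_r => x; rewrite !inE.
set p := n_comp _ _; set q := n_comp _ _; lia.
Qed.

Lemma num_circlesE I : num_circles I = num_true (cr I) [ffun=> true].
Proof. by apply: eq_n_comp_r => x; rewrite !inE ffunE. Qed.

Lemma lab_true I : lab (cr I) [ffun=> true].
Proof. by apply/labP => x y _; rewrite !ffunE. Qed.

Lemma num_circles_merge I c : c \notin I -> ~~ conn_ends I c ->
  num_circles I = (num_circles (c |: I)).+1.
Proof.
move=> cI nc; rewrite !num_circlesE.
rewrite (num_true_coarse (@circle_connect_sym D I)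
  (@circle_connect_sym D (c |: I)) nc (merge_edge cI nc) (lab_true _)).
by rewrite ffunE addn1.
Qed.

Lemma num_circles_split I c : c \notin I -> conn_ends I c ->
  num_circles (c |: I) = (num_circles I).+1.
Proof.
move=> cI nc; rewrite !num_circlesE.
have nc' : ~~ conn_ends (c |: I) c by rewrite /conn_ends surgery_circles // negbK.
rewrite (num_true_coarse (@circle_connect_sym D (c |: I))
  (@circle_connect_sym D I) nc' (split_edge nc) (lab_true _)).
by rewrite ffunE addn1.
Qed.

(** The terms added by the deformation are [X * X = X] and the [- 1 * 1] in [Delta 1]. Compared with
    a term preserving the degree, each has one X fewer, which is worth 2. *)
Lemma edge_degree I c w u : c \notin I -> lab (cr I) w -> lab (cr (c |: I)) u ->
  (edge_coef I c w u -> edge_deformed I c w u = 1 /\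
     poly_degree (c |: I) u = poly_degree I w) /\
  (~~ edge_coef I c w u -> edge_deformed I c w u != 0 ->
     poly_degree (c |: I) u = poly_degree I w + 2).
Proof.
move=> cI wL uL; rewrite /edge_coef /edge_deformed -/(agree_off I c w u).
rewrite -/(conn_ends I c) /poly_degree !label_degreeE cardsU1 cI.
have [ag|] := boolP (agree_off I c w u); last by rewrite /= mul0r eqxx.
rewrite /= mul1r; have [nc|nc] := boolP (conn_ends I c).
  have nc' : ~~ conn_ends (c |: I) c by rewrite /conn_ends surgery_circles // negbK.
  have := num_circles_split cI nc; rewrite agree_split // in ag.
  have ag' : agree (cr (c |: I)) (e0 c) (e2 c) u w.
    by apply/forallP => x; rewrite eq_sym; apply: (forallP ag).
  have := num_true_merge (@circle_connect_sym D (c |: I))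
    (@circle_connect_sym D I) nc' (split_edge nc) uL wL ag'.
  rewrite /Delta_coef /Delta_deformed.
  by case: (w _); case: (u (e0 c)); case: (u (e2 c)) => /= h1 h2;
    split=> // *; try split; lia.
have := num_circles_merge cI nc; rewrite agree_merge in ag.
have := num_true_merge (@circle_connect_sym D I)
    (@circle_connect_sym D (c |: I)) nc (merge_edge cI nc) wL uL ag.
rewrite /m_coef /m_deformed.
by case: (w (e0 c)); case: (w (e2 c)); case: (u (e0 c)) => /= h1 h2;
    split=> // *; try split; lia.
Qed.

Definition edge_sign I c v : int :=
  if conn_ends I c && ~~ v (e0 c) then -1 else 1.

Lemma edge_sum I c w v : c \notin I -> lab (cr I) w -> lab (cr (c |: I)) v ->
  \sum_(u | lab (cr (c |: I)) u) edge_deformed I c w u * (sublab u v)%:R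
  = (lab (cr I) v)%:R * (sublab w v)%:R * edge_sign I c v.
Proof.
move=> cI wL vL; rewrite /edge_sign; have [nc|nc] /= := boolP (conn_ends I c).
  have nc' : ~~ conn_ends (c |: I) c by rewrite /conn_ends surgery_circles // negbK.
  rewrite -[if _ then _ else _](if_neg) negbK.
  rewrite -(split_sum (@circle_connect_sym D (c |: I)) nc' (split_edge nc) wL vL).
  apply: eq_bigr => u _; rewrite /edge_deformed nc agree_split //.
have := vL; rewrite (lab_coarse (merge_edge cI nc)).
case/andP => -> _; rewrite mul1r mulr1.
rewrite -(merge_sum (@circle_connect_sym D I) (merge_edge cI nc) wL vL).
by apply: eq_bigr => u _; rewrite /edge_deformed (negPf nc) agree_merge.
Qed.

End Edges.

(** * The deformed complex and its diagonalisation *)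

Section Cube.
Variable n : nat.
Implicit Types (I J K : {set 'I_n}) (c : 'I_n).

Definition cube_sign I c : int := (-1) ^+ #|[set b in I | (b < c)%N]|.

Definition cube_diff I J : int :=
  \sum_(c | (c \notin I) && (J == c |: I)) cube_sign I c.

Lemma cube_sign_sqr I c : cube_sign I c * cube_sign I c = 1.
Proof. by rewrite /cube_sign -expr2 sqrr_sign. Qed.

Lemma cube_sign_add I c c0 : c0 \notin I ->
  cube_sign (c0 |: I) c = (if (c0 < c)%N then -1 else 1) * cube_sign I c.
Proof.
move=> c0I; rewrite /cube_sign; have [lt|ge] := ifP.
  have -> : [set b in c0 |: I | (b < c)%N] = c0 |: [set b in I | (b < c)%N].
    by apply/setP => b; rewrite !inE; have [->|] := eqVneq b c0.
  by rewrite cardsU1 inE (negPf c0I) /= exprS.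
rewrite mul1r; congr (_ ^+ #|pred_of_set _|); apply/setP => b; rewrite !inE.
by have [->|] := eqVneq b c0; rewrite //= ge andbF.
Qed.

Lemma cube_sign_anti I c c0 : c \notin I -> c0 \notin I -> c != c0 ->
  cube_sign (c0 |: I) c * cube_sign I c0 = - (cube_sign (c |: I) c0 * cube_sign I c).
Proof.
move=> cI c0I cc0; rewrite !cube_sign_add // -!mulrA [cube_sign I c * _]mulrC.
have : (c : nat) != c0 by [].
by case: (ltngtP c c0) => // _ _; rewrite ?mul1r ?mulN1r ?opprK.
Qed.

Lemma setU1_inj I c c' : c \notin I -> c' \notin I -> c |: I = c' |: I -> c = c'.
Proof.
move=> cI c'I e; have : c \in c' |: I by rewrite -e setU11.
by rewrite in_setU1 (negPf cI) orbF => /eqP.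
Qed.

Lemma cube_diffE I c : c \notin I -> cube_diff I (c |: I) = cube_sign I c.
Proof.
move=> cI; rewrite /cube_diff (big_pred1 c) // => c' /=.
apply/andP/eqP => [[c'I /eqP e]|->]; last by [].
by apply/esym/(setU1_inj cI c'I).
Qed.

Lemma cube_diffP I J : cube_diff I J != 0 -> exists2 c, c \notin I & J = c |: I.
Proof.
have [c /andP[cI /eqP ->] _|no] := pickP (fun c => (c \notin I) && (J == c |: I)).
  by exists c.
by rewrite /cube_diff big_pred0 ?eqxx.
Qed.

Lemma sum_cube_diff I (F : {set 'I_n} -> int) :
  \sum_J cube_diff I J * F J = \sum_(c | c \notin I) cube_sign I c * F (c |: I).
Proof.
rewrite /cube_diff; under eq_bigr => J _ do rewrite big_distrl /=.
rewrite (exchange_big_dep (fun c => c \notin I)) /=; last by move=> J c _ /andP[].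
apply: eq_bigr => c cI; rewrite (big_pred1 (c |: I)) // => J /=.
by rewrite cI.
Qed.

Lemma cube_diff_sqr I K : \sum_J cube_diff I J * cube_diff J K = 0.
Proof.
rewrite sum_cube_diff.
pose g c c' : int := if [&& c \notin I, c' \notin I, c' != c & K == c' |: (c |: I)]
  then cube_sign (c |: I) c' * cube_sign I c else 0.
transitivity (\sum_c \sum_c' g c c').
  rewrite big_mkcond; apply: eq_bigr => c _; rewrite /g.
  have [cI|] := boolP (c \in I); first by rewrite /= big1.
  move=> cI; rewrite /cube_diff big_distrr big_mkcond /=; apply: eq_bigr => c' _.
  by rewrite in_setU1 negb_or [(_ != _) && (_ \notin _)]andbC -andbA mulrC.
have gN c c' : g c c' = - g c' c.
  rewrite /g [c == c']eq_sym setUCA -![c |: (c' |: I)]setUCA.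
  rewrite [(c \notin I) && _]andbCA.
  case: ifP => [/and4P[c'I cI cc' _]|]; last by rewrite oppr0.
  by rewrite cube_sign_anti.
set S := (LHS); suff : S = - S by lia.
rewrite {1}/S exchange_big /= -sumrN; apply: eq_bigr => c _; rewrite -sumrN.
by apply: eq_bigr => c' _; rewrite -gN.
Qed.

(** The edge maps in direction [c0] are multiplications by a sign, so going back along them
    contracts the cube. The summands are the entries at [(I, K)] of the differential followed by the
    contraction and of the contraction followed by the differential. *)
Lemma cube_homotopy c0 I K :
  (if c0 \in K then 0 else cube_diff I (c0 |: K) * cube_sign K c0) +
  (if c0 \in I then cube_sign (I :\ c0) c0 * cube_diff (I :\ c0) K else 0)
  = (I == K)%:R.
Proof.
case: ifP => cK; case: ifP => cI.
- rewrite add0r; have c0I : c0 \notin I :\ c0 by rewrite !inE eqxx.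
  have [<-|neq] := eqVneq I K.
    by rewrite -{3}(setD1K cI) cube_diffE // cube_sign_sqr.
  have [->|/cube_diffP[c cI' KE]] := eqVneq (cube_diff (I :\ c0) K) 0.
    by rewrite mulr0.
  move: cK; rewrite KE in_setU1 (negPf c0I) orbF => /eqP cc0.
  by case/eqP: neq; rewrite KE -cc0 setD1K.
- by rewrite addr0; case: eqP => // e; rewrite e cK in cI.
- have [I0 IE c0I0] : exists2 I0, I = c0 |: I0 & c0 \notin I0.
    by exists (I :\ c0); rewrite ?setD1K // !inE eqxx.
  have -> : (I == K) = false by apply/eqP => e; rewrite e cK in cI.
  rewrite IE setU1K //.
  have [[c cI0 KE]|no] : (exists2 c, c \notin I0 & K = c |: I0) \/
       (forall c, c \notin I0 -> K <> c |: I0).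
    case: (pickP (fun c => (c \notin I0) && (K == c |: I0))) => [c /andP[? /eqP]|no].
      by left; exists c.
    by right=> c cI0 KE; have := no c; rewrite cI0 KE eqxx.
    rewrite KE; have cc0 : c != c0.
      by apply/eqP => e; move: cK; rewrite KE e setU11.
    rewrite setUCA cube_diffE; last by rewrite !inE negb_or cc0.
    rewrite cube_diffE // !cube_sign_add //.
    have : (c : nat) != c0 by [].
    by case: (ltngtP c c0) => // _ _; rewrite ?mul1r ?mulN1r ?mulNr ?mulrN
      [cube_sign I0 c * _]mulrC addNr.
  have -> : cube_diff I0 K = 0.
    by apply: contra_not_eq (_ : ~ _); [apply: cube_diffP | case=> c /no].
  have [->|/cube_diffP[c cI' KE]] := eqVneq (cube_diff (c0 |: I0) (c0 |: K)) 0.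
    by rewrite mul0r mulr0.
  case: (no c); first by apply: contraNN cI'; apply: setU1r.
  have cc0 : c0 != c by apply: contraNneq cI' => <-; rewrite setU11.
  rewrite -[K](setU1K (negbT cK)) KE setUCA setU1K //.
  by rewrite in_setU1 negb_or cc0.
- rewrite addr0.
  have [<-|neq] := eqVneq I K; first by rewrite cube_diffE ?cI // cube_sign_sqr.
  have [->|/cube_diffP[c cI' KE]] := eqVneq (cube_diff I (c0 |: K)) 0.
    by rewrite mul0r.
  have cc0 : c0 = c.
    have : c0 \in c |: I by rewrite -KE setU11.
    by rewrite in_setU1 cI orbF => /eqP.
  case/eqP: neq; rewrite -(setU1K (negbT cI)) -(setU1K (negbT cK)) KE cc0.
  by [].
Qed.

End Cube.

Section FunMatrix.
Variables (R : pzRingType) (S : finType).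
Implicit Types A B : S -> S -> R.

Definition fun_mx A : 'M[R]_#|S| := \matrix_(i, j) A (enum_val i) (enum_val j).

Lemma fun_mxM A B :
  fun_mx A *m fun_mx B = fun_mx (fun x y => \sum_z A x z * B z y).
Proof.
apply/matrixP => i j; rewrite !mxE.
rewrite [RHS](reindex (@enum_val S S)); last exact: onW_bij (enum_val_bij S).
by apply: eq_bigr => k _; rewrite !mxE.
Qed.

Lemma eq_fun_mx A B : (forall x y, A x y = B x y) -> fun_mx A = fun_mx B.
Proof. by move=> AB; apply/matrixP => i j; rewrite !mxE. Qed.

Lemma fun_mx1 : fun_mx (fun x y => (x == y)%:R) = 1%:M.
Proof. by apply/matrixP => i j; rewrite !mxE (inj_eq enum_val_inj). Qed.

End FunMatrix.

(** * The generators of the total complex and the signs of its edges *)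

Section States.
Variable D : link_diagram.
Local Notation n := (crossings D).
Local Notation cr := (@circle_rel D).
Local Notation e0 c := (inl (c, 0) : point D).
Implicit Types (I J K : smoothing D) (c : 'I_n) (w u v : labelling D).

Definition state := {x in [pred x : smoothing D * labelling D | lab (cr x.1) x.2]}.
HB.instance Definition _ := Finite.on state.
Implicit Types x y z : state.

Definition st_set x : smoothing D := (val x).1.
Definition st_lab x : labelling D := (val x).2.

Lemma stP x : lab (cr (st_set x)) (st_lab x).
Proof. by have := valP x; rewrite inE. Qed.

Lemma st_eqE x y : (x == y) = (st_set x == st_set y) && (st_lab x == st_lab y).
Proof. by rewrite -val_eqE /st_set /st_lab; case: (val x) (val y) => [? ?] [? ?]. Qed.

Lemma sum_state (R : nmodType) (G : smoothing D -> labelling D -> R) :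
  \sum_(z : state) G (st_set z) (st_lab z) = \sum_I \sum_(u | lab (cr I) u) G I u.
Proof.
rewrite pair_big_dep /=.
rewrite (eq_bigl (mem [pred x : smoothing D * labelling D | lab (cr x.1) x.2]));
  last by case=> I u; rewrite !inE.
exact: esym (big_sub _ (fun p => G p.1 p.2)).
Qed.

Lemma sum_state_set (R : pzSemiRingType) I (G : labelling D -> R) :
  \sum_(z : state) (I == st_set z)%:R * G (st_lab z) = \sum_(u | lab (cr I) u) G u.
Proof.
rewrite (sum_state (fun J u => (I == J)%:R * G u)) (bigD1 I) //= [X in _ + X]big1 => [|J JI].
  by rewrite addr0; apply: eq_bigr => u _; rewrite eqxx mul1r.
by rewrite big1 // => u _; rewrite eq_sym (negPf JI) mul0r.
Qed.

Lemma sum_state_lab (R : pzSemiRingType) w (G : smoothing D -> R) :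
  \sum_(z : state) (w == st_lab z)%:R * G (st_set z) = \sum_(I | lab (cr I) w) G I.
Proof.
rewrite (sum_state (fun J u => (w == u)%:R * G J)) [RHS]big_mkcond /=.
apply: eq_bigr => I _; rewrite big_mkcond (bigD1 w) //= [X in _ + X]big1 => [|u uw].
  by rewrite addr0 eqxx mul1r.
by rewrite eq_sym (negPf uw) mul0r if_same.
Qed.

Definition neg_lab v : labelling D := [ffun x => ~~ v x].

Lemma neg_labK : involutive neg_lab.
Proof. by move=> v; apply/ffunP => x; rewrite !ffunE negbK. Qed.

Lemma lab_neg I v : lab (cr I) (neg_lab v) = lab (cr I) v.
Proof.
suff H u : lab (cr I) u -> lab (cr I) (neg_lab u).
  by apply/idP/idP => [/H|/H //]; rewrite neg_labK.
by move/labP => uL; apply/labP => x y /uL; rewrite !ffunE => ->.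
Qed.

(** At each crossing [J] agrees with [I] or with [K]: the smoothings compatible with a colouring
    form a convex subset of the cube. *)
Lemma lab_between I J K v : I \subset J -> J \subset K ->
  lab (cr I) v -> lab (cr K) v -> lab (cr J) v.
Proof.
move=> /subsetP IJ /subsetP JK /forallP vI /forallP vK.
apply/forallP => x; apply/forallP => y.
have /forallP/(_ y) := vI x; have /forallP/(_ y) := vK x.
case: x y => [x|?] [y|?] //=; rewrite /smooth.
have := IJ x.1; have := JK x.1.
case: (x.1 \in I); case: (x.1 \in J); case: (x.1 \in K) => // h1 h2;
  by [have := h1 isT | have := h2 isT].
Qed.

(* A split edge at a circle of colour 0 acts by -1 on functions on colourings;
   [half_rank] trivialises this sign, since the number of circles of colour 0
   plus the number of 1-smoothings along them grows by 2 at a split and is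
   constant at a merge. *)
Definition half_rank I v : nat :=
  ((num_true (cr I) (neg_lab v) + #|[set c in I | ~~ v (e0 c)]|)./2)%N.

Definition half_circles I : nat := (num_circles I + #|I|)./2%N.

Lemma card_set_add (P : pred 'I_n) I c : c \notin I ->
  #|[set d in c |: I | P d]| = (P c + #|[set d in I | P d]|)%N.
Proof.
move=> cI; case: (boolP (P c)) => Pc.
  have -> : [set d in c |: I | P d] = c |: [set d in I | P d].
    by apply/setP => d; rewrite !inE; have [->|] := eqVneq d c.
  by rewrite cardsU1 inE (negPf cI).
rewrite add0n; apply: eq_card => d; rewrite !inE.
by have [->|] := eqVneq d c; rewrite /= ?(negPf Pc) ?andbF.
Qed.

Lemma edge_sign_half I c v : c \notin I -> lab (cr I) v -> lab (cr (c |: I)) v ->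
  edge_sign I c v = (-1) ^+ (half_rank I v + half_rank (c |: I) v).
Proof.
move=> cI vI vJ; rewrite /edge_sign /half_rank card_set_add //.
have nvI : lab (cr I) (neg_lab v) by rewrite lab_neg.
have nvJ : lab (cr (c |: I)) (neg_lab v) by rewrite lab_neg.
set k := #|_|; set p := num_true (cr I) _; set q := num_true _ _.
have [nc|nc] /= := boolP (conn_ends I c).
  have nc' : ~~ conn_ends (c |: I) c by rewrite /conn_ends surgery_circles // negbK.
  have := num_true_coarse (@circle_connect_sym D (c |: I))
    (@circle_connect_sym D I) nc' (split_edge nc) nvI.
  rewrite -/p -/q ffunE => ->; case: (v _) => /=.
    by rewrite addn0 add0n addnn -signr_odd odd_double.
  rewrite (_ : (p + 1 + (true + k))./2 = (p + k)./2.+1)%N; last first.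
    by rewrite addn1 addSn add1n addnS.
  by rewrite addnS addnn exprS -signr_odd odd_double mulr1.
have := num_true_coarse (@circle_connect_sym D I)
    (@circle_connect_sym D (c |: I)) nc (merge_edge cI nc) nvJ.
rewrite -/p -/q ffunE => ->; case: (v _) => /=.
  by rewrite addn0 add0n addnn -signr_odd odd_double.
by rewrite addn1 addnS addSn /= addnn -signr_odd odd_double.
Qed.

(** Complementing the colouring moves the sign -1 from splits at colour 0 to splits at colour 1. The
    two edge signs thus differ exactly at splits, where [half_circles] grows by 1; it is constant at
    merges. *)
Lemma half_circles_edge I c v : c \notin I -> lab (cr I) v -> lab (cr (c |: I)) v ->
  edge_sign I c (neg_lab v) * (-1) ^+ half_circles I
  = edge_sign I c v * (-1) ^+ half_circles (c |: I) :> int.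
Proof.
move=> cI vI vJ; rewrite /edge_sign /half_circles cardsU1 cI ffunE negbK.
have [nc|nc] /= := boolP (conn_ends I c).
  rewrite (num_circles_split cI nc) addnS addSn /= exprS mulN1r.
  by case: (v _); rewrite /= ?mul1r ?mulN1r ?opprK.
by rewrite (num_circles_merge cI nc) addSn add1n addnS.
Qed.

End States.

Lemma sign_cancel (a b b' s1 s2 : int) : a ^+ 2 = 1 ->
  s1 * a * (s2 * (a * b * b')) = s1 * s2 * b * b'.
Proof. by move=> h; rewrite -[RHS]mulr1 -h; ring. Qed.

Lemma sign_cancel2 (a b s1 s2 : int) : a ^+ 2 = 1 ->
  s1 * (s2 * (b * a)) * a = s2 * b * s1.
Proof. by move=> h; rewrite -[RHS]mulr1 -h; ring. Qed.

(** * Change of basis from monomials to colourings *)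

Section Operators.
Variable D : link_diagram.
Local Notation n := (crossings D).
Local Notation cr := (@circle_rel D).
Local Notation e0 c := (inl (c, 0) : point D).
Local Notation St := (state D).
Implicit Types (I J K : smoothing D) (c : 'I_n) (w u v : labelling D) (x y z : St).

Definition deformed_coef x y : int :=
  \sum_(c | (c \notin st_set x) && (st_set y == c |: st_set x))
    cube_sign (st_set x) c * edge_deformed (st_set x) c (st_lab x) (st_lab y).

Definition diff_coef x y : int := differential_coef int (val x) (val y).

Definition state_half_rank x := half_rank (st_set x) (st_lab x).

(* The monomial indexed by [x], evaluated at the colouring [y] of the circles
   by the roots [0] and [1] of [X^2 = X]; the sign makes the edge maps of the
   cube restrictions of functions on colourings, without further signs. *)
Definition eval_coef x y : int := (st_set x == st_set y)%:R *
  ((sublab (st_lab x) (st_lab y))%:R * (-1) ^+ state_half_rank y).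

(** Moebius inversion on the Boolean lattice of labellings of a fixed smoothing. *)
Definition eval_inv_coef x y : int := (st_set x == st_set y)%:R *
  ((sublab (st_lab x) (st_lab y))%:R *
   (-1) ^+ (state_half_rank x + num_true (cr (st_set x)) (st_lab x)
                 + num_true (cr (st_set y)) (st_lab y))).

(** The differential in the basis of colourings: it keeps the colouring, so each colouring carries a
    cube complex of its own. *)
Definition diag_coef x y : int :=
  (st_lab x == st_lab y)%:R * cube_diff (st_set x) (st_set y).

Lemma evalK : fun_mx eval_coef *m fun_mx eval_inv_coef = 1%:M.
Proof.
rewrite fun_mxM -fun_mx1; apply: eq_fun_mx => x y.
rewrite st_eqE; case: eqP => [e|ne] /=; last first.
  apply: big1 => z _; rewrite /eval_coef /eval_inv_coef.
  case: eqP => [xz|]; last by rewrite !mul0r.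
  by case: eqP => [zy|]; rewrite ?mul0r ?mulr0 //; case: ne; rewrite xz.
pose num_X v := num_true (cr (st_set x)) v.
pose G v : int := ([&& lab (cr (st_set x)) v, sublab (st_lab x) v &
    sublab v (st_lab y)])%:R * (-1) ^+ num_X v * (-1) ^+ num_X (st_lab y).
transitivity (\sum_z (st_set x == st_set z)%:R * G (st_lab z)).
  apply: eq_bigr => z _; rewrite /eval_coef /eval_inv_coef /G -e [st_set z == _]eq_sym.
  case: eqP => [xz|]; last by rewrite !mul0r.
  have -> : lab (cr (st_set x)) (st_lab z) by rewrite xz stP.
  rewrite andTb !mul1r -xz -/(num_X _) -/(num_X _) !exprD -mulnb natrM.
  exact/sign_cancel/sqrr_sign.
rewrite sum_state_set /G -mulr_suml.
have yL : lab (cr (st_set x)) (st_lab y) by rewrite e stP.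
have [xy|nxy] := boolP (sublab (st_lab x) (st_lab y)); last first.
  rewrite big1 => [|v _]; last first.
    case: and3P => [[_ /sublabP xv /sublabP vy]|_]; last by rewrite mul0r.
    by case/sublabP: nxy => t /xv /vy.
  rewrite mul0r; case: eqP => // e1; case/sublabP: nxy => t; by rewrite e1.
have := alternating_sum (@circle_connect_sym D (st_set x)) (stP x) yL xy.
rewrite big_mkcond /= => alt.
rewrite [X in X * _](_ : _ = (-1) ^+ num_X (st_lab x) *+ (st_lab x == st_lab y)).
  by rewrite mulrnAl; case: eqP => [<-|//]; rewrite -expr2 sqrr_sign.
rewrite -alt big_mkcond; apply: eq_bigr => v _ /=.
by case: (lab _ v) => //=; case: (sublab _ v && _); rewrite ?mul1r ?mul0r.
Qed.

(** By [edge_sum], evaluation turns an edge map into restriction to the colourings compatible with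
    both smoothings, up to [edge_sign]; the factor [half_rank] in [eval_coef] absorbs that sign. *)
Lemma deformed_eval : fun_mx deformed_coef *m fun_mx eval_coef =
  fun_mx eval_coef *m fun_mx diag_coef.
Proof.
rewrite !fun_mxM; apply: eq_fun_mx => x y.
set I := st_set x; set J := st_set y; set w := st_lab x; set v := st_lab y.
pose B u : int := \sum_(c | (c \notin I) && (J == c |: I))
    cube_sign I c * edge_deformed I c w u.
pose G u : int := B u * ((sublab u v)%:R * (-1) ^+ state_half_rank y).
transitivity (\sum_z (J == st_set z)%:R * G (st_lab z)).
  apply: eq_bigr => z _; rewrite /deformed_coef /eval_coef /G /B [st_set z == _]eq_sym.
  by case: eqP => [<-|]; rewrite ?mul0r ?mulr0 // !mul1r.
rewrite sum_state_set.
pose F K : int := (I == K)%:R * ((sublab w v)%:R * (-1) ^+ half_rank K v *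
   cube_diff K J).
transitivity (\sum_z (v == st_lab z)%:R * F (st_set z)); last first.
  apply: eq_bigr => z _; rewrite /eval_coef /diag_coef /F /state_half_rank [st_lab z == _]eq_sym.
  by case: eqP => [<-|]; rewrite ?mul0r ?mulr0 // !mul1r !mulrA.
rewrite sum_state_lab [RHS]big_mkcond [RHS](bigD1 I) //= [X in _ = _ + X]big1 => [|K KI]; last first.
  by rewrite /F eq_sym (negPf KI) mul0r if_same.
rewrite addr0 /F eqxx mul1r /G /B.
under eq_bigr => u _ do rewrite mulrA big_distrl /=.
rewrite -mulr_suml exchange_big /=.
under eq_bigr => c /andP[cI /eqP JE].
  under eq_bigr => u _ do rewrite -mulrA.
  rewrite -mulr_sumr JE edge_sum; [|exact: cI|exact: stP|by rewrite -JE; exact: stP].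
  over.
rewrite /cube_diff; have [vI|] := boolP (lab (cr I) v); last first.
  by move=> _; rewrite big1 ?mul0r // => c _; rewrite !mul0r mulr0.
rewrite mulr_sumr mulr_suml; apply: eq_bigr => c /andP[cI /eqP JE].
rewrite edge_sign_half // -?JE; last exact: stP.
rewrite /state_half_rank -/J -/v exprD mul1r.
exact/sign_cancel2/sqrr_sign.
Qed.

Lemma diag_sqr : fun_mx diag_coef *m fun_mx diag_coef = 0.
Proof.
rewrite fun_mxM; apply/matrixP => i j; rewrite !mxE.
move: (enum_val i) (enum_val j) => x y; rewrite /diag_coef.
have [e|ne] := eqVneq (st_lab x) (st_lab y); last first.
  apply: big1 => z _; case: eqP => [xz|]; last by rewrite !mul0r.
  by rewrite -xz (negPf ne) mul0r mulr0.
transitivity (\sum_(z : St) (st_lab x == st_lab z)%:R *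
  (cube_diff (st_set x) (st_set z) * cube_diff (st_set z) (st_set y))).
  apply: eq_bigr => z _; rewrite -e [st_lab z == _]eq_sym.
  by case: eqP => _; rewrite ?mul0r // !mul1r.
rewrite (sum_state_lab (st_lab x) (fun K => cube_diff (st_set x) K * cube_diff K (st_set y))).
rewrite -[RHS](cube_diff_sqr (st_set x) (st_set y)) [LHS]big_mkcond /=.
apply: eq_bigr => K _; case: ifP => // nK.
have [->|/cube_diffP[c _ KE]] := eqVneq (cube_diff (st_set x) K) 0; first by rewrite mul0r.
have [->|/cube_diffP[c' _ yE]] := eqVneq (cube_diff K (st_set y)) 0; first by rewrite mulr0.
case/negP: nK; apply: (@lab_between _ (st_set x) K (st_set y)).
- by rewrite KE subsetUr.
- by rewrite yE subsetUr.
- exact: stP.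
- by rewrite e stP.
Qed.

End Operators.

Lemma sign_odd (k l : nat) : ((-1) ^+ k = (-1) ^+ l :> int) <-> odd k = odd l.
Proof.
rewrite -(signr_odd _ k) -(signr_odd _ l).
by case: (odd k); case: (odd l).
Qed.

(** * Contraction of the cubes, and exchange of the two colours *)

Section Cubes.
Variable D : link_diagram.
Local Notation n := (crossings D).
Local Notation cr := (@circle_rel D).
Local Notation e0 c := (inl (c, 0) : point D).
Local Notation St := (state D).
Implicit Types (I J K : smoothing D) (c : 'I_n) (w u v : labelling D) (x y z : St).

(** Such crossings are the directions of the cube of [v]: both smoothings there are compatible with
    it, see [free_lab] and [lab_free]. *)
Definition free_at v c := [forall k, v (inl (c, k)) == v (e0 c)].

Lemma free_lab v c I J : free_at v c -> (forall d, d != c -> (d \in I) = (d \in J)) ->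
  lab (cr I) v -> lab (cr J) v.
Proof.
move=> /forallP vc IJ /forallP vI; apply/forallP => x; apply/forallP => y.
have /forallP/(_ y) := vI x; case: x y => [x|?] [y|?] //=.
have [xc _|xc] := eqVneq x.1 c; last by rewrite /smooth IJ.
apply/implyP => /orP[] /eqP ->.
  have /forallP/(_ (inl (Defs.arc x)))/implyP := vI (inl x); apply.
  by rewrite /= eqxx.
case: x xc => d k /= ->; rewrite /smooth /=.
by have /eqP -> := vc k; rewrite eq_sym; apply: vc.
Qed.

Lemma lab_free v c I : c \notin I -> lab (cr I) v -> lab (cr (c |: I)) v ->
  free_at v c.
Proof.
move=> cI vI vJ; apply/forallP.
have sI k : v (inl (c, k)) = v (inl (c, 1 - k)).
  apply: (labP _ _ vI); have := connect_smooth I (c, k).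
  by rewrite /smooth /= (negPf cI).
have sJ k : v (inl (c, k)) = v (inl (c, 3 - k)).
  apply: (labP _ _ vJ); have := connect_smooth (c |: I) (c, k).
  by rewrite /smooth /= setU11.
have v1 : v (inl (c, 1)) = v (e0 c) by rewrite sI subrr.
have v3 : v (inl (c, 3)) = v (e0 c) by rewrite sJ subrr.
have v2 : v (inl (c, 2)) = v (e0 c).
  by rewrite -v1 sJ; congr (v (inl (c, _))); apply: val_inj.
by elim/Z4_ind; rewrite ?v1 ?v2 ?v3.
Qed.

(** The direction is picked from the colouring alone, hence is the same at all vertices of its cube,
    as [cube_homotopy] requires. *)
Definition homotopy_coef x y : int := (st_lab x == st_lab y)%:R *
  (if [pick c | free_at (st_lab x) c] is Some c then
     if (c \in st_set x) && (st_set y == st_set x :\ c)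
     then cube_sign (st_set y) c else 0 else 0).

Definition has_free v := [exists c, free_at v c].

Definition free_coef x y : int := (x == y)%:R * (has_free (st_lab y))%:R.

Lemma diag_homotopy :
  fun_mx (@diag_coef D) *m fun_mx homotopy_coef
  + fun_mx homotopy_coef *m fun_mx (@diag_coef D) = fun_mx free_coef.
Proof.
rewrite !fun_mxM; apply/matrixP => i j; rewrite !mxE.
move: (enum_val i) (enum_val j) => x y; rewrite /free_coef /homotopy_coef /diag_coef.
have [e|ne] := eqVneq (st_lab x) (st_lab y); last first.
  rewrite st_eqE (negPf ne) andbF mul0r.
  rewrite !big1 ?addr0 // => z _; case: eqP => [xz|]; rewrite ?mul0r //.
    by rewrite -xz (negPf ne) !mul0r mulr0.
  by rewrite -xz (negPf ne) !mul0r mulr0.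
rewrite /has_free -e; set v := st_lab x; set I := st_set x; set K := st_set y.
have vI : lab (cr I) v by exact: stP.
have vK : lab (cr K) v by rewrite /v e; exact: stP.
pose h J L : int := if [pick c | free_at v c] is Some c then
     if (c \in J) && (L == J :\ c) then cube_sign L c else 0 else 0.
transitivity (\sum_(J | lab (cr J) v) (cube_diff I J * h J K) +
              \sum_(J | lab (cr J) v) (h I J * cube_diff J K)).
  rewrite -!sum_state_lab; congr (_ + _); apply: eq_bigr => z _;
    rewrite [st_lab z == _]eq_sym -/v /h; case: eqP => [e1|]; rewrite -?e1;
    by rewrite ?mul0r // !mul1r.
have -> : (x == y) = (I == K) by rewrite st_eqE e eqxx andbT.
rewrite /h; case: pickP => [c vc|no]; last first.
  rewrite (_ : [exists c, _] = false); last by apply/existsP => -[c]; rewrite no.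
  by rewrite !big1 ?addr0 ?mulr0 // => J _; rewrite ?mulr0 ?mul0r.
rewrite (_ : [exists c, _] = true) ?mulr1; last by apply/existsP; exists c.
rewrite -(cube_homotopy c I K); congr (_ + _).
  case: ifP => cK.
    apply: big1 => J _; case: andP => [[cJ /eqP KE]|]; last by rewrite mulr0.
    by rewrite KE !inE eqxx in cK.
  have vcK : lab (cr (c |: K)) v.
    by apply: (@free_lab v c K) => // d dc; rewrite in_setU1 (negPf dc).
  rewrite (bigD1 (c |: K)) //= big1 ?addr0 => [|J /andP[_ JK]].
    by rewrite setU11 setU1K ?cK // eqxx.
  case: andP => [[cJ /eqP KE]|]; last by rewrite mulr0.
  by rewrite KE setD1K ?eqxx in JK.
case: ifP => cI; last by apply: big1 => J _; rewrite mul0r.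
have vcI : lab (cr (I :\ c)) v.
  by apply: (@free_lab v c I) => // d dc; rewrite in_setD1 dc.
rewrite (bigD1 (I :\ c)) //= big1 ?addr0 => [|J /andP[_ /negPf->]]; last by rewrite mul0r.
by rewrite eqxx.
Qed.

Lemma diag_free : fun_mx (@diag_coef D) *m fun_mx free_coef = fun_mx (@diag_coef D).
Proof.
rewrite fun_mxM; apply: eq_fun_mx => x y.
rewrite (bigD1 y) //= big1 => [|z zy]; last by rewrite /free_coef (negPf zy) mul0r mulr0.
rewrite /free_coef eqxx mul1r addr0 /diag_coef; case: eqP => [e|]; last by rewrite !mul0r.
have [->|/cube_diffP[c cI KE]] := eqVneq (cube_diff (st_set x) (st_set y)) 0.
  by rewrite mulr0 mul0r.
rewrite (_ : has_free _ = true) ?mulr1 //; apply/existsP; exists c.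
by apply: lab_free cI _ _; [rewrite -e; apply: stP | rewrite -KE; apply: stP].
Qed.

(** Multiplication by X at the point [p], in the basis of colourings. *)
Definition colour_coef (p : point D) x y : int := (x == y)%:R * (st_lab y p)%:R.

Lemma colour_diag p : fun_mx (colour_coef p) *m fun_mx (@diag_coef D) =
  fun_mx (@diag_coef D) *m fun_mx (colour_coef p).
Proof.
rewrite !fun_mxM; apply: eq_fun_mx => x y.
rewrite (bigD1 x) //= big1 => [|z zy]; last by rewrite /colour_coef eq_sym (negPf zy) !mul0r.
rewrite [RHS](bigD1 y) //= [X in _ = _ + X]big1 => [|z zy]; last first.
  by rewrite /colour_coef (negPf zy) mul0r mulr0.
rewrite /colour_coef !eqxx !mul1r !addr0 /diag_coef mulrC.
by case: eqP => [<-|] //; rewrite !mul0r.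
Qed.

(** Exchanging X and [1 - X] complements colourings and reverses the sign of [Delta]; the factor
    [half_circles] makes up for that sign, and the two half ranks come from the normalisation of the
    basis. *)
Definition swap_coef x y : int :=
  ((st_set x == st_set y) && (st_lab y == neg_lab (st_lab x)))%:R *
  (-1) ^+ (half_circles (st_set x) + state_half_rank x + state_half_rank y).

Lemma swap_colour p : fun_mx (colour_coef p) *m fun_mx swap_coef =
  fun_mx swap_coef *m (1%:M - fun_mx (colour_coef p)).
Proof.
rewrite mulmxBr mulmx1 !fun_mxM; apply/matrixP => i j; rewrite !mxE.
move: (enum_val i) (enum_val j) => x y.
rewrite (bigD1 x) //= big1 => [|z zy]; last by rewrite /colour_coef eq_sym (negPf zy) !mul0r.
rewrite [X in _ = _ - X](bigD1 y) //= [X in _ = _ - (_ + X)]big1 => [|z zy]; last first.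
  by rewrite /colour_coef (negPf zy) mul0r mulr0.
rewrite /colour_coef !eqxx !mul1r !addr0 /swap_coef.
case: andP => [[_ /eqP ->]|]; last by rewrite !mul0r mulr0 subr0.
by rewrite ffunE; case: (st_lab x p); rewrite /= ?mul1r ?mul0r ?mulr1 ?mulr0 ?subr0 ?subrr.
Qed.

Lemma neg_state_proof x : (st_set x, neg_lab (st_lab x)) \in
  [pred x : smoothing D * labelling D | lab (cr x.1) x.2].
Proof. by rewrite inE /= lab_neg stP. Qed.
Definition neg_state x : St := exist (fun z : smoothing D * labelling D =>
  z \in [pred x : smoothing D * labelling D | lab (cr x.1) x.2]) _ (neg_state_proof x).

Lemma swap_diag : fun_mx swap_coef *m fun_mx (@diag_coef D) =
  fun_mx (@diag_coef D) *m fun_mx swap_coef.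
Proof.
have swapE x y : swap_coef x y = (y == neg_state x)%:R *
    (-1) ^+ (half_circles (st_set x) + state_half_rank x + state_half_rank y).
  by rewrite /swap_coef st_eqE /= [st_set y == _]eq_sym.
have negK : involutive neg_state.
  by move=> x; apply/eqP; rewrite st_eqE /st_set /st_lab /= neg_labK !eqxx.
rewrite !fun_mxM; apply: eq_fun_mx => x y.
rewrite (bigD1 (neg_state x)) //= big1 => [|z zy]; last first.
  by rewrite swapE (negPf zy) !mul0r.
rewrite [RHS](bigD1 (neg_state y)) //= [X in _ = _ + X]big1 => [|z zy]; last first.
  rewrite swapE (_ : y == _ = false) ?mul0r ?mulr0 //.
  by apply: contraNF zy => /eqP->; rewrite negK.
rewrite !swapE negK !eqxx !mul1r !addr0 /diag_coef.
rewrite -[st_set (neg_state x)]/(st_set x) -[st_set (neg_state y)]/(st_set y).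
rewrite -[st_lab (neg_state x)]/(neg_lab (st_lab x)).
rewrite -[st_lab (neg_state y)]/(neg_lab (st_lab y)).
rewrite -(inj_eq (can_inj (@neg_labK D))) neg_labK.
case: eqP => [e|_]; last by rewrite !(mul0r, mulr0).
rewrite !mul1r.
have [->|/cube_diffP[c cI yE]] := eqVneq (cube_diff (st_set x) (st_set y)) 0.
  by rewrite mulr0 mul0r.
rewrite mulrC; congr (_ * _).
rewrite /state_half_rank -[st_set (neg_state x)]/(st_set x) -[st_set (neg_state y)]/(st_set y).
rewrite -[st_lab (neg_state x)]/(neg_lab (st_lab x)).
have yv : st_lab y = neg_lab (st_lab x) by rewrite e neg_labK.
rewrite -[st_lab (neg_state y)]/(neg_lab (st_lab y)) -e yv.
set v := st_lab x; have vI : lab (cr (st_set x)) v by exact: stP.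
have vJ : lab (cr (st_set y)) v by rewrite /v e lab_neg stP.
have := half_circles_edge cI vI; rewrite -yE => /(_ vJ).
rewrite !edge_sign_half ?lab_neg -?yE // -!exprD => /sign_odd h.
apply/sign_odd; move: h; rewrite !oddD.
by do 6!case: (odd _).
Qed.

End Cubes.

Lemma num_true_sub (T : finType) (e : rel T) (u w : {ffun T -> bool}) :
  connect_sym e -> lab e u -> lab e w -> sublab u w ->
  (num_true e u <= num_true e w)%N /\ (num_true e u = num_true e w -> u = w).
Proof.
move=> eC uL wL /sublabP uw; rewrite !num_trueE //.
have sub : fingraph.root e @: [set x | u x] \subset fingraph.root e @: [set x | w x].
  by apply: imsetS; apply/subsetP => x; rewrite !inE; apply: uw.
split; first exact: subset_leq_card.
move/eqP; rewrite (subset_leqif_card sub) => /subsetP bus.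
apply/ffunP => x; apply/idP/idP => [/uw//|wx].
have /bus/imsetP[y] : fingraph.root e x \in fingraph.root e @: [set x | w x].
  by apply: imset_f; rewrite inE.
rewrite inE => uy /eqP; rewrite (root_connect eC) => /((labP _ _ uL) _ _) ->.
by [].
Qed.

(** * Degrees, and multiplication by X at a point *)

Section Graded.
Variable D : link_diagram.
Local Notation n := (crossings D).
Local Notation cr := (@circle_rel D).
Local Notation e0 c := (inl (c, 0) : point D).
Local Notation St := (state D).
Local Notation crC I := (@circle_connect_sym D I).
Implicit Types (I J K : smoothing D) (c : 'I_n) (w u v : labelling D) (x y z : St).
Implicit Types (p : point D).

Definition state_hdeg x : int := hom_degree (st_set x).
Definition state_qdeg x : int := poly_degree (st_set x) (st_lab x).
Definition num_X x : nat := num_true (cr (st_set x)) (st_lab x).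

Lemma qdgE x : state_qdeg x = (num_circles (st_set x) + #|st_set x|)%N%:Z
  - 2 * (num_X x)%:Z + ((n_plus D)%:Z - 2 * (n_minus D)%:Z).
Proof. rewrite /state_qdeg /poly_degree label_degreeE /num_X; lia. Qed.

Lemma edge_cases x y :
  (exists2 c, c \notin st_set x /\ st_set y = c |: st_set x &
    deformed_coef x y =
      cube_sign (st_set x) c * edge_deformed (st_set x) c (st_lab x) (st_lab y) /\
    diff_coef x y =
      cube_sign (st_set x) c * (edge_coef (st_set x) c (st_lab x) (st_lab y))%:R)
  \/ (deformed_coef x y = 0 /\ diff_coef x y = 0).
Proof.
rewrite /deformed_coef /diff_coef /differential_coef -/(st_set x) -/(st_set y).
case: (pickP (fun c => (c \notin st_set x) && (st_set y == c |: st_set x))) => [c|no].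
  move=> cP; left; exists c; first by case/andP: cP => cI /eqP.
  have uniq c' : (c' \notin st_set x) && (st_set y == c' |: st_set x) = (c' == c).
    apply/idP/eqP => [/andP[c'I /eqP yE]|->//].
    by case/andP: cP => cI /eqP yE'; apply: (setU1_inj c'I cI); rewrite -yE -yE'.
  by rewrite !(big_pred1 c).
by right; rewrite !big_pred0.
Qed.

Lemma diff_degree x y : diff_coef x y != 0 -> state_hdeg y = state_hdeg x + 1 /\ state_qdeg y = state_qdeg x.
Proof.
case: (edge_cases x y) => [[c [cI yE] [_ ->]]|[_ ->]]; last by rewrite eqxx.
have xL := stP x; have := stP y; rewrite yE => yL.
have [H _] := edge_degree cI xL yL.
have [ec|] := boolP (edge_coef _ _ _ _); last by rewrite mulr0 eqxx.
have [_ dE] := H ec; move=> _; rewrite /state_hdeg /hom_degree /state_qdeg yE dE cardsU1 cI.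
by split=> //; lia.
Qed.

Lemma deformed_degree x y : deformed_coef x y - diff_coef x y != 0 ->
  state_hdeg y = state_hdeg x + 1 /\ state_qdeg y = state_qdeg x + 2.
Proof.
case: (edge_cases x y) => [[c [cI yE] [-> ->]]|[-> ->]]; last by rewrite subrr eqxx.
have xL := stP x; have := stP y; rewrite yE => yL.
have [H1 H2] := edge_degree cI xL yL.
have [ec|ec] := boolP (edge_coef _ _ _ _).
  by have [-> _] := H1 ec; rewrite subrr eqxx.
rewrite mulr0 subr0 mulf_eq0 negb_or => /andP[_ /(H2 ec)].
by rewrite /state_hdeg /hom_degree /state_qdeg yE => ->; rewrite cardsU1 cI; split=> //; lia.
Qed.

Definition add_circle p x : labelling D :=
  [ffun z => st_lab x z || connect (cr (st_set x)) p z].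

Lemma lab_add_circle p x : lab (cr (st_set x)) (add_circle p x).
Proof.
apply/labP => y z yz; rewrite !ffunE ((labP _ _ (stP x)) _ _ yz).
by rewrite (same_connect_r (crC _) yz).
Qed.

Lemma add_state_proof p x : (st_set x, add_circle p x) \in
  [pred x : smoothing D * labelling D | lab (cr x.1) x.2].
Proof. by rewrite inE /= lab_add_circle. Qed.
Definition add_state p x : St := exist (fun z : smoothing D * labelling D =>
  z \in [pred x : smoothing D * labelling D | lab (cr x.1) x.2]) _ (add_state_proof p x).

Lemma add_state_id p x : st_lab x p -> add_state p x = x.
Proof.
move=> xp; apply/eqP; rewrite st_eqE eqxx; apply/eqP/ffunP => z.
rewrite ffunE; case: (boolP (connect _ p z)); rewrite ?orbF ?orbT //.
by move/((labP _ _ (stP x)) _ _) => <-; rewrite xp.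
Qed.

Lemma add_state_nt p x : ~~ st_lab x p -> num_X (add_state p x) = (num_X x).+1.
Proof.
move=> xp; apply: (num_true_add (crC _) (stP x) (lab_add_circle p x) xp) => z.
by rewrite ffunE.
Qed.

(** Multiplication by X at [p] subject to [X^2 = X] splits by degree: this part, of degree -2, is
    multiplication subject to [X^2 = 0], and [proj_coef] is the part of degree 0. *)
Definition mulX_coef p x y : int := (~~ st_lab x p && (y == add_state p x))%:R.
Definition proj_coef p x y : int := ((y == x) && st_lab x p)%:R.

Lemma mulX_projE p x y :
  mulX_coef p x y + proj_coef p x y = (y == add_state p x)%:R.
Proof.
rewrite /mulX_coef /proj_coef; have [xp|xp] := boolP (st_lab x p).
  by rewrite add_state_id // andbT add0r.
by rewrite andbF addr0.
Qed.

Lemma mulX_degree p x y : mulX_coef p x y != 0 ->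
  state_hdeg y = state_hdeg x /\ state_qdeg y = state_qdeg x - 2.
Proof.
rewrite /mulX_coef; case: andP => [[xp /eqP ->] _|_]; last by rewrite eqxx.
split=> //; rewrite !qdgE add_state_nt // -[st_set (add_state p x)]/(st_set x); lia.
Qed.

(** The expansion of a monomial after substituting [1 + X] for X. *)
Definition below_coef x y : int :=
  ((st_set x == st_set y) && sublab (st_lab y) (st_lab x))%:R.

Lemma below_degree x y : below_coef x y != 0 -> state_hdeg y = state_hdeg x.
Proof.
by rewrite /below_coef /state_hdeg; case: andP => [[/eqP-> _]|]; rewrite ?eqxx.
Qed.

Lemma below_degree0 x y : state_qdeg y = state_qdeg x -> below_coef x y = (x == y)%:R.
Proof.
rewrite !qdgE /below_coef st_eqE => dE; congr (nat_of_bool _)%:R.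
case: eqP => //= xy; apply/idP/eqP => [yx|->]; last exact/sublabP.
have yL : lab (cr (st_set x)) (st_lab y) by rewrite xy stP.
have [_ H] := num_true_sub (crC _) yL (stP x) yx.
by apply/esym/H; move: dE; rewrite /num_X -xy; lia.
Qed.

(** The sign turning X into -X, times a sign of the smoothing. The product depends only on the
    polynomial degree modulo 4, so conjugation by it fixes [d] and negates [Psi]. *)
Definition parity_sign x : int := (-1) ^+ (half_circles (st_set x) + num_X x).

Lemma parity_sign_eq x y : state_qdeg y = state_qdeg x -> parity_sign y = parity_sign x.
Proof.
rewrite !qdgE /parity_sign /half_circles => dE; apply/sign_odd; move: dE.
move: (num_circles _ + _)%N (num_circles _ + _)%N (num_X x) (num_X y) => a b k l dE.
rewrite !oddD; lia.
Qed.

Lemma parity_sign_opp x y : state_qdeg y = state_qdeg x + 2 -> parity_sign y = - parity_sign x.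
Proof.
rewrite !qdgE /parity_sign /half_circles => dE.
rewrite -[RHS]mulN1r -[RHS]exprS.
apply/sign_odd; move: dE.
move: (num_circles _ + _)%N (num_circles _ + _)%N (num_X x) (num_X y) => a b k l dE.
rewrite /= !oddD; lia.
Qed.

End Graded.

Lemma mulrACA5 (a b c d e : int) : a * (b * c) * (d * e) = a * d * c * (b * e).
Proof. ring. Qed.

Lemma sign_cancel3 (p a s : int) : p ^+ 2 = 1 -> p * a * (s * p) = s * a.
Proof. by move=> h; rewrite -[RHS]mulr1 -h; ring. Qed.

(** * Identities for the deformed differential, proved in the basis of colourings *)

Section DeformedComplex.
Variable D : link_diagram.
Local Notation cr := (@circle_rel D).
Local Notation St := (state D).
Local Notation crC I := (@circle_connect_sym D I).
Implicit Types (I J K : smoothing D) (w u v : labelling D) (x y z : St).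
Implicit Types (p : point D).

Local Notation B := (fun_mx (@deformed_coef D)).
Local Notation d := (fun_mx (@diff_coef D)).
Local Notation E := (fun_mx (@eval_coef D)).
Local Notation Ei := (fun_mx (@eval_inv_coef D)).
Local Notation Dg := (fun_mx (@diag_coef D)).
Local Notation mX p := (fun_mx (@mulX_coef D p)).
Local Notation mP p := (fun_mx (@proj_coef D p)).
Local Notation T := (fun_mx (@below_coef D)).
Local Notation V p := (fun_mx (@colour_coef D p)).
Local Notation W := (fun_mx (@swap_coef D)).

Definition sign_coef x y : int := (x == y)%:R * parity_sign x.
Local Notation J := (fun_mx sign_coef).

Lemma mulX_eval p : (mX p + mP p) *m E = E *m V p.
Proof.
have -> : mX p + mP p = fun_mx (fun x y => (y == add_state p x)%:R).
  by apply/matrixP => i j; rewrite !mxE mulX_projE.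
rewrite !fun_mxM; apply: eq_fun_mx => x y.
rewrite (bigD1 (add_state p x)) //= big1 => [|z /negPf->]; last by rewrite mul0r.
rewrite [RHS](bigD1 y) //= [X in _ = _ + X]big1 => [|z zy]; last first.
  by rewrite /colour_coef (negPf zy) mul0r mulr0.
rewrite /colour_coef !eqxx !mul1r !addr0 /eval_coef.
rewrite -[st_set (add_state p x)]/(st_set x) -[st_lab (add_state p x)]/(add_circle p x).
case: eqP => [xy|]; last by rewrite !mul0r.
rewrite !mul1r mulrAC -natrM mulnb; congr (_%:R * _); congr (nat_of_bool _).
have yL := stP y; rewrite -xy in yL.
apply/sublabP/andP => [H|[/sublabP H yp] z].
  split; last by apply: H; rewrite ffunE connect0 orbT.
  by apply/sublabP => z xz; apply: H; rewrite ffunE xz.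
by rewrite ffunE => /orP[/H//|/((labP _ _ yL) _ _) <-].
Qed.

(** Substituting [1 - X] and evaluating at [v] is evaluating at the complementary colouring: the
    signed sum over the [u] below both [w] and [v] vanishes unless no circle is true in both, that
    is, unless [sublab w (neg_lab v)]. *)
Lemma below_eval : T *m J *m E = E *m W.
Proof.
rewrite !fun_mxM; apply: eq_fun_mx => x y.
set I := st_set x; set v := st_lab y; set w := st_lab x.
pose s := (-1) ^+ (half_circles I + state_half_rank y) : int.
have TJ z : \sum_z0 below_coef x z0 * sign_coef z0 z = below_coef x z * parity_sign z.
  rewrite (bigD1 z) //= big1 => [|z0 zz]; last by rewrite /sign_coef (negPf zz) mul0r mulr0.
  by rewrite /sign_coef eqxx mul1r addr0.
under eq_bigr => z _ do rewrite TJ.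
rewrite [RHS](bigD1 (neg_state y)) //= [X in _ = _ + X]big1 => [|z zy]; last first.
  rewrite /swap_coef; case: andP => [[/eqP yz /eqP yzl]|]; last by rewrite mul0r mulr0.
  case/eqP: zy; apply/eqP; rewrite st_eqE -[st_set (neg_state y)]/(st_set y).
  by rewrite -[st_lab (neg_state y)]/(neg_lab v) /v yzl neg_labK yz !eqxx.
rewrite addr0 /swap_coef.
rewrite -[st_set (neg_state y)]/(st_set y) -[st_lab (neg_state y)]/(neg_lab v).
rewrite neg_labK !eqxx mul1r /eval_coef.
rewrite -[st_set (neg_state y)]/(st_set y) -[st_lab (neg_state y)]/(neg_lab v) -/w -/I.
have [e|ne] := eqVneq I (st_set y); last first.
  rewrite !mul0r big1 // => z _; rewrite /below_coef.
  case: andP => [[/eqP xz _]|]; last by rewrite !mul0r.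
  by rewrite -xz (negPf ne) mul0r mulr0.
pose G u := ([&& lab (cr I) u, sublab u w & sublab u v])%:R * (-1) ^+ num_true (cr I) u * s.
transitivity (\sum_z (I == st_set z)%:R * G (st_lab z)).
  apply: eq_bigr => z _; rewrite /below_coef /G -/I -/w -e.
  have [Iz|_] := eqVneq I (st_set z); last by rewrite !mul0r.
  rewrite Iz stP !mul1r /= -mulnb natrM /parity_sign /num_X -Iz /s.
  by rewrite !exprD; apply: mulrACA5.
rewrite sum_state_set /G -mulr_suml.
pose o : labelling D := [ffun=> false].
pose m : labelling D := [ffun t => w t && v t].
have vL : lab (cr I) v by rewrite e stP.
have oL : lab (cr I) o by apply/labP => t t' _; rewrite !ffunE.
have mL : lab (cr I) m.
  by apply/labP => t t' tt'; rewrite !ffunE ((labP _ _ (stP x)) _ _ tt') ((labP _ _ vL) _ _ tt').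
have om : sublab o m by apply/sublabP => t; rewrite ffunE.
have := alternating_sum (crC I) oL mL om.
rewrite [num_true _ o]num_true0 => [|t]; last by rewrite ffunE.
rewrite expr0 => alt.
rewrite (_ : \sum_(u | _) _ = (o == m)%:R); last first.
  rewrite -[RHS]alt big_mkcond [RHS]big_mkcond; apply: eq_bigr => u _ /=.
  have -> : sublab o u by apply/sublabP => t; rewrite ffunE.
  have -> : sublab u m = sublab u w && sublab u v.
    apply/sublabP/andP => [H|[/sublabP H1 /sublabP H2] t ut]; last by rewrite ffunE H1 ?H2.
    by split; apply/sublabP => t /H; rewrite ffunE => /andP[].
  by case: (lab _ u); rewrite //=; case: (_ && _); rewrite ?mul1r ?mul0r.
have -> : (o == m) = sublab w (neg_lab v).
  apply/eqP/sublabP => [om' t wt|H].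
    by have /ffunP/(_ t) := om'; rewrite !ffunE wt /= => <-.
  apply/ffunP => t; rewrite !ffunE; case: (boolP (w t)) => //= /H.
  by rewrite ffunE => /negPf ->.
rewrite mul1r -mulrA; congr (_ * _); rewrite /s -e -exprD; apply/sign_odd.
by rewrite !oddD; do 3!case: (odd _).
Qed.

Lemma eval_unit : Ei *m E = 1%:M.
Proof. exact/mulmx1C/evalK. Qed.

Lemma eval_inj k (M N : 'M[int]_(k, _)) : M *m E = N *m E -> M = N.
Proof. by move/(congr1 (mulmx^~ Ei)); rewrite -!mulmxA evalK !mulmx1. Qed.

Lemma deformed_sqr : B *m B = 0.
Proof.
apply: eval_inj; rewrite mul0mx -mulmxA deformed_eval mulmxA deformed_eval.
by rewrite -mulmxA diag_sqr mulmx0.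
Qed.

(* In the basis of colourings the complex is a sum of cubes: those of positive
   dimension are contractible, and those of dimension 0 have zero differential. *)
Lemma deformed_torsion_free (m : int) (Y Z : 'rV[int]_#|{: St}|) : m != 0 ->
  Y *m B = m *: Z -> exists U, Z = U *m B.
Proof.
move=> m0 YZ; pose F := fun_mx (@free_coef D); pose H := fun_mx (@homotopy_coef D).
have mI k (A A' : 'rV[int]_k) : m *: A = m *: A' -> A = A'.
  by move/matrixP=> e; apply/matrixP => i j; have := e i j; rewrite !mxE => /(mulfI m0).
have YZ' : Y *m E *m Dg = m *: (Z *m E).
  by rewrite -mulmxA -deformed_eval mulmxA YZ scalemxAl.
have ZD : Z *m E *m Dg = 0.
  by apply: mI; rewrite scalemxAl -YZ' -mulmxA diag_sqr mulmx0 scaler0.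
(* A multiple of [Z *m E] is a boundary, and boundaries have no component at a colouring without
   free crossings; on the others the homotopy applies. *)
have ZF : Z *m E *m F = Z *m E.
  by apply: mI; rewrite scalemxAl -YZ' -mulmxA diag_free.
exists (Z *m E *m H *m Ei); apply: eval_inj.
rewrite -[RHS]mulmxA deformed_eval !mulmxA -[X in X *m Dg]mulmxA eval_unit mulmx1.
rewrite -{1}ZF /F -diag_homotopy mulmxDr !mulmxA ZD mul0mx add0r.
by [].
Qed.

Lemma mulX_deformed p : (mX p + mP p) *m B = B *m (mX p + mP p).
Proof.
apply: eval_inj; rewrite -!mulmxA deformed_eval mulX_eval !mulmxA mulX_eval.
by rewrite deformed_eval -!mulmxA colour_diag.
Qed.

Lemma below_deformed : T *m J *m B = B *m (T *m J).
Proof.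
apply: eval_inj; rewrite -[LHS]mulmxA deformed_eval [LHS]mulmxA below_eval.
rewrite -[RHS]mulmxA below_eval -mulmxA swap_diag !mulmxA.
by rewrite deformed_eval.
Qed.

Lemma below_mulX p : (mX p + mP p) *m (T *m J) = T *m J *m (1%:M - (mX p + mP p)).
Proof.
apply: eval_inj; rewrite -[LHS]mulmxA below_eval [LHS]mulmxA mulX_eval.
rewrite -[LHS]mulmxA swap_colour -[RHS]mulmxA mulmxBl mul1mx mulX_eval.
rewrite [RHS]mulmxBr [X in _ = _ - X]mulmxA !below_eval.
by rewrite mulmxBr mulmx1 mulmxBr !mulmxA.
Qed.

Lemma sign_conj (A : St -> St -> int) (s : int) :
  (forall x y, A x y != 0 -> parity_sign y = s * parity_sign x) ->
  J *m fun_mx A *m J = s *: fun_mx A.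
Proof.
move=> H; rewrite !fun_mxM; apply/matrixP => i j; rewrite !mxE.
move: (enum_val i) (enum_val j) => x y.
rewrite (bigD1 y) //= [X in _ + X]big1 => [|z zy]; last by rewrite /sign_coef (negPf zy) mul0r mulr0.
rewrite (bigD1 x) //= big1 => [|z zx]; last by rewrite /sign_coef eq_sym (negPf zx) !mul0r.
rewrite /sign_coef !eqxx !mul1r !addr0.
have [->|/H ->] := eqVneq (A x y) 0; first by rewrite mulr0 mul0r mulr0.
exact/sign_cancel3/sqrr_sign.
Qed.

End DeformedComplex.

(** * Subgroups of Z^n *)

Definition submodule (V : lmodType int) (S : V -> Prop) :=
  S 0 /\ forall a u v, S u -> S v -> S (a *: u + v).

Section Submodule.
Variables (V : lmodType int) (S : V -> Prop).
Hypothesis SS : submodule S.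
Lemma submod0 : S 0. Proof. exact: SS.1. Qed.
Lemma submodD u v : S u -> S v -> S (u + v).
Proof. by move=> Su Sv; rewrite -[u]scale1r; apply: SS.2. Qed.
Lemma submodZ a u : S u -> S (a *: u).
Proof. by move=> Su; rewrite -[_ *: _]addr0; apply: SS.2 => //; apply: submod0. Qed.
Lemma submodN u : S u -> S (- u).
Proof. by rewrite -scaleN1r; apply: submodZ. Qed.
Lemma submodB u v : S u -> S v -> S (u - v).
Proof. by move=> Su Sv; apply: submodD => //; apply: submodN. Qed.
Lemma submod_sum I (r : seq I) (P : pred I) (F : I -> V) :
  (forall i, P i -> S (F i)) -> S (\sum_(i <- r | P i) F i).
Proof. by move=> SF; elim/big_ind: _ => //; [exact: submod0 | exact: submodD]. Qed.
End Submodule.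

(** Euclidean division: add to generators of the vectors with first coordinate 0 a vector whose
    first coordinate is nonzero of least absolute value, if there is one. *)
Lemma submodule_generators n (S : 'rV[int]_n -> Prop) : submodule S ->
  exists k (G : 'M[int]_(k, n)), forall v, S v <-> exists u, v = u *m G.
Proof.
elim: n S => [|n IHn]; last rewrite -[n.+1]add1n; move=> S SS.
  exists 0%N, 0 => v; split=> _; first by exists 0; apply/matrixP => i [].
  by rewrite (_ : v = 0); [exact: submod0 | apply/matrixP => i []].
pose S1 (v : 'rV[int]_n) := S (row_mx (0 : 'rV_1) v).
have S1S : submodule S1.
  split=> [|a u v Su Sv]; first by rewrite /S1 row_mx0; apply: submod0.
  have := SS.2 a _ _ Su Sv; rewrite scale_row_mx add_row_mx scaler0 addr0.
  by [].
have [k [G GP]] := IHn S1 S1S.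
have rowE (v : 'rV[int]_(1 + n)) : v 0 0 = 0 -> v = row_mx 0 (rsubmx v).
  move=> v0; rewrite -{1}(hsubmxK v); congr row_mx.
  apply/matrixP => i j; rewrite !ord1 !mxE -[RHS]v0; congr (v _ _).
  exact: val_inj.
have [[s [Ss s0]]|none] := pselect (exists s : 'rV_(1 + n), S s /\ s 0 0 != 0); last first.
  exists k, (row_mx 0 G) => v; split=> [Sv|[u ->]]; last first.
    by rewrite mul_mx_row mulmx0; apply/GP; exists u.
  have v0 : v 0 0 = 0 by apply/eqP/negP => /negP v0; apply: none; exists v.
  have /GP[u vu] : S1 (rsubmx v) by rewrite /S1 -rowE.
  by exists u; rewrite mul_mx_row mulmx0 -vu -rowE.
have ex : exists m, `[< exists s : 'rV_(1 + n), [/\ S s, s 0 0 != 0 & absz (s 0 0) = m] >].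
  by exists (absz (s 0 0)); apply/asboolP; exists s.
case: (ex_minnP ex) => m /asboolP[{s Ss s0} s [Ss s0 sm]] min_m.
exists (1 + k)%N, (col_mx s (row_mx 0 G)) => v; split=> [Sv|[u ->]]; last first.
  rewrite -(hsubmxK u) mul_row_col; apply: submodD => //.
    by rewrite [lsubmx u]mx11_scalar mul_scalar_mx; apply: submodZ.
  by rewrite mul_mx_row mulmx0; apply/GP; exists (rsubmx u).
pose a := divz (v 0 0) (s 0 0); pose w := v - a *: s.
have Sw : S w by apply: submodB => //; apply: submodZ.
have w0 : w 0 0 = 0.
  have wE : w 0 0 = modz (v 0 0) (s 0 0) by rewrite /w !mxE.
  move: wE; set b := w 0 0 => wE.
  apply/eqP/negP => /negP wn0; have : (m <= `|b|)%N.
    by apply: min_m; apply/asboolP; exists w.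
  rewrite leqNgt => /negP; apply; rewrite -sm -ltz_nat !abszE wE.
  by rewrite ger0_norm ?modz_ge0 // ltz_mod.
have /GP[u wu] : S1 (rsubmx w) by rewrite /S1 -rowE.
exists (row_mx a%:M u); rewrite mul_row_col mul_scalar_mx mul_mx_row mulmx0 -wu -rowE //.
by rewrite /w addrC subrK.
Qed.

Lemma det_1D p k (A : 'M[int]_k) : prime p ->
  exists c, \det (1%:M + p%:Z *: A) = 1 + p%:Z * c.
Proof.
move=> pp; suff /dvdzP[c e] : (p %| \det (1%:M + p%:Z *: A) - 1)%Z.
  by exists c; rewrite [p%:Z * c]mulrC -e [RHS]addrC subrK.
rewrite (dvdz_pcharf (pchar_Fp pp)) rmorphB /= -det_map_mx map_mxD map_mxZ.
rewrite [X in X *: _](_ : _ = 0); last exact: pchar_Fp_0.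
by rewrite scale0r addr0 map_mx1 det1 subrr.
Qed.

(* Nakayama's lemma: if the generators satisfy [G = M + p A G] with the rows of
   [M] in [W], then [\det (1 - p A)] maps [S] into [W]. *)
Lemma p_divisible_coprime n p (S W : 'rV[int]_n -> Prop) : prime p ->
  submodule S -> submodule W ->
  (forall f, S f -> exists w e, [/\ W w, S e & f = w + p%:Z *: e]) ->
  forall f, S f -> exists c, W ((1 + p%:Z * c) *: f).
Proof.
move=> pp SS WS H; have [k [G GP]] := submodule_generators SS.
have HG i : exists wu : 'rV[int]_n * 'rV[int]_k,
    W wu.1 /\ row i G = wu.1 + p%:Z *: (wu.2 *m G).
  have [|w [e [Ww /GP[u ->] GE]]] := H (row i G); last by exists (w, u).
  by apply/GP; exists (delta_mx 0 i); rewrite rowE.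
have [F FP] := choice HG.
pose A : 'M[int]_k := \matrix_i (F i).2; pose M : 'M[int]_(k, n) := \matrix_i (F i).1.
have AG : (1%:M + p%:Z *: - A) *m G = M.
  rewrite mulmxDl mul1mx; apply/row_matrixP => i.
  rewrite linearD /= (FP i).2 -scalemxAl linearZ /= mulNmx linearN /= row_mul.
  by rewrite /A rowK /M rowK scalerN addrK.
have [c detE] := det_1D (- A) pp.
move=> f /GP[u ->]; exists c; rewrite -detE scalemxAr -mul_scalar_mx.
rewrite -mul_adj_mx -mulmxA AG mulmxA.
set B := u *m _; rewrite mulmx_sum_row; apply: submod_sum => // i _.
by apply: submodZ => //; rewrite rowK; apply: (FP i).1.
Qed.

(** * Filtered deformations of a bigraded complex *)

Section Graded.
Variables (N : nat) (hdeg qdeg : 'I_N -> int).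
Implicit Types (f g u v w y z t : 'rV[int]_N) (A : 'M[int]_N) (i j : int).

Definition supported (Q : int -> int -> Prop) f :=
  forall k, f 0 k != 0 -> Q (hdeg k) (qdeg k).

Definition homog i j := supported (fun a b => a = i /\ b = j).
Definition homog_ge i j := supported (fun a b => a = i /\ j <= b).
Definition hrow i := supported (fun a _ => a = i).

Definition bideg a b A := forall k l, A k l != 0 -> hdeg l = hdeg k + a /\ qdeg l = qdeg k + b.

Lemma supported_submodule Q : submodule (supported Q).
Proof.
split=> [k|a u v Su Sv k]; first by rewrite mxE eqxx.
rewrite !mxE; have [->|/Su//] := eqVneq (u 0 k) 0.
by rewrite mulr0 add0r => /Sv.
Qed.

Lemma supported_mul (Q Q' : int -> int -> Prop) A f :
  (forall k l, A k l != 0 -> Q (hdeg k) (qdeg k) -> Q' (hdeg l) (qdeg l)) ->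
  supported Q f -> supported Q' (f *m A).
Proof.
move=> H Sf l; rewrite mxE => fA.
have [k /andP[fk Akl]|no] := pickP (fun k => (f 0 k != 0) && (A k l != 0)).
  by apply: H Akl (Sf _ fk).
case/eqP: fA; apply: big1 => k _; have := no k.
by case: eqP => [->|_]; [rewrite mul0r | case: eqP => [->|//]; rewrite mulr0].
Qed.

Lemma supported_impl (Q Q' : int -> int -> Prop) f :
  (forall a b, Q a b -> Q' a b) -> supported Q f -> supported Q' f.
Proof. by move=> QQ Sf k /Sf /QQ. Qed.

Lemma supported_scale (Q : int -> int -> Prop) (m : int) f :
  m != 0 -> supported Q (m *: f) -> supported Q f.
Proof. by move=> m0 H k fk; apply: H; rewrite mxE mulf_neq0. Qed.

Lemma homog_mul a b A i j f : bideg a b A -> homog i j f -> homog (i + a) (j + b) (f *m A).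
Proof. by move=> AP; apply: supported_mul => k l /AP[-> ->] [-> ->]. Qed.

Lemma hrow_mul a b A i f : bideg a b A -> hrow i f -> hrow (i + a) (f *m A).
Proof. by move=> AP; apply: supported_mul => k l /AP[-> _] ->. Qed.

Definition qpart j f : 'rV[int]_N := \row_k (if qdeg k == j then f 0 k else 0).

Lemma qpart_linear j (a : int) u v : qpart j (a *: u + v) = a *: qpart j u + qpart j v.
Proof.
by apply/rowP => k; rewrite !mxE; case: ifP => // _; rewrite mulr0 addr0.
Qed.
Lemma qpart0 j : qpart j 0 = 0.
Proof. by apply/rowP => k; rewrite !mxE if_same. Qed.
Lemma qpartD j u v : qpart j (u + v) = qpart j u + qpart j v.
Proof. by rewrite -[u]scale1r qpart_linear !scale1r. Qed.
Lemma qpartZ j a u : qpart j (a *: u) = a *: qpart j u.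
Proof. by rewrite -[a *: u]addr0 qpart_linear qpart0 !addr0. Qed.

Lemma qpart_homog i j f : hrow i f -> homog i j (qpart j f).
Proof. by move=> Hf k; rewrite !mxE; case: (qdeg k =P j) => [-> /Hf|]; rewrite ?eqxx. Qed.

Lemma qpart_id i j f : homog i j f -> qpart j f = f.
Proof.
move=> Hf; apply/rowP => k; rewrite mxE; case: ifP => // /negbT jk.
by apply/esym/eqP; apply: contraNT jk => /Hf[_ ->].
Qed.

Lemma qpart_below i j j' f : homog_ge i j f -> j' < j -> qpart j' f = 0.
Proof.
move=> Hf jj; apply/rowP => k; rewrite !mxE; case: eqP => // jk.
apply/eqP; apply: contraTT jj => /Hf[_]; rewrite jk; by rewrite -leNgt.
Qed.

Lemma qpart_rest i j f : homog_ge i j f -> homog_ge i (j + 1) (f - qpart j f).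
Proof.
move=> Hf k; rewrite !mxE; case: (qdeg k =P j) => [_|jk]; first by rewrite subrr eqxx.
rewrite subr0 => /Hf[-> h]; split=> //; lia.
Qed.

Lemma qpart_mul a b A j f : bideg a b A -> qpart j (f *m A) = qpart (j - b) f *m A.
Proof.
move=> AP; apply/rowP => l; rewrite !mxE.
case: eqP => lj.
  apply: eq_bigr => k _; rewrite mxE; case: eqP => // kj.
  have [->|/AP[_ e]] := eqVneq (A k l) 0; first by rewrite !mulr0.
  by case: kj; rewrite -lj e addrK.
rewrite big1 // => k _; rewrite mxE; case: eqP => [kj|]; last by rewrite mul0r.
have [->|/AP[_ e]] := eqVneq (A k l) 0; first by rewrite mulr0.
by case: lj; rewrite e kj subrK.
Qed.

Lemma qdeg_bounds : exists2 b : int, 0 <= b & forall k, - b <= qdeg k <= b.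
Proof.
exists (\sum_k `|qdeg k|); first exact: sumr_ge0.
move=> k; rewrite -ler_norml (bigD1 k) //= lerDl; exact: sumr_ge0.
Qed.

Variables (d Psi : 'M[int]_N).
Local Notation B := (d + Psi).
Hypotheses (dP : bideg 1 0 d) (PsiP : bideg 1 2 Psi).
Hypothesis BB : B *m B = 0.

(** * The correction argument inside a stable subgroup [V]: the whole complex or the reduced one *)

Section Stable.
Variable V : 'rV[int]_N -> Prop.
Hypotheses (VS : submodule V) (V_part : forall j f, V f -> V (qpart j f)).
Hypotheses (V_d : forall f, V f -> V (f *m d)) (V_Psi : forall f, V f -> V (f *m Psi)).
Hypothesis V_div : forall (m : int) f, m != 0 -> V (m *: f) -> V f.
Hypothesis V_tors : forall (m i : int) y z, m != 0 -> V y -> V z -> hrow i z ->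
  y *m B = m *: z -> exists t, [/\ V t, hrow (i - 1) t & z = t *m B].

(** Vanishing of the homology modulo [m], phrased with integral lifts. The modulus is not assumed
    prime: 4 occurs in [four_torsion]. *)
Definition acyclic_mod (m : int) i j := forall f e, V f -> homog i j f ->
  f *m d = m *: e -> exists g e', [/\ V g, homog (i - 1) j g & f = g *m d + m *: e'].

Lemma V_B f : V f -> V (f *m B).
Proof. by move=> Vf; rewrite mulmxDr; apply: (submodD VS); [apply: V_d|apply: V_Psi]. Qed.

(** As [B] squares to 0, the lowest part of the error [u] is a cocycle modulo [m], hence of the form
    [g *m d + m *: e]. Replacing [y] by [y - g] and [z] by [z + e] raises the degree of the error,
    and degrees are bounded. *)
Lemma extend_mod (m : int) i j : m != 0 -> (forall j', j <= j' -> acyclic_mod m i j') ->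
  forall y z u, V y -> V z -> V u -> hrow (i - 1) y -> homog_ge i j u ->
  y *m B = m *: z + u ->
  exists y' z', [/\ V y', V z', y' *m B = m *: z' & homog_ge i j (z' - z)].
Proof.
move=> m0 ac; have [b b0 bP] := qdeg_bounds.
suff H (k : nat) j1 : j <= j1 -> b < j1 + k%:Z -> forall y z u, V y -> V z -> V u ->
    hrow (i - 1) y -> homog_ge i j1 u -> y *m B = m *: z + u ->
    exists y' z', [/\ V y', V z', y' *m B = m *: z' & homog_ge i j (z' - z)].
  by move=> y z u; apply: (H (absz (b + 1 - j)%R) j _ _ y z u); lia.
elim: k j1 => [|k IHk] j1 jj1 bk y z u Vy Vz Vu Hy Hu yB.
  exists y, z; split=> //; last by rewrite subrr; apply: (submod0 (supported_submodule _)).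
  suff u0 : u = 0 by rewrite yB u0 addr0.
  apply/rowP => l; rewrite mxE; apply/eqP; apply: contraTT (bP l) => /Hu[_ h].
  by rewrite negb_and -!ltNge; apply/orP; right; lia.
pose u1 := qpart j1 u.
have Hu1 : homog i j1 u1 by apply: qpart_homog; apply: supported_impl Hu => ? ? [].
have u1d : u1 *m d = m *: - qpart j1 (z *m B).
  have /(congr1 (qpart j1)) : (m *: z + u) *m B = 0 by rewrite -yB -mulmxA BB mulmx0.
  rewrite qpart0 mulmxDl -scalemxAl qpart_linear [u *m B]mulmxDr (qpartD _ (u *m d)).
  rewrite (qpart_mul j1 u dP) (qpart_mul j1 u PsiP) subr0.
  rewrite (@qpart_below i j1 (j1 - 2) u) ?mul0mx ?addr0 //; last lia.
  by move/eqP; rewrite addrC addr_eq0 scalerN => /eqP.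
have [g [e [Vg Hg u1E]]] := ac _ jj1 u1 _ (V_part j1 Vu) Hu1 u1d.
have Ve : V e.
  apply: (V_div m0); have -> : m *: e = u1 - g *m d by rewrite u1E addrC addKr.
  by apply: (submodB VS); [apply: V_part|apply: V_d].
have He : homog i j1 e.
  apply: (supported_scale m0); have -> : m *: e = u1 - g *m d by rewrite u1E addrC addKr.
  apply: (submodB (supported_submodule _)) => //; have := homog_mul dP Hg.
  by rewrite subrK addr0.
have Hg' : hrow (i - 1) g by apply: supported_impl Hg => ? ? [].
have H1 : homog_ge i (j1 + 1) ((u - u1) - g *m Psi).
  apply: (submodB (supported_submodule _)); first exact: qpart_rest.
  by apply: supported_impl (homog_mul PsiP Hg) => a b' [-> ->]; split; lia.
have E1 : (y - g) *m B = m *: (z + e) + ((u - u1) - g *m Psi).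
  rewrite mulmxBl yB u1E [g *m B]mulmxDr scalerDr.
  by move: (g *m d) (g *m Psi) => G1 G2; apply/rowP => k'; rewrite !mxE; ring.
have jj1' : j <= j1 + 1 by lia.
have bk' : b < j1 + 1 + k%:Z by lia.
have [y' [z' [Vy' Vz' yB' Hz']]] := IHk (j1 + 1) jj1' bk' _ _ _ (submodB VS Vy Vg)
   (submodD VS Vz Ve) (submodB VS (submodB VS Vu (V_part _ Vu)) (V_Psi Vg))
   (submodB (supported_submodule _) Hy Hg') H1 E1.
exists y', z'; split=> //; rewrite (_ : z' - z = z' - (z + e) + e).
  apply: (submodD (supported_submodule _) Hz'); apply: supported_impl He => a b' [-> ->]; split=> //.
by rewrite opprD addrA subrK.
Qed.

Definition stable_cocycle i j f := [/\ V f, homog i j f & f *m d = 0].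
Definition stable_coboundary i j f := exists g, [/\ V g, homog (i - 1) j g & f = g *m d].

Lemma stable_cocycle_sub i j : submodule (stable_cocycle i j).
Proof.
split=> [|a u v [Vu Hu du] [Vv Hv dv]].
  by split; [exact: submod0 | apply: (submod0 (supported_submodule _)) | rewrite mul0mx].
split; [exact: VS.2 | exact: (supported_submodule _).2 |].
by rewrite mulmxDl -scalemxAl du dv scaler0 addr0.
Qed.

Lemma stable_coboundary_sub i j : submodule (stable_coboundary i j).
Proof.
split=> [|a u v [g [Vg Hg ->]] [g' [Vg' Hg' ->]]].
  by exists 0; split; [exact: submod0 | apply: (submod0 (supported_submodule _)) | rewrite mul0mx].
exists (a *: g + g'); split; [exact: VS.2 | exact: (supported_submodule _).2 |].
by rewrite mulmxDl -scalemxAl.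
Qed.

Hypothesis dd : d *m d = 0.

(** A cocycle is [g *m d + p *: e] with [e] again a cocycle, so cocycles modulo coboundaries are
    divisible by [p], and Nakayama's lemma applies. *)
Lemma acyclic_coprime p i j f : prime p -> acyclic_mod p i j -> stable_cocycle i j f ->
  exists c, stable_coboundary i j ((1 + p%:Z * c) *: f).
Proof.
move=> pp ac; have p0 : p%:Z != 0 by rewrite eqz_nat -lt0n prime_gt0.
apply: (p_divisible_coprime pp (stable_cocycle_sub i j) (stable_coboundary_sub i j)).
move=> {}f [Vf Hf fd].
have [|g [e [Vg Hg fE]]] := ac f 0 Vf Hf; first by rewrite fd scaler0.
have eE : p%:Z *: e = f - g *m d by rewrite fE addrC addKr.
exists (g *m d), e; split=> //; first by exists g.
split.
- by apply: (V_div p0); rewrite eE; apply: (submodB VS) => //; apply: V_d.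
- apply: (supported_scale p0); rewrite eE; apply: (submodB (supported_submodule _)) => //.
  by have := homog_mul dP Hg; rewrite subrK addr0.
apply/rowP => k; have /rowP/(_ k) : p%:Z *: (e *m d) = 0.
  by rewrite scalemxAl eE mulmxBl fd -mulmxA dd mulmx0 subrr.
by rewrite !mxE => /eqP; rewrite mulf_eq0 (negPf p0) => /eqP.
Qed.

(** As [z] starts in degree [j], the lowest part of [t], when below [j - 2], is a cocycle, and a
    multiple of it by some [1 + p c] is [g *m d]. Subtracting [g *m B] from that multiple of [t]
    raises its lowest degree and does not affect its image under [B]. *)
Lemma push_up p i j : prime p ->
  (forall j', j' < j - 2 -> acyclic_mod p (i - 1) j') ->
  forall t z, V t -> hrow (i - 1) t -> homog_ge i j z -> t *m B = z ->
  exists c t', [/\ V t', homog_ge (i - 1) (j - 2) t' & t' *m B = (1 + p%:Z * c) *: z].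
Proof.
move=> pp ac; have [b b0 bP] := qdeg_bounds.
suff H (k : nat) j1 t z : j - 2 <= j1 + k%:Z -> V t -> homog_ge (i - 1) j1 t ->
    homog_ge i j z -> t *m B = z ->
    exists c t', [/\ V t', homog_ge (i - 1) (j - 2) t' & t' *m B = (1 + p%:Z * c) *: z].
  move=> t z Vt Ht; apply: (H (absz (j - 2 + b)%R) (- b)) => //; first lia.
  by move=> l /Ht ->; split=> //; have /andP[] := bP l.
elim: k j1 t z => [|k IHk] j1 t z jk Vt Ht Hz tB.
  exists 0, t; split=> //; last by rewrite mulr0 addr0 scale1r.
  by apply: supported_impl Ht => a' b' [-> h]; split=> //; lia.
have [h|jj1] := lerP (j - 2) j1.
  exists 0, t; split=> //; last by rewrite mulr0 addr0 scale1r.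
  by apply: supported_impl Ht => a' b' [-> h']; split=> //; lia.
have t1d : qpart j1 t *m d = 0.
  have := congr1 (qpart j1) tB; rewrite mulmxDr qpartD !(qpart_mul _ _ dP) (qpart_mul _ _ PsiP).
  rewrite subr0 (@qpart_below _ _ (j1 - 2) t Ht) ?mul0mx ?addr0; last lia.
  by move=> ->; rewrite (qpart_below Hz) //; lia.
have [|c [g [Vg Hg gE]]] := @acyclic_coprime p (i - 1) j1 (qpart j1 t) pp (ac _ jj1).
  by split=> //; [exact: V_part | apply: qpart_homog; apply: supported_impl Ht => ? ? []].
have tB' : ((1 + p%:Z * c) *: t - g *m B) *m B = (1 + p%:Z * c) *: z.
  by rewrite mulmxBl -mulmxA BB mulmx0 subr0 -scalemxAl tB.
have Ht' : homog_ge (i - 1) (j1 + 1) ((1 + p%:Z * c) *: t - g *m B).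
  have -> : (1 + p%:Z * c) *: t - g *m B =
            (1 + p%:Z * c) *: (t - qpart j1 t) - g *m Psi.
    rewrite scalerBr gE mulmxDr; move: (_ *: t) (g *m d) (g *m Psi) => t1 G1 G2.
    by rewrite opprD addrA.
  apply: (submodB (supported_submodule _)); first exact/(submodZ (supported_submodule _))/qpart_rest.
  by apply: supported_impl (homog_mul PsiP Hg) => a' b' [-> ->]; split; lia.
have Hz' : homog_ge i j ((1 + p%:Z * c) *: z) by apply: (submodZ (supported_submodule _)).
have [||c' [t' [Vt' Ht'' tB'']]] := IHk (j1 + 1) _ _ _ _ Ht' Hz' tB'.
- lia.
- by apply: (submodB VS); [exact: submodZ | exact: V_B].
exists (c' + c + p%:Z * c' * c), t'; split=> //; rewrite tB'' scalerA.
by congr (_ *: _); ring.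
Qed.

(* If [y] is a deformed cocycle modulo [m] up to terms of high degree, whose
   leading qpart bounds [m z], then [z] lifts to a deformed coboundary, so that
   it is hit by [Psi] from the next diagonal. *)
Lemma lift_coboundary p (m : int) i j j0 : prime p -> m != 0 -> j < j0 ->
  (forall j', j0 <= j' -> acyclic_mod m i j') ->
  (forall j', j' < j - 2 -> acyclic_mod p (i - 1) j') ->
  forall y z u, V y -> V z -> V u -> hrow (i - 1) y -> homog_ge i j z ->
  homog_ge i j0 u -> y *m B = m *: z + u ->
  exists c q r, [/\ V q, V r, homog (i - 1) (j - 2) q /\ homog (i - 1) j r, q *m d = 0
    & (1 + p%:Z * c) *: qpart j z = r *m d + q *m Psi].
Proof.
move=> pp m0 jj0 ac1 ac2 y z u Vy Vz Vu Hy Hz Hu yB.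
have [y' [z' [Vy' Vz' yB' Hz']]] := extend_mod m0 ac1 Vy Vz Vu Hy Hu yB.
have Hz'j : homog_ge i j z'.
  rewrite -(subrK z z'); apply: (submodD (supported_submodule _)) => //.
  by apply: supported_impl Hz' => a' b' [-> h]; split=> //; lia.
have Hz'i : hrow i z' by apply: supported_impl Hz'j => ? ? [].
have [t0 [Vt0 Ht0 z'E]] := V_tors m0 Vy' Vz' Hz'i yB'.
have [c [t [Vt Ht tB]]] := push_up pp ac2 Vt0 Ht0 Hz'j (esym z'E).
have Hti : hrow (i - 1) t by apply: supported_impl Ht => ? ? [].
have z'z : qpart j z' = qpart j z.
  by rewrite -(subrK z z') qpartD (qpart_below Hz' jj0) add0r.
(* [t] starts in degree [j - 2], so [t *m B] has the parts [q *m d] in degree [j - 2], where [z']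
   vanishes, and [r *m d + q *m Psi] in degree [j], where [z'] agrees with [z]. *)
exists c, (qpart (j - 2) t), (qpart j t); split; try exact: V_part.
- by split; apply: qpart_homog.
- have := congr1 (qpart (j - 2)) tB; rewrite mulmxDr qpartD (qpart_mul _ _ dP).
  rewrite (qpart_mul _ _ PsiP) subr0 (@qpart_below _ _ (j - 2 - 2) t Ht); last lia.
  rewrite mul0mx addr0 qpartZ => ->; rewrite (qpart_below Hz'j) ?scaler0 //; lia.
have := congr1 (qpart j) tB; rewrite mulmxDr qpartD (qpart_mul _ _ dP).
by rewrite (qpart_mul _ _ PsiP) subr0 qpartZ z'z.
Qed.

Lemma acyclic_sqr (m : int) i j : m != 0 -> acyclic_mod m i j -> acyclic_mod (m * m) i j.
Proof.
move=> m0 ac f e Vf Hf fd.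
have [|g [e1 [Vg Hg fE]]] := ac f (m *: e) Vf Hf; first by rewrite fd scalerA.
have e1E : m *: e1 = f - g *m d by rewrite fE addrC addKr.
have Ve1 : V e1.
  by apply: (V_div m0); rewrite e1E; apply: (submodB VS) => //; apply: V_d.
have He1 : homog i j e1.
  apply: (supported_scale m0); rewrite e1E; apply: (submodB (supported_submodule _)) => //.
  by have := homog_mul dP Hg; rewrite subrK addr0.
have e1d : e1 *m d = m *: e.
  apply/rowP => k; have /rowP/(_ k) : m *: (e1 *m d) = m *: (m *: e).
    by rewrite scalemxAl e1E mulmxBl fd -mulmxA dd mulmx0 subr0 scalerA.
  by rewrite [LHS]mxE [RHS]mxE => /(mulfI m0).
have [g' [e2 [Vg' Hg' e1E']]] := ac e1 e Ve1 He1 e1d.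
exists (g + m *: g'), e2; split.
- by apply: (submodD VS) => //; apply: submodZ.
- by apply: (submodD (supported_submodule _)) => //; apply: (submodZ (supported_submodule _)).
by rewrite fE e1E' scalerDr mulmxDl -scalemxAl scalerA addrA.
Qed.

End Stable.

(** * The operator [Nu] and odd torsion *)

Section Operators.
Variable Nu : 'M[int]_N.
Hypotheses (NuP : bideg 0 2 Nu) (dd : d *m d = 0).
Hypothesis Nud : Nu *m d - d *m Nu = 2 *: Psi.
Let true_pred (f : 'rV[int]_N) := True.
Hypothesis tors : forall (m i : int) y z, m != 0 -> hrow i z ->
  y *m B = m *: z -> exists t, hrow (i - 1) t /\ z = t *m B.

Lemma true_sub : submodule true_pred. Proof. by []. Qed.

Lemma true_tors (m i : int) y z : m != 0 -> true_pred y -> true_pred z -> hrow i z ->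
  y *m B = m *: z -> exists t, [/\ true_pred t, hrow (i - 1) t & z = t *m B].
Proof. by move=> m0 _ _ Hz /(tors m0 Hz)[t []]; exists t. Qed.

Local Notation acyclic := (acyclic_mod true_pred).

Lemma homog_ge_of_homog i j f : homog i j f -> homog_ge i j f.
Proof. by move=> Hf; apply: supported_impl Hf => a b [-> ->]. Qed.

Lemma hrow_of_homog i j f : homog i j f -> hrow i f.
Proof. by move=> Hf; apply: supported_impl Hf => ? ? []. Qed.

(** Removes the factors left by [acyclic_coprime] and [push_up]. *)
Lemma bezout_mem (S : 'rV[int]_N -> Prop) (k c : int) f : submodule S ->
  S (k *: f) -> S ((1 + k * c) *: f) -> S f.
Proof.
move=> SS Sk S1; rewrite (_ : f = (1 + k * c) *: f - c *: (k *: f)).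
  by apply: (submodB SS) => //; apply: submodZ.
by rewrite scalerA -scalerBl -[LHS]scale1r; congr (_ *: _); ring.
Qed.

(* As [2 Psi] is the commutator of [d] and [Nu], replacing [y] by [2 y - y Nu]
   moves the error term [Psi] of the deformed coboundary up by one more step,
   past the group in degree [j + 2], which need not vanish. *)
Lemma odd_torsion p i j x y : prime p -> odd p ->
  (forall j', j + 4 <= j' -> acyclic p i j') ->
  (forall j', j' < j - 2 -> acyclic p (i - 1) j') ->
  homog i j x -> homog (i - 1) j y -> p%:Z *: x = y *m d ->
  exists2 y', homog (i - 1) j y' & x = y' *m d.
Proof.
move=> pp op ac1 ac2 Hx Hy xy; have p0 : p%:Z != 0 by rewrite eqz_nat -lt0n prime_gt0.
have HN a b f : homog a b f -> homog a (b + 2) (f *m Nu).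
  by move=> Hf; have := homog_mul NuP Hf; rewrite addr0.
have dNu f : f *m d *m Nu = f *m Nu *m d - 2 *: (f *m Psi).
  have /(congr1 (mulmx f)) := Nud; rewrite mulmxBr !mulmxA -scalemxAr => <-.
  by rewrite opprB addrC subrK.
(* The error of [2 *: y] lies in degree [j + 2], where homology may survive. By the commutator
   identity [y *m Nu] has the same error modulo [p], up to a term in degree [j + 4], which is above
   both diagonals. *)
pose y0 := 2 *: y - y *m Nu; pose z0 := 2 *: x - x *m Nu; pose u0 := - (y *m Nu *m Psi).
have E0 : y0 *m B = p%:Z *: z0 + u0.
  have pxN : p%:Z *: (x *m Nu) = y *m Nu *m d - 2 *: (y *m Psi).
    by rewrite scalemxAl xy dNu.
  rewrite /y0 /z0 /u0 mulmxBl -scalemxAl [y *m B]mulmxDr -xy.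
  rewrite [y *m Nu *m B]mulmxDr scalerBr pxN.
  move: (y *m Nu *m d) (y *m Nu *m Psi) (y *m Psi) => a2 a3 a4.
  by apply/rowP => k; rewrite !mxE; ring.
have Hz0 : homog_ge i j z0.
  apply: (submodB (supported_submodule _)); first exact/(submodZ (supported_submodule _))/homog_ge_of_homog.
  by apply: supported_impl (HN _ _ _ Hx) => a b [-> ->]; split=> //; lia.
have Hu0 : homog_ge i (j + 4) u0.
  apply: (submodN (supported_submodule _)).
  by apply: supported_impl (homog_mul PsiP (HN _ _ _ Hy)) => a b [-> ->]; split; lia.
have Hy0 : hrow (i - 1) y0.
  apply: (submodB (supported_submodule _)); first exact/(submodZ (supported_submodule _))/(hrow_of_homog Hy).
  exact: hrow_of_homog (HN _ _ _ Hy).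
have jj : j < j + 4 by lia.
have V_div (m : int) f : m != 0 -> true_pred (m *: f) -> true_pred f by [].
have [c [q [r [_ _ [Hq Hr] qd0 E]]]] := @lift_coboundary true_pred true_sub
  (fun _ _ _ => I) (fun _ _ => I) (fun _ _ => I) V_div true_tors dd
  p p i j (j + 4) pp p0 jj ac1 ac2 y0 z0 u0 I I I Hy0 Hz0 Hu0 E0.
have z0E : qpart j z0 = 2 *: x.
  rewrite /z0 -scaleN1r addrC qpart_linear qpartZ (qpart_id Hx) (@qpart_below i (j + 2)) ?scaler0 ?add0r //.
    exact/homog_ge_of_homog/HN.
  lia.
have qN : 2 *: (q *m Psi) = q *m Nu *m d.
  by have := dNu q; rewrite qd0 mul0mx => /esym/eqP; rewrite subr_eq0 => /eqP->.
pose S f := exists2 y', homog (i - 1) j y' & f = y' *m d.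
have SS : submodule S.
  split; first by exists 0; [apply: (submod0 (supported_submodule _)) | rewrite mul0mx].
  move=> a u v [u' Hu' ->] [v' Hv' ->]; exists (a *: u' + v'); first exact: (supported_submodule _).2.
  by rewrite mulmxDl -scalemxAl.
have Spx : S (p%:Z *: x) by exists y.
apply: (@bezout_mem S p%:Z c x SS Spx).
(* One factor 2 comes from [z0]; the other makes [q *m Psi] a coboundary, [q] being a cocycle. *)
have S4 : S (4%:Z *: ((1 + p%:Z * c) *: x)).
  exists (2 *: r + q *m Nu).
    apply: (submodD (supported_submodule _)); first exact: (submodZ (supported_submodule _)).
    by have := HN _ _ _ Hq; rewrite subrK.
  rewrite mulmxDl -qN -scalemxAl -scalerDr -E z0E !scalerA.
  by congr (_ *: _); ring.
have Spf : S (p%:Z *: ((1 + p%:Z * c) *: x)).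
  by rewrite scalerA mulrC -scalerA; apply: submodZ.
have [k pk] : exists k, p = (2 * k + 1)%N.
  by exists p./2; rewrite -{1}(odd_double_half p) op addnC mul2n.
move: Spf S4; move: (_ *: x) => f Spf S4.
(* With [p = 2k + 1], the Bezout identity for [p] and 4 is [p^2 - 4 (k^2 + k) = 1]. *)
rewrite (_ : f = p%:Z *: (p%:Z *: f) - (k%:Z * k%:Z + k%:Z) *: (4%:Z *: f)).
  by apply: (submodB SS); apply: submodZ.
rewrite !scalerA -scalerBl -[LHS]scale1r; congr (_ *: _).
by rewrite pk PoszD PoszM; ring.
Qed.

(** * The reduced complex at a base point and torsion at 2 *)

Section Reduced.
Variables (X P : 'M[int]_N).
Hypotheses (XD : bideg 0 (-2) X) (PD : bideg 0 0 P).
Hypotheses (XP : X *m P = X) (PX : P *m X = 0) (PP : P *m P = P).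
Hypotheses (Xd : X *m d = d *m X) (XB : (X + P) *m B = B *m (X + P)).
Hypothesis NuX : Nu *m X - X *m Nu = 2 *: P - 1%:M.

(** [P] projects onto the generators labelled X at a base point. Its image is also the kernel of
    [X], hence stable under [d], and the part fixed by [X + P], hence stable under [B]. *)
Definition reduced f := f *m P = f.

Lemma reduced_sub : submodule reduced.
Proof.
split=> [|a u v Hu Hv]; first exact: mul0mx.
by rewrite /reduced mulmxDl -scalemxAl Hu Hv.
Qed.

Lemma reducedX f : reduced f -> f *m X = 0.
Proof. by move=> <-; rewrite -mulmxA PX mulmx0. Qed.

Lemma NuXE f : f *m Nu *m X = f *m X *m Nu + 2 *: (f *m P) - f.
Proof.
have /(congr1 (mulmx f)) := NuX; rewrite !mulmxBr mulmx1 !mulmxA -scalemxAr.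
by move/eqP; rewrite subr_eq => /eqP ->; rewrite addrC addrA.
Qed.

(** The commutator [NuX] places [f - f *m P] in the image of [P], while [P] kills it. *)
Lemma reduced_of_X f : f *m X = 0 -> reduced f.
Proof.
move=> fX; have := NuXE f; rewrite fX mul0mx add0r => E.
have gE : f - f *m P = f *m P - f *m Nu *m X.
  by rewrite E; apply/rowP => k; rewrite !mxE; ring.
have : (f - f *m P) *m P = f - f *m P.
  by rewrite {1}gE mulmxBl -!mulmxA XP PP mulmxA -gE.
rewrite mulmxBl -mulmxA PP subrr => /esym/eqP; rewrite subr_eq0 => /eqP e.
by rewrite /reduced -e.
Qed.

Lemma reduced_NuX f : reduced f -> f *m Nu *m X = f.
Proof.
move=> Hf; rewrite NuXE (reducedX Hf) mul0mx add0r Hf.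
by rewrite scaler_nat mulr2n addrK.
Qed.

Lemma reduced_mulX f : reduced (f *m X).
Proof. by rewrite /reduced -mulmxA XP. Qed.

Lemma reduced_qpart j f : reduced f -> reduced (qpart j f).
Proof.
move=> Hf; have := qpart_mul j f PD; rewrite subr0 Hf => e.
by rewrite /reduced -e.
Qed.

Lemma reduced_d f : reduced f -> reduced (f *m d).
Proof.
move=> Hf; apply: reduced_of_X.
by rewrite -mulmxA -Xd mulmxA (reducedX Hf) mul0mx.
Qed.

Lemma reduced_XP f : f *m (X + P) = f -> reduced f.
Proof.
by move=> fXP; rewrite /reduced -{1}fXP -mulmxA mulmxDl XP PP.
Qed.

Lemma mulXP_reduced f : reduced f -> f *m (X + P) = f.
Proof. by move=> Hf; rewrite mulmxDr (reducedX Hf) Hf add0r. Qed.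

Lemma reduced_Psi f : reduced f -> reduced (f *m Psi).
Proof.
move=> Hf; rewrite (_ : f *m Psi = f *m B - f *m d); last by rewrite mulmxDr addrC addKr.
apply: (submodB reduced_sub); last exact: reduced_d.
by apply: reduced_XP; rewrite -mulmxA -XB mulmxA mulXP_reduced.
Qed.

Lemma reduced_div (m : int) f : m != 0 -> reduced (m *: f) -> reduced f.
Proof.
move=> m0; rewrite /reduced -scalemxAl => /rowP H; apply/rowP => k.
by have := H k; rewrite !mxE => /(mulfI m0).
Qed.

(** [X + P] commutes with [B], maps into the reduced complex and is the identity there, so it makes
    a primitive of [z] reduced. *)
Lemma reduced_tors (m i : int) y z : m != 0 -> reduced y -> reduced z -> hrow i z ->
  y *m B = m *: z -> exists t, [/\ reduced t, hrow (i - 1) t & z = t *m B].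
Proof.
move=> m0 Hy Hz Hzi /(tors m0 Hzi)[t [Ht zE]]; exists (t *m (X + P)); split.
- by rewrite /reduced -mulmxA mulmxDl XP PP.
- rewrite mulmxDr; apply: (submodD (supported_submodule _)).
    by have := hrow_mul XD Ht; rewrite addr0.
  by have := hrow_mul PD Ht; rewrite addr0.
by rewrite -mulmxA XB mulmxA -zE mulXP_reduced.
Qed.

Lemma dNuE f : f *m d *m Nu = f *m Nu *m d - 2 *: (f *m Psi).
Proof.
have /(congr1 (mulmx f)) := Nud; rewrite mulmxBr !mulmxA -scalemxAr => <-.
by rewrite opprB addrC subrK.
Qed.

Lemma homog_Nu i j f : homog i j f -> homog i (j + 2) (f *m Nu).
Proof. by move=> Hf; have := homog_mul NuP Hf; rewrite addr0. Qed.

Lemma homog_X i j f : homog i j f -> homog i (j - 2) (f *m X).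
Proof. by move=> Hf; have := homog_mul XD Hf; rewrite addr0. Qed.

(* Modulo 2 the operator [Nu] commutes with [d] and [Nu X + X Nu = 1], so the
   unreduced complex is a sum of two shifted copies of the reduced one. *)
Lemma reduced_acyclic i j : acyclic 2 i j -> acyclic_mod reduced 2 i j.
Proof.
move=> ac f e Hf Hfi fd; have [c [e1 [_ Hc fE]]] := ac f e I Hfi fd.
exists (c *m Nu *m X), ((e1 *m Nu - c *m Psi) *m X); split.
- exact: reduced_mulX.
- by have := homog_X (homog_Nu Hc); rewrite addrK.
rewrite -{1}(reduced_NuX Hf) fE mulmxDl dNuE -scalemxAl mulmxDl mulmxBl -!scalemxAl.
rewrite -[c *m Nu *m d *m X]mulmxA -Xd mulmxA mulmxBl scalerBr.
by rewrite addrAC addrA.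
Qed.

(** The second copy: [f *m Nu] is a cocycle modulo 2 in degree [j + 2], and [X] carries a primitive
    of it to one of [f *m Nu *m X = f]. *)
Lemma reduced_acyclic_shift i j : acyclic 2 i (j + 2) -> acyclic_mod reduced 2 i j.
Proof.
move=> ac f e Hf Hfi fd.
have [|c [e1 [_ Hc fE]]] := ac (f *m Nu) (e *m Nu + f *m Psi) I (homog_Nu Hfi).
  have := dNuE f; rewrite fd -scalemxAl scalerDr => ->; by rewrite subrK.
exists (c *m X), (e1 *m X); split; first exact: reduced_mulX.
  by have := homog_X Hc; rewrite addrK.
by rewrite -{1}(reduced_NuX Hf) fE mulmxDl -!scalemxAl -!mulmxA Xd.
Qed.

(* The class of [x] is moved into the reduced complex, which modulo 2 lives on a
   single diagonal; there [4 k = 2 l Psi] up to coboundaries, and lifting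
   [l] to the deformed complex shows that [k] itself is hit by [Psi]. *)
Lemma four_torsion i j x y :
  (forall j', j' != j -> j' != j + 2 -> acyclic 2 i j') ->
  (forall j', j' < j - 2 -> acyclic 2 (i - 1) j') ->
  homog i j x -> homog (i - 1) j y -> x *m d = 0 -> 4 *: x = y *m d ->
  exists2 y', homog (i - 1) j y' & 2 *: x = y' *m d.
Proof.
move=> ac1 ac2 Hx Hy xd xy.
pose S f := exists2 y', homog (i - 1) j y' & f = y' *m d.
have SS : submodule S.
  split; first by exists 0; [apply: (submod0 (supported_submodule _)) | rewrite mul0mx].
  move=> a u v [u' Hu' ->] [v' Hv' ->]; exists (a *: u' + v'); first exact: (supported_submodule _).2.
  by rewrite mulmxDl -scalemxAl.
(* Degree [j - 2] is off both diagonals, so an odd multiple of [x *m X] has a reduced primitive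
   [z]. *)
have acV : acyclic_mod reduced 2%:Z i (j - 2).
  by apply: reduced_acyclic; apply: ac1; apply/eqP; lia.
have [|c [z [Vz Hz zE]]] := acyclic_coprime reduced_sub reduced_d reduced_div dd
    (p := 2) (f := x *m X) isT acV.
  split; [exact: reduced_mulX | exact: homog_X |].
  by rewrite -mulmxA Xd mulmxA xd mul0mx.
(* As [z *m Nu *m X = z], subtracting the coboundary of [z *m Nu] kills the image under [X]: [k] is
   reduced and represents an odd multiple of the class of [x]. *)
pose k := (1 + 2%:Z * c) *: x - z *m Nu *m d.
pose y1 := (1 + 2%:Z * c) *: y - 4 *: (z *m Nu).
have Hz' : homog (i - 1) j (z *m Nu) by have := homog_Nu Hz; rewrite subrK.
have Hy1 : homog (i - 1) j y1.
  by apply: (submodB (supported_submodule _)); apply: (submodZ (supported_submodule _)).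
have k4 : 4 *: k = y1 *m d.
  rewrite /k /y1 mulmxBl -!scalemxAl -xy scalerBr !scalerA.
  by congr (_ *: _ - _); ring.
have Hk : homog i j k.
  apply: (submodB (supported_submodule _)); first exact: (submodZ (supported_submodule _)).
  by have := homog_mul dP Hz'; rewrite subrK addr0.
have kX : k *m X = 0.
  rewrite /k mulmxBl -scalemxAl zE -[z *m Nu *m d *m X]mulmxA -Xd mulmxA.
  by rewrite (reduced_NuX Vz) subrr.
have Vk := reduced_of_X kX.
(* [l] measures the failure of [y1] to be reduced. It is a cocycle with [l *m Nu = y1 - l1], so the
   commutator identity expresses [4 *: k] through the reduced cochains [l] and [l1]. *)
pose l := y1 *m X; pose l1 := 2 *: (y1 *m P) - y1 *m Nu *m X.
have ld : l *m d = 0 by rewrite /l -mulmxA Xd mulmxA -k4 -scalemxAl kX scaler0.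
have lPsi : 2 *: (l *m Psi) = 4 *: k - l1 *m d.
  have := dNuE l; rewrite ld mul0mx => /esym/eqP; rewrite subr_eq0 => /eqP <-.
  have -> : l *m Nu = y1 - l1.
    by rewrite /l1 NuXE /l; apply/rowP => t; rewrite !mxE; ring.
  by rewrite mulmxBl k4.
have Vl : reduced l by exact: reduced_mulX.
have Vl1 : reduced l1.
  apply: (submodB reduced_sub); last exact: reduced_mulX.
  by apply: (submodZ reduced_sub); rewrite /reduced -mulmxA PP.
have Hl : homog (i - 1) (j - 2) l by exact: homog_X.
have Hl1 : homog (i - 1) j l1.
  apply: (submodB (supported_submodule _)); last by have := homog_X (homog_Nu Hy1); rewrite addrK.
  by apply: (submodZ (supported_submodule _)); have := homog_mul PD Hy1; rewrite !addr0.
have E0 : (2 *: l + l1) *m B = (2%:Z * 2%:Z) *: k + l1 *m Psi.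
  rewrite mulmxDl -scalemxAl !mulmxDr ld add0r lPsi addrA.
  by rewrite -[4 *: k - _ + _]addrA addNr addr0.
have Hu : homog_ge i (j + 2) (l1 *m Psi).
  by have := homog_ge_of_homog (homog_mul PsiP Hl1); rewrite subrK.
have Hy0 : hrow (i - 1) (2 *: l + l1).
  apply: (supported_submodule _).2; [exact: hrow_of_homog Hl | exact: hrow_of_homog Hl1].
have m0 : 2%:Z * 2%:Z != 0 by [].
have jj : j < j + 2 by lia.
have ac1' j' : j + 2 <= j' -> acyclic_mod reduced (2%:Z * 2%:Z) i j'.
  move=> jj'; apply: acyclic_sqr => //; try exact: reduced_sub; try exact: reduced_d;
    try exact: reduced_div.
  (* Degree [j + 2] lies on a diagonal, but reduced homology modulo 2 vanishes there by comparison
     with degree [j + 4]. *)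
  have [->|ne] := eqVneq j' (j + 2).
    by apply: reduced_acyclic_shift; apply: ac1; apply/eqP; lia.
  by apply: reduced_acyclic; apply: ac1 => //; apply/eqP; lia.
have ac2' j' : j' < j - 2 -> acyclic_mod reduced 2%:Z (i - 1) j'.
  by move=> jj'; apply/reduced_acyclic/ac2.
have [c' [q [r [Vq Vr [Hq Hr] qd0 E]]]] := @lift_coboundary reduced reduced_sub
  reduced_qpart reduced_d reduced_Psi reduced_div reduced_tors dd
  2 (2%:Z * 2%:Z) i j (j + 2) isT m0 jj ac1' ac2' _ _ _
  (reduced_sub.2 2 _ _ Vl Vl1) Vk (reduced_Psi Vl1) Hy0 (homog_ge_of_homog Hk) Hu E0.
rewrite (qpart_id Hk) in E.
(* [q *m Psi] becomes a coboundary only after doubling, so [2 *: k] is reached and not [k]. *)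
have Sk1 : S ((1 + 2%:Z * c') *: (2%:Z *: k)).
  exists (2 *: r + q *m Nu).
    apply: (supported_submodule _).2 => //; by have := homog_Nu Hq; rewrite subrK.
  have := dNuE q; rewrite qd0 mul0mx => /esym/eqP; rewrite subr_eq0 => /eqP qN.
  by rewrite scalerA mulrC -scalerA E scalerDr mulmxDl -scalemxAl qN.
have Sk2 : S (2%:Z *: (2%:Z *: k)) by exists y1 => //; rewrite scalerA.
have Sk := bezout_mem SS Sk2 Sk1.
have Sx1 : S ((1 + 2%:Z * c) *: (2%:Z *: x)).
  rewrite scalerA mulrC -scalerA.
  rewrite (_ : _ *: x = k + z *m Nu *m d); last by rewrite subrK.
  by rewrite scalerDr; apply: (submodD SS) => //; apply: (submodZ SS); exists (z *m Nu).
have Sx2 : S (2%:Z *: (2%:Z *: x)) by exists y => //; rewrite scalerA.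
exact: (bezout_mem SS Sx2 Sx1).
Qed.

End Reduced.
End Operators.
End Graded.

(** * The operators on the deformed Khovanov complex *)

Section Components.
Variables (N : nat) (hdeg qdeg : 'I_N -> int).
Implicit Types (A M : 'M[int]_N) (k a b : int).
Local Notation bideg := (bideg hdeg qdeg).

Definition degree_part k A : 'M[int]_N :=
  \matrix_(i, j) (if qdeg j == qdeg i + k then A i j else 0).

Lemma degree_partD k A M : degree_part k (A + M) = degree_part k A + degree_part k M.
Proof. by apply/matrixP => i j; rewrite !mxE; case: ifP; rewrite ?addr0. Qed.

Lemma degree_partN k A : degree_part k (- A) = - degree_part k A.
Proof. by apply/matrixP => i j; rewrite !mxE; case: ifP; rewrite ?oppr0. Qed.

Lemma compB k A M : degree_part k (A - M) = degree_part k A - degree_part k M.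
Proof. by apply/matrixP => i j; rewrite !mxE; case: ifP; rewrite ?subr0. Qed.

Lemma degree_part_id a k A : bideg a k A -> degree_part k A = A.
Proof.
move=> AP; apply/matrixP => i j; rewrite !mxE; case: ifP => // ne.
by apply/esym/eqP/negPn/negP => /AP[_ e]; rewrite e eqxx in ne.
Qed.

Lemma degree_part_neq a b k A : bideg a b A -> k != b -> degree_part k A = 0.
Proof.
move=> AP kb; apply/matrixP => i j; rewrite !mxE; case: eqP => // e.
apply/eqP/negPn/negP => /AP[_ e']; case/eqP: kb; apply: (addrI (qdeg i)).
by rewrite -e -e'.
Qed.

Lemma degree_part_mulr a b k A M : bideg a b M -> degree_part k (A *m M) = degree_part (k - b) A *m M.
Proof.
move=> MP; apply/matrixP => i j; rewrite !mxE.
have E l : M l j = 0 \/ (qdeg l == qdeg i + (k - b)) = (qdeg j == qdeg i + k).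
  have [|/MP[_ ->]] := eqVneq (M l j) 0; [by left | right].
  by apply/eqP/eqP; lia.
case: eqP => [jk|jk].
  apply: eq_bigr => l _; rewrite mxE; have [->|->] := E l; first by rewrite !mulr0.
  by rewrite jk eqxx.
rewrite big1 // => l _; rewrite mxE; have [->|->] := E l; first by rewrite mulr0.
by case: eqP => [/jk|]; rewrite ?mul0r.
Qed.

Lemma degree_part_mull a b k A M : bideg a b M -> degree_part k (M *m A) = M *m degree_part (k - b) A.
Proof.
move=> MP; apply/matrixP => i j; rewrite !mxE.
have E l : M i l = 0 \/ (qdeg j == qdeg l + (k - b)) = (qdeg j == qdeg i + k).
  have [|/MP[_ ->]] := eqVneq (M i l) 0; [by left | right].
  by rewrite -addrA [b + _]addrC subrK.
case: eqP => [jk|jk].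
  apply: eq_bigr => l _; rewrite mxE; have [->|->] := E l; first by rewrite !mul0r.
  by rewrite jk eqxx.
rewrite big1 // => l _; rewrite mxE; have [->|->] := E l; first by rewrite mul0r.
by case: eqP => [/jk|]; rewrite ?mulr0.
Qed.

End Components.

Section Identities.
Variable D : link_diagram.
Local Notation St := (state D).
Implicit Types p : point D.

Definition hdeg (k : 'I_#|{: St}|) : int := state_hdeg (enum_val k).
Definition qdeg (k : 'I_#|{: St}|) : int := state_qdeg (enum_val k).
Local Notation bideg := (bideg hdeg qdeg).
Local Notation degree_part := (degree_part qdeg).

Definition Bmx := fun_mx (@deformed_coef D).
Definition dmx := fun_mx (@diff_coef D).
Definition Psimx := locked (Bmx - dmx).
Definition Xmx p := fun_mx (@mulX_coef D p).
Definition Pmx p := fun_mx (@proj_coef D p).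
Definition Tmx := fun_mx (@below_coef D).
Definition Jmx := fun_mx (@sign_coef D).
(* [Tmx] followed by [Jmx] is, up to sign, the substitution of [1 - X] for [X],
   an automorphism of the deformed complex.  Its first correction term [Numx]
   is the sum over the circles labelled X of their relabelling by 1. *)
Definition Numx := degree_part 2 Tmx.

Lemma BmxE : dmx + Psimx = Bmx.
Proof. by rewrite /Psimx -lock addrC subrK. Qed.

Lemma dmxP : bideg 1 0 dmx.
Proof. by move=> k l; rewrite mxE => /diff_degree[h q]; rewrite /hdeg /qdeg h q addr0. Qed.

Lemma PsimxP : bideg 1 2 Psimx.
Proof. by move=> k l; rewrite /Psimx -lock !mxE => /deformed_degree[h q]; rewrite /hdeg /qdeg h q. Qed.

Lemma XmxP p : bideg 0 (-2) (Xmx p).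
Proof. by move=> k l; rewrite mxE => /mulX_degree[h q]; rewrite /hdeg /qdeg h q addr0. Qed.

Lemma PmxP p : bideg 0 0 (Pmx p).
Proof.
move=> k l; rewrite mxE /proj_coef.
case: (enum_val l =P enum_val k) => [e _|_]; last by rewrite eqxx.
by rewrite /hdeg /qdeg e !addr0.
Qed.

Lemma NumxP : bideg 0 2 Numx.
Proof.
move=> k l; rewrite !mxE; case: (qdeg l =P _) => [e|]; last by rewrite eqxx.
by move/below_degree => h; rewrite addr0 /hdeg h.
Qed.

Lemma degree_part0_Tmx : degree_part 0 Tmx = 1%:M.
Proof.
apply/matrixP => i j; rewrite !mxE addr0; case: eqP => [/below_degree0->|ne].
  by rewrite (inj_eq enum_val_inj).
by case: eqP => // e; rewrite e in ne.
Qed.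

Lemma Bsqr : (dmx + Psimx) *m (dmx + Psimx) = 0.
Proof. by rewrite BmxE; apply: deformed_sqr. Qed.

(** The degree 0 part of [Bsqr], which itself comes from the cubes of colourings; this replaces a
    case analysis on pairs of crossings. *)
Lemma dmx_sqr : dmx *m dmx = 0.
Proof.
have /(congr1 (degree_part 0)) := Bsqr.
rewrite mulmxDl !degree_partD (degree_part_mull _ _ dmxP) (degree_part_mull _ _ PsimxP) !degree_partD.
rewrite subr0 (degree_part_id dmxP) (degree_part_neq PsimxP) // (degree_part_neq dmxP) // (degree_part_neq PsimxP) //.
rewrite !addr0 mulmx0 addr0 => ->.
by apply/matrixP => i j; rewrite !mxE if_same.
Qed.

Lemma XP_B p : (Xmx p + Pmx p) *m (dmx + Psimx) = (dmx + Psimx) *m (Xmx p + Pmx p).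
Proof. by rewrite BmxE; apply: mulX_deformed. Qed.

Lemma X_d p : Xmx p *m dmx = dmx *m Xmx p.
Proof.
have /(congr1 (degree_part (-2))) := XP_B p.
rewrite !mulmxDl !degree_partD !(degree_part_mull _ _ (@XmxP p)) !(degree_part_mull _ _ (@PmxP p)).
rewrite !(degree_part_mull _ _ dmxP) !(degree_part_mull _ _ PsimxP) !degree_partD.
rewrite subrr !subr0 (degree_part_id dmxP) (degree_part_id (@XmxP p)).
rewrite (degree_part_neq PsimxP) // (degree_part_neq dmxP) // (degree_part_neq PsimxP) //.
rewrite (degree_part_neq (@PmxP p)) // (degree_part_neq (@XmxP p)) // (degree_part_neq (@PmxP p)) //.
by rewrite !addr0 !mulmx0 !addr0.
Qed.

Lemma mulX_proj p : Xmx p *m Pmx p = Xmx p.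
Proof.
rewrite fun_mxM; apply: eq_fun_mx => x y.
rewrite (bigD1 y) //= big1 => [|z zy]; last first.
  by rewrite /proj_coef eq_sym (negPf zy) mulr0.
rewrite addr0 /proj_coef eqxx /mulX_coef; case: andP => [[_ /eqP ->]|]; last by rewrite mul0r.
by rewrite /st_lab /= ffunE connect0 orbT.
Qed.

Lemma proj_mulX p : Pmx p *m Xmx p = 0.
Proof.
rewrite fun_mxM; apply/matrixP => i j; rewrite !mxE; apply: big1 => z _.
rewrite /proj_coef /mulX_coef; case: eqP => [->|]; last by rewrite mul0r.
by case: (st_lab _ p); rewrite ?mul0r ?mulr0.
Qed.

Lemma proj_proj p : Pmx p *m Pmx p = Pmx p.
Proof.
rewrite fun_mxM; apply: eq_fun_mx => x y.
rewrite (bigD1 x) //= big1 => [|z zx]; last by rewrite /proj_coef (negPf zx) mul0r.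
rewrite addr0 /proj_coef eqxx /=; case: (st_lab x p); first by rewrite mul1r.
by rewrite mul0r andbF.
Qed.

Lemma Jsqr : Jmx *m Jmx = 1%:M.
Proof.
rewrite fun_mxM -fun_mx1; apply: eq_fun_mx => x y.
rewrite (bigD1 x) //= big1 => [|z zx]; last by rewrite /sign_coef eq_sym (negPf zx) !mul0r.
rewrite addr0 /sign_coef eqxx mul1r; case: eqP => [->|]; last by rewrite !mul0r mulr0.
by rewrite mul1r -expr2 sqrr_sign.
Qed.

Lemma d_conj : Jmx *m dmx *m Jmx = dmx.
Proof.
rewrite (@sign_conj D _ 1) ?scale1r // => x y /diff_degree[_ /parity_sign_eq ->].
by rewrite mul1r.
Qed.

Lemma Psi_conj : Jmx *m Psimx *m Jmx = - Psimx.
Proof.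
have -> : Psimx = fun_mx (fun x y : St => deformed_coef x y - diff_coef x y).
  by apply/matrixP => i j; rewrite /Psimx -lock !mxE.
rewrite (@sign_conj D _ (-1)) ?scaleN1r // => x y /deformed_degree[_ /parity_sign_opp ->].
by rewrite mulN1r.
Qed.

Lemma X_conj p : Jmx *m Xmx p *m Jmx = - Xmx p.
Proof.
rewrite (@sign_conj D _ (-1)) ?scaleN1r // => x y /mulX_degree[_ q].
by rewrite (@parity_sign_opp D y x) ?q ?subrK // mulN1r opprK.
Qed.

Lemma P_conj p : Jmx *m Pmx p *m Jmx = Pmx p.
Proof.
rewrite (@sign_conj D _ 1) ?scale1r // => x y; rewrite /proj_coef.
by case: (y =P x) => [->|]; rewrite ?eqxx // mul1r.
Qed.

(** [T J] commutes with [d + Psi], and conjugation by [J] turns [d + Psi] into [d - Psi]. *)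
Lemma T_B : Tmx *m (dmx - Psimx) = (dmx + Psimx) *m Tmx.
Proof.
have e : Jmx *m (dmx + Psimx) *m Jmx = dmx - Psimx.
  by rewrite mulmxDr mulmxDl d_conj Psi_conj.
rewrite -e !mulmxA BmxE [Tmx *m Jmx *m Bmx]below_deformed -!mulmxA Jsqr mulmx1.
by [].
Qed.

(** The degree 2 part of [T_B]: as [Tmx] has degree 0 part 1, [Psi] appears once on each side, with
    opposite signs. *)
Lemma Nu_d : Numx *m dmx - dmx *m Numx = 2 *: Psimx.
Proof.
have /(congr1 (degree_part 2)) := T_B.
rewrite mulmxBr mulmxDl compB degree_partD !(degree_part_mulr _ _ dmxP) !(degree_part_mulr _ _ PsimxP).
rewrite !(degree_part_mull _ _ dmxP) !(degree_part_mull _ _ PsimxP) subrr subr0 degree_part0_Tmx mul1mx mulmx1.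
rewrite -/Numx => /eqP; rewrite subr_eq => /eqP ->.
by rewrite -[dmx *m _ + _ + _]addrA [dmx *m _ + _]addrC addrK scaler_nat mulr2n.
Qed.

Lemma Nu_X p : Numx *m Xmx p - Xmx p *m Numx = 2 *: Pmx p - 1%:M.
Proof.
have e : Jmx *m (1%:M - (Xmx p + Pmx p)) *m Jmx = 1%:M - Pmx p + Xmx p.
  rewrite mulmxBr mulmx1 mulmxDr mulmxBl Jsqr mulmxDl X_conj P_conj.
  by rewrite opprD opprK addrA addrAC.
have /(congr1 (mulmx^~ Jmx)) := below_mulX p.
rewrite -!mulmxA Jsqr mulmx1 !mulmxA -[X in _ = X]mulmxA -[X in _ = X]mulmxA.
rewrite [Jmx *m (_ *m _)]mulmxA e => /(congr1 (degree_part 0)).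
rewrite mulmxDl mulmxDr mulmxBr mulmx1 !degree_partD degree_partN.
rewrite !(degree_part_mull _ _ (@XmxP p)) !(degree_part_mull _ _ (@PmxP p)).
rewrite !(degree_part_mulr _ _ (@XmxP p)) !(degree_part_mulr _ _ (@PmxP p)).
rewrite !subr0 degree_part0_Tmx !mulmx1 !mul1mx sub0r opprK -/Numx.
move=> h; have -> : Numx *m Xmx p = Xmx p *m Numx + Pmx p - 1%:M + Pmx p.
  by rewrite h; apply/matrixP => i j; rewrite !mxE; ring.
by apply/matrixP => i j; rewrite !mxE; ring.
Qed.

Lemma hrow_tors (m i : int) y z : m != 0 -> hrow hdeg qdeg i z ->
  y *m (dmx + Psimx) = m *: z ->
  exists t, hrow hdeg qdeg (i - 1) t /\ z = t *m (dmx + Psimx).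
Proof.
move=> m0 Hz; rewrite BmxE => /(deformed_torsion_free m0)[t zE].
exists (\row_k (if hdeg k == i - 1 then t 0 k else 0)); split.
  by move=> k; rewrite mxE; case: (hdeg k =P i - 1) => //; rewrite eqxx.
have {}zE : z = t *m (dmx + Psimx) by rewrite BmxE zE.
rewrite -BmxE; apply/rowP => l; rewrite zE [LHS]mxE [RHS]mxE.
have hB k : (dmx + Psimx) k l = 0 \/ hdeg l = hdeg k + 1.
  have [|ne] := eqVneq ((dmx + Psimx) k l) 0; [by left | right; move: ne; rewrite mxE].
  have [->|/dmxP[]//] := eqVneq (dmx k l) 0; rewrite add0r; by case/PsimxP.
have [li|li] := eqVneq (hdeg l) i.
  apply: eq_bigr => k _; rewrite [X in _ = X * _]mxE; have [->|e] := hB k; first by rewrite !mulr0.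
  by rewrite -li e addrK eqxx.
rewrite [RHS]big1 => [|k _]; last first.
  rewrite [X in X * _]mxE; have [->|e] := hB k; first by rewrite mulr0.
  by case: (hdeg k =P i - 1) => [ek|]; [rewrite e ek subrK eqxx in li | rewrite mul0r].
have : z 0 l = 0 by apply/eqP; apply: contraNT li => /Hz ->.
by rewrite zE mxE.
Qed.

End Identities.

(** * Torsion in the thin region *)

Section HomologyClasses.
Variables (R : nzRingType) (U V W : lmodType R).
Variables (f : {linear U -> V}) (g : {linear V -> W}).
Implicit Types z : cocycle g.

Lemma homology_class0 : homology_class f (0 : cocycle g) = 0.
Proof. by rewrite /homology_class raddf0. Qed.

Lemma homology_class_eq0 z : homology_class f z = 0 <-> exists u, f u = val z.
Proof.
split=> [z0|[u fu]].
  have : z - 0 \in @coboundary_pred _ _ _ _ f g.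
    by rewrite Quotient.idealrBE; apply/eqP; rewrite -/(homology_class f z) z0 raddf0.
  by rewrite subr0 => /asboolP.
rewrite -homology_class0; apply: homology_class_eq; rewrite subr0.
by apply/asboolP; exists u.
Qed.

Lemma homology_classMn z k : homology_class f (z *+ k) = homology_class f z *+ k.
Proof.
elim: k => [|k IHk]; first by rewrite !mulr0n homology_class0.
by rewrite !mulrS homology_classD IHk.
Qed.

End HomologyClasses.

Section Cochains.
Variable D : link_diagram.
Local Notation St := (state D).
Local Notation N := #|{: St}|.
Implicit Types (i j : int).

Lemma gen_state_proof i j (g : generator D i j) :
  val g \in [pred x : smoothing D * labelling D | lab (@circle_rel D x.1) x.2].
Proof. by have /and3P[] := valP g. Qed.
Definition gen_state i j (g : generator D i j) : St :=
  exist (fun z : smoothing D * labelling D =>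
  z \in [pred x : smoothing D * labelling D | lab (@circle_rel D x.1) x.2])
  _ (gen_state_proof g).
Definition gen_index i j (g : generator D i j) : 'I_N := enum_rank (gen_state g).

Lemma gen_indexK i j (g : generator D i j) : enum_val (gen_index g) = gen_state g.
Proof. exact: enum_rankK. Qed.

Lemma gen_index_hdeg i j (g : generator D i j) : hdeg (gen_index g) = i.
Proof. by rewrite /hdeg gen_indexK; have /and3P[_ /eqP] := valP g. Qed.

Lemma gen_index_qdeg i j (g : generator D i j) : qdeg (gen_index g) = j.
Proof. by rewrite /qdeg gen_indexK; have /and3P[_ _ /eqP] := valP g. Qed.

Lemma gen_index_inj i j : injective (@gen_index i j).
Proof.
move=> g h /enum_rank_inj /(congr1 val) e; apply: val_inj; exact: e.
Qed.

Lemma gen_indexP i j (k : 'I_N) : hdeg k = i -> qdeg k = j ->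
  exists g : generator D i j, gen_index g = k.
Proof.
move=> hk qk; have gP : [&& is_labelling (val (enum_val k)).1 (val (enum_val k)).2,
     hom_degree (val (enum_val k)).1 == i &
     poly_degree (val (enum_val k)).1 (val (enum_val k)).2 == j].
  by apply/and3P; split; [apply: stP | apply/eqP | apply/eqP].
exists (exist (fun x : smoothing D * labelling D => [&& is_labelling x.1 x.2,
  hom_degree x.1 == i & poly_degree x.1 x.2 == j]) _ gP); rewrite /gen_index -[RHS]enum_valK; congr enum_rank.
exact: val_inj.
Qed.

Definition restrict i j (f : 'rV[int]_N) : cochain D int i j :=
  [ffun g => f 0 (gen_index g)].

Definition extend i j (c : cochain D int i j) : 'rV[int]_N :=
  \row_k \sum_(g | gen_index g == k) c g.

Lemma restrictK i j (c : cochain D int i j) : restrict i j (extend c) = c.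
Proof.
apply/ffunP => g; rewrite !ffunE mxE (big_pred1 g) // => h /=.
by rewrite (inj_eq (@gen_index_inj i j)).
Qed.

Lemma extend_homog i j (c : cochain D int i j) : homog (@hdeg D) (@qdeg D) i j (extend c).
Proof.
move=> k; rewrite mxE.
case: (pickP (fun g : generator D i j => gen_index g == k)) => [g /eqP <- _|no].
  by rewrite gen_index_hdeg gen_index_qdeg.
by rewrite big_pred0 ?eqxx.
Qed.

Lemma homog_eq i j f g : homog (@hdeg D) (@qdeg D) i j f -> homog (@hdeg D) (@qdeg D) i j g ->
  restrict i j f = restrict i j g -> f = g.
Proof.
move=> Hf Hg /ffunP e; apply/rowP => k.
have [/andP[/eqP hk /eqP qk]|ne] := boolP ((hdeg k == i) && (qdeg k == j)).
  by have [h <-] := gen_indexP hk qk; have := e h; rewrite !ffunE.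
have f0 f' : homog (@hdeg D) (@qdeg D) i j f' -> f' 0 k = 0.
  move=> Hf'; apply/eqP; apply: contraNT ne => /Hf'[-> ->].
  by rewrite !eqxx.
by rewrite !f0.
Qed.

Lemma dmxE i j i' (g : generator D i j) (h : generator D i' j) :
  @dmx D (gen_index g) (gen_index h) = differential_coef int (val g) (val h).
Proof. by rewrite mxE !gen_indexK. Qed.

Lemma restrict_diff i i' j f : i' = i + 1 ->
  differential i' (restrict i j f) = restrict i' j (f *m @dmx D).
Proof.
move=> ii'; apply/ffunP => h; rewrite !ffunE mxE.
under eq_bigr => g _ do rewrite ffunE -dmxE.
rewrite (partition_big (@gen_index i j) predT) //=; apply: eq_bigr => k _.
rewrite (eq_bigr (fun=> f 0 k * dmx D k (gen_index h))); last by move=> g /eqP ->.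
case: (pickP (fun g : generator D i j => gen_index g == k)) => [g /eqP gk|no].
  by rewrite (big_pred1 g) // => g' /=; rewrite -gk (inj_eq (@gen_index_inj i j)).
rewrite big_pred0 //; apply/esym.
have [->|/dmxP[hk qk]] := eqVneq (dmx D k (gen_index h)) 0; first by rewrite mulr0.
rewrite gen_index_hdeg ii' in hk; rewrite gen_index_qdeg addr0 in qk.
have [g gk] := gen_indexP (esym (addIr _ hk)) (esym qk).
by have := no g; rewrite gk eqxx.
Qed.

Lemma extend_diff i i' j (c : cochain D int i j) : i' = i + 1 ->
  extend (differential i' c) = extend c *m @dmx D.
Proof.
move=> ii'; apply: (@homog_eq i' j); first exact: extend_homog.
  by have := homog_mul (@dmxP D) (@extend_homog i j c); rewrite addr0 -ii'.
by rewrite restrictK -(@restrict_diff i i' j _ ii') restrictK.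
Qed.

Lemma extend_linear i j (a : int) (c c' : cochain D int i j) :
  extend (a *: c + c') = a *: extend c + extend c'.
Proof.
apply/rowP => k; rewrite !mxE mulr_sumr -big_split /=.
by apply: eq_bigr => g _; rewrite !ffunE.
Qed.

End Cochains.

Section Torsion.
Variable D : link_diagram.
Local Notation N := #|{: state D}|.
Local Notation d := (@dmx D).
Local Notation homog := (homog (@hdeg D) (@qdeg D)).
Local Notation acyclic := (acyclic_mod (@hdeg D) (@qdeg D) d (fun=> True)).
Implicit Types (i j : int).

Lemma class_eq0P i j (z : cocycle (@differential D int i (i + 1) j)) :
  homology_class (@differential D int (i - 1) i j) z = 0 <->
  exists2 y, homog (i - 1) j y & extend (val z) = y *m d.
Proof.
have ii : i = i - 1 + 1 by rewrite subrK.
rewrite homology_class_eq0; split=> [[u uz]|[y Hy zy]].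
  by exists (extend u); [exact: extend_homog | rewrite -(@extend_diff _ _ i) // uz].
exists (restrict (i - 1) j y).
by have := @restrict_diff D (i - 1) i j y ii; rewrite -zy restrictK.
Qed.

Lemma cocycleP i j (z : cocycle (@differential D int i (i + 1) j)) :
  extend (val z) *m d = 0.
Proof.
have /eqP zc := cocycle_closed z.
rewrite -(@extend_diff _ _ (i + 1)) // zc.
by apply/rowP => k; rewrite !mxE big1 // => g _; rewrite ffunE.
Qed.

Lemma cocycleMn i j (z : cocycle (@differential D int i (i + 1) j)) k :
  extend (val (z *+ k)) = k%:Z *: extend (val z).
Proof.
elim: k => [|k IHk].
  by rewrite mulr0n scale0r; apply/rowP => k; rewrite !mxE big1 // => g _; rewrite ffunE.
rewrite mulrS raddfD /= -[val z]scale1r extend_linear IHk scale1r.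
by rewrite intS scalerDl scale1r.
Qed.

Lemma intr_Fp_eq0 p (a : int) : prime p -> (a%:~R == 0 :> 'F_p) = (p %| a)%Z.
Proof. by move=> pp; rewrite (dvdz_pcharf (pchar_Fp pp)). Qed.

Lemma differential_intr (R : comNzRingType) i i' j (c : cochain D int i j) :
  differential i' ([ffun g => (c g)%:~R] : cochain D R i j) =
  [ffun h => (differential i' c h)%:~R].
Proof.
apply/ffunP => h; rewrite !ffunE rmorph_sum /=; apply: eq_bigr => g _.
rewrite ffunE rmorphM /=; congr (_ * _).
rewrite /differential_coef rmorph_sum /=; apply: eq_bigr => b _.
by rewrite rmorphM rmorphXn rmorphN1 /= rmorph_nat.
Qed.

(** A primitive over the prime field is lifted to integers entry by entry; what is left is divisible
    by [p]. *)
Lemma acyclic_of_trivial p i j : prime p -> trivial_module (Kh D 'F_p i j) ->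
  acyclic p%:Z i j.
Proof.
move=> pp triv f e _ Hf fd.
have ii : i = i - 1 + 1 by rewrite subrK.
pose c : cochain D 'F_p i j := [ffun g => (restrict i j f g)%:~R].
have cc : c \in ker_pred (@differential D 'F_p i (i + 1) j).
  rewrite inE; apply/eqP; rewrite /= differential_intr; apply/ffunP => h.
  rewrite (@restrict_diff _ i) // fd !ffunE mxE.
  by apply/eqP; rewrite intr_Fp_eq0 // dvdz_mulr.
have /homology_class_eq0[u uc] := triv (homology_class _ (Cocycle cc)).
pose u' : cochain D int (i - 1) j := [ffun g => (u g : nat)%:Z].
have uE : u = [ffun g => (u' g)%:~R].
  by apply/ffunP => g; rewrite !ffunE -[RHS]/((u g)%:R) natr_Zp.
have uc' : differential i u = c := uc.
rewrite uE differential_intr in uc'.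
have Hg := @extend_homog D (i - 1) j u'; set g := extend u' in Hg.
have gd : g *m d = extend (differential i u') by rewrite (@extend_diff _ _ i).
have Hfg : homog i j (f - g *m d).
  apply: (submodB (supported_submodule _ _ _)) => //.
  by have := homog_mul (@dmxP D) Hg; rewrite subrK addr0.
pose r k := (f - g *m d) 0 k.
have div k : (p %| r k)%Z.
  have [->|/Hfg[hk qk]] := eqVneq (r k) 0; first exact: dvdz0.
  have [h hE] := gen_indexP hk qk; rewrite -intr_Fp_eq0 //.
  have := congr1 (fun c : cochain D 'F_p i j => c h) uc'.
  rewrite [LHS]ffunE [RHS]ffunE [restrict _ _ _ _]ffunE hE => e1.
  rewrite /r !mxE rmorphB /= -e1 -(restrictK (differential i u')) ffunE hE.
  by rewrite -gd mxE subrr.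
exists g, (\row_k (r k %/ p)%Z); split=> //.
apply/rowP => k; rewrite [RHS]mxE [X in _ + X]mxE [X in _ + _ * X]mxE.
have rk : r k = f 0 k - (g *m d) 0 k by rewrite /r mxE [X in _ + X]mxE.
by rewrite [p%:Z * _]mulrC divzK ?div // rk addrC subrK.
Qed.

Definition bounds i j (f : 'rV[int]_N) := exists2 y, homog (i - 1) j y & f = y *m d.

Lemma bounds_sub i j : submodule (bounds i j).
Proof.
split; first by exists 0; [apply: (submod0 (supported_submodule _ _ _)) | rewrite mul0mx].
move=> a u v [u' Hu' ->] [v' Hv' ->]; exists (a *: u' + v').
  exact: (supported_submodule _ _ _).2.
by rewrite mulmxDl -scalemxAl.
Qed.

Lemma true_div (m : int) (f : 'rV[int]_N) : m != 0 -> True -> True. Proof. by []. Qed.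

(** Universal coefficients: [p]-torsion in row [i] contributes to homology modulo [p] in row
    [i - 1]. *)
Lemma torsion_free_of_acyclic p i j x : prime p -> acyclic p%:Z (i - 1) j ->
  bounds i j (p%:Z *: x) -> bounds i j x.
Proof.
move=> pp ac [y Hy xy]; have p0 : p%:Z != 0 by rewrite eqz_nat -lt0n prime_gt0.
have [g [e [_ Hg yE]]] := ac y x I Hy (esym xy).
have eE : p%:Z *: e = y - g *m d by rewrite yE addrC addKr.
exists e.
  apply: (supported_scale p0); rewrite eE; apply: (submodB (supported_submodule _ _ _)) => //.
  by have := homog_mul (@dmxP D) Hg; rewrite subrK addr0.
apply/rowP => k; have /rowP/(_ k) : p%:Z *: x = p%:Z *: (e *m d).
  by rewrite xy scalemxAl eE mulmxBl -mulmxA dmx_sqr mulmx0 subr0.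
by rewrite [LHS]mxE [RHS]mxE => /(mulfI p0).
Qed.

Section Thin.
Variables (i1 i2 s : int).
Hypothesis thin : thin_over_with D i1 i2 s.

Lemma off_acyclic p i j : prime p -> i1 <= i <= i2 -> 2 * i - j <> s + 1 ->
  2 * i - j <> s - 1 -> acyclic p%:Z i j.
Proof.
by move=> pp ii h1 h2; apply: acyclic_of_trivial => //; apply: thin => //; apply/eqP.
Qed.

(** Torsion in row [i] needs homology modulo [p] in row [i - 1], which leaves [2 * i - j] equal to
    [s + 1] or [s + 3]; in the second case row [i] itself is acyclic modulo [p]. *)
Lemma off_diagonal_torsion p i j x : prime p -> i1 < i <= i2 -> 2 * i - j <> s + 1 ->
  homog i j x -> x *m d = 0 -> bounds i j (p%:Z *: x) -> bounds i j x.
Proof.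
move=> pp ii h1 Hx xd px; have [h3|h3] := eqVneq (2 * i - j) (s + 3); last first.
  by apply: torsion_free_of_acyclic px => //; apply: off_acyclic => //; lia.
have ac : acyclic p%:Z i j by apply: off_acyclic => //; lia.
have [|c [g [_ Hg gE]]] := acyclic_coprime (@dmxP D) (V := fun=> True)
    (conj I (fun _ _ _ _ _ => I)) (fun _ _ => I) true_div (@dmx_sqr D) (f := x) pp ac.
  by split.
by apply: (@bezout_mem _ (bounds i j) p%:Z c _ (bounds_sub i j) px); exists g.
Qed.

Lemma odd_p_torsion p i j x : prime p -> odd p -> i1 < i <= i2 ->
  homog i j x -> x *m d = 0 -> bounds i j (p%:Z *: x) -> bounds i j x.
Proof.
move=> pp op ii Hx xd px.
have [h1|/eqP h1] := eqVneq (2 * i - j) (s + 1); last exact: off_diagonal_torsion px.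
have [y Hy xy] := px.
apply: (odd_torsion (@dmxP D) (@PsimxP D) (@Bsqr D) (@NumxP D) (@dmx_sqr D) (@Nu_d D)
   (@hrow_tors D) pp op _ _ Hx Hy xy) => j' jj'; apply: off_acyclic => //; lia.
Qed.

Lemma four_p_torsion i j x : i1 < i <= i2 ->
  homog i j x -> x *m d = 0 -> bounds i j (4 *: x) -> bounds i j (2 *: x).
Proof.
move=> ii Hx xd px.
have [h1|/eqP h1] := eqVneq (2 * i - j) (s + 1); last first.
  apply: (@off_diagonal_torsion 2) => //.
  - exact: (submodZ (supported_submodule _ _ _)).
  - by rewrite -scalemxAl xd scaler0.
  - by rewrite scalerA.
have [y Hy xy] := px.
(* The reduced complex needs a base point; the empty diagram has none, but its differential is 0. *)
case: (pickP (@predT (Defs.point D))) => [b _|no]; last first.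
  suff d0 : d = 0.
    suff -> : x = 0 by rewrite scaler0; apply: (submod0 (bounds_sub i j)).
    apply/rowP => k; have /rowP/(_ k) := xy; rewrite d0 mulmx0 [LHS]mxE !mxE => /eqP.
    by rewrite mulf_eq0 /= => /eqP.
  apply/matrixP => k l; rewrite !mxE /diff_coef /differential_coef big1 // => c _.
  by have := no (inl (c, 0)).
apply: (@four_torsion _ _ _ _ _ (@dmxP D) (@PsimxP D) (@Bsqr D) _ (@NumxP D)
   (@dmx_sqr D) (@Nu_d D) (@hrow_tors D) _ _ (@XmxP D b) (@PmxP D b) (mulX_proj b)
   (proj_mulX b) (proj_proj b) (X_d b) (XP_B b) (Nu_X b) i j x y) => //.
- by move=> j' h2 h3; apply: off_acyclic => //; lia.
- by move=> j' h2; apply: off_acyclic => //; lia.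
Qed.

End Thin.
End Torsion.

Lemma two_torsion_group (M : zmodType) :
  (forall p (x : M), prime p -> odd p -> x *+ p = 0 -> x = 0) ->
  (forall x : M, x *+ 4 = 0 -> x *+ 2 = 0) ->
  forall n (x : M), (0 < n)%N -> x *+ n = 0 -> x *+ 2 = 0.
Proof.
move=> Hodd H4 n; have [m] := ubnP n; elim: m n => // m IHm n nm x n0 xn.
have [n1|n1] := leqP n 1.
  by have e : n = 1%N by [lia]; move: xn; rewrite e mulr1n => ->; rewrite mul0rn.
have [/hasP[p]|no] := boolP (has odd (primes n)).
  rewrite mem_primes => /and3P[pp _ pn] op.
  have p1 := prime_gt1 pp; have nE := divnK pn.
  have np0 : (0 < n %/ p)%N.
    by rewrite divn_gt0 ?prime_gt0 //; apply: dvdn_leq.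
  apply: (IHm (n %/ p)%N) => //; first exact: leq_trans (ltn_Pdiv p1 n0) nm.
  by apply: (Hodd p) => //; rewrite -mulrnA nE.
have e2 : (2 %| n)%N.
  have := pdiv_dvd n; rewrite (_ : pdiv n = 2%N) //.
  have pp := pdiv_prime n1; case: (even_prime pp) => // op.
  case/hasP: no; exists (pdiv n) => //; by rewrite mem_primes pp n0 pdiv_dvd.
have nE := divnK e2.
have [e4|ne4] := boolP (2 %| n %/ 2)%N.
  have nE4 := divnK e4; apply: (IHm (n %/ 2)%N) => //; [lia|lia|].
  rewrite -nE4 mulrnA; apply: H4; rewrite -mulrnA.
  have -> : (n %/ 2 %/ 2 * 4 = n)%N by lia.
  exact: xn.
have [h1|h1] := leqP (n %/ 2) 1.
  by rewrite -[2%N](_ : n = 2%N) //; lia.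
have pp := pdiv_prime h1; case: (even_prime pp) => [p2|op].
  by have := pdiv_dvd (n %/ 2); rewrite p2 (negPf ne4).
case/hasP: no; exists (pdiv (n %/ 2)) => //; rewrite mem_primes pp n0.
by rewrite (dvdn_trans (pdiv_dvd _)) // -{2}nE dvdn_mulr.
Qed.

Lemma Kh_torsion (D : link_diagram) (i1 i2 s : int) : thin_over_with D i1 i2 s ->
  forall i j n (x : Kh D int i j), i1 < i <= i2 -> (0 < n)%N -> x *+ n = 0 -> x *+ 2 = 0.
Proof.
move=> thin i j n x ii; move: n x; apply: two_torsion_group => [p x pp op|x].
  rewrite -(homology_class_repr x); move: (repr x) => z.
  rewrite -homology_classMn => /class_eq0P; rewrite cocycleMn => pz.
  apply/class_eq0P; apply: (odd_p_torsion thin pp op ii _ _ pz).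
    exact: extend_homog.
  exact: cocycleP.
rewrite -(homology_class_repr x); move: (repr x) => z.
rewrite -!homology_classMn => /class_eq0P; rewrite cocycleMn => pz.
apply/class_eq0P; rewrite cocycleMn; apply: (four_p_torsion thin ii _ _ pz).
  exact: extend_homog.
exact: cocycleP.
Qed.

(** * Finitely generated groups whose torsion has exponent 2 *)

Lemma additive_of (A B : zmodType) (f : A -> B) : zmod_morphism f ->
  exists g : {additive A -> B}, g =1 f.
Proof.
move=> fM.
pose M := GRing.isZmodMorphism.Build A B f fM.
pose g : {additive A -> B} := HB.pack f M.
by exists g.
Qed.

Lemma isomorphic_of_bij (A B : zmodType) (f : A -> B) : zmod_morphism f ->
  injective f -> (forall y, exists x, f x = y) -> isomorphic B A.
Proof.
move=> fM fI fS; have [g gK] := choice fS.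
have fK : cancel f g by move=> x; apply: fI; rewrite gK.
have [F FE] := additive_of fM.
have [|h hE] := @additive_of B A g.
  by apply: (@Algebra.can2_zmod_morphism _ _ F) => x; rewrite FE.
by exists h; exists f => x; rewrite hE.
Qed.

Definition finitely_generated (M : zmodType) :=
  exists n (phi : 'rV[int]_n -> M), zmod_morphism phi /\ forall x, exists v, phi v = x.

Lemma zmod_morphismZ n (M : zmodType) (phi : 'rV[int]_n -> M) : zmod_morphism phi ->
  forall a v, phi (a *: v) = phi v *~ a.
Proof.
move=> phiM; have [g gE] := additive_of phiM.
by move=> a v; rewrite -!gE -raddfMz -{1}[a]intz scaler_int.
Qed.

(** In Smith normal form of the relations, the hypothesis makes every nonzero diagonal entry divide
    2. Units contribute nothing; [A0] and [A2] index the free and the order 2 summands. *)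
Lemma two_torsion_structure (M : zmodType) : finitely_generated M ->
  (forall n (x : M), (0 < n)%N -> x *+ n = 0 -> x *+ 2 = 0) ->
  exists k l : nat, isomorphic M ('rV[int]_k * 'rV['Z_2]_l)%type.
Proof.
move=> [n [phi [phiM phiS]]] tors.
have [f0 fE] := additive_of phiM.
have phi0 : phi 0 = 0 by rewrite -fE raddf0.
have phiD u v : phi (u + v) = phi u + phi v by rewrite -!fE raddfD.
have phiZ := zmod_morphismZ phiM.
have kerS : submodule (fun v => phi v = 0).
  by split=> // a u v pu pv; rewrite phiD phiZ pu pv mul0rz addr0.
have [k [G GP]] := submodule_generators kerS.
have [L Lu [R Ru [d _ GE]]] := int_Smith_normal_form G.
(* A coordinate beyond the [k] relations is unconstrained, which the entry 0 encodes. *)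
pose dd (j : 'I_n) : int := if (j < k)%N then d`_j else 0.
pose psi (w : 'rV[int]_n) := phi (w *m R).
pose en (w : 'rV[int]_n) (j : 'I_n) : int := w 0 j.
have psi0 w : psi w = 0 <-> forall j, (dd j %| en w j)%Z.
  rewrite /psi GP GE; split=> [[u wR]|H].
    have wE : w = u *m L *m \matrix_(i, j) (d`_i *+ (i == j :> nat)).
      by apply: (can_inj (mulmxK Ru)); rewrite wR !mulmxA.
    move=> j; rewrite /en wE mxE; apply: rpred_sum => i _.
    rewrite [X in _ * X]mxE; have [ij|_] := eqVneq (i : nat) j; last first.
      by rewrite mulr0n mulr0; apply: rpred0.
    by rewrite /dd -ij ltn_ord mulr1n dvdz_mull.
  pose u : 'rV[int]_k := \row_i (if (insub (i : nat) : option 'I_n) is Some j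
     then (en w j %/ d`_i)%Z else 0).
  exists (u *m invmx L); rewrite !mulmxA mulmxKV //; congr (_ *m R).
  apply/rowP => j; rewrite mxE; have := H j; rewrite /dd; case: ltnP => jk wj.
    rewrite (bigD1 (Ordinal jk)) //= big1 => [|i ij]; last first.
      rewrite [X in _ * X]mxE; have [e|_] := eqVneq (i : nat) j; last by rewrite mulr0n mulr0.
      by case/eqP: ij; apply: val_inj.
    rewrite !mxE /= eqxx mulr1n addr0 insubT //= => jn.
    by rewrite (_ : Sub _ _ = j) ?divzK //; apply: val_inj.
  rewrite big1 => [|i _].
    by apply/eqP; move: wj; rewrite dvd0z.
  rewrite [X in _ * X]mxE; have [e|_] := eqVneq (i : nat) j; last by rewrite mulr0n mulr0.
  by have := ltn_ord i; rewrite e ltnNge jk.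
have dd2 j : dd j != 0 -> (dd j %| 2)%Z.
  move=> dj; have h : psi (dd j *: delta_mx 0 j) = 0.
    apply/psi0 => l; rewrite /en !mxE eqxx /=; have [->|_] := eqVneq l j.
      by rewrite mulr1 dvdzz.
    by rewrite mulr0 dvdz0.
  have : psi (2 *: delta_mx 0 j) = 0.
    have e2 : psi (delta_mx 0 j) *+ absz (dd j) = 0.
      move: h; rewrite /psi -scalemxAl phiZ; case: (dd j) => m.
        by rewrite -pmulrn.
      by rewrite NegzE mulrNz => /eqP; rewrite oppr_eq0 -pmulrn => /eqP.
    have := tors _ _ _ e2; rewrite absz_gt0 => /(_ dj).
    by rewrite /psi -scalemxAl phiZ -pmulrn.
  by move/psi0/(_ j); rewrite /en !mxE !eqxx mulr1.
pose A0 := [set j | dd j == 0]; pose A2 := [set j | absz (dd j) == 2%N].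
have en_sum (T : finType) (f : T -> 'I_n) (c : T -> int) t : injective f ->
    \sum_(t' | f t' == f t) c t' = c t.
  by move=> fI; rewrite (big_pred1 t) // => t'; rewrite /= (inj_eq fI).
pose w (ab : 'rV[int]_#|A0| * 'rV['Z_2]_#|A2|) : 'rV[int]_n := \row_j
  (\sum_(t | enum_val t == j) ab.1 0 t + \sum_(t | enum_val t == j) (ab.2 0 t : nat)%:Z).
have w0 ab t : en (w ab) (enum_val t) = ab.1 0 t.
  rewrite /en mxE en_sum; last exact: enum_val_inj.
  rewrite big_pred0 ?addr0 // => t'; apply/negbTE/eqP => e.
  have := enum_valP t'; rewrite e inE; have := enum_valP t; rewrite inE => /eqP ->.
  by [].
have w2 ab t : en (w ab) (enum_val t) = (ab.2 0 t : nat)%:Z.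
  rewrite /en mxE en_sum; last exact: enum_val_inj.
  rewrite big_pred0 ?add0r // => t'; apply/negbTE/eqP => e.
  have := enum_valP t'; rewrite e inE; have := enum_valP t; rewrite inE => /eqP h /eqP h'.
  by rewrite h' in h.
have divE (v : 'rV[int]_n) : psi v = 0 <->
    (forall t : 'I_#|A0|, en v (enum_val t) = 0) /\
    (forall t : 'I_#|A2|, (2 %| en v (enum_val t))%Z).
  have A2E j : j \in A2 -> forall x, (dd j %| x)%Z = (2 %| x)%Z.
    by rewrite inE => /eqP h x; rewrite !dvdzE h.
  rewrite psi0; split=> [H|[H0 H2] j].
    split=> t; last by rewrite -(A2E _ (enum_valP t)).
    have := H (enum_val t); have := enum_valP t; rewrite inE => /eqP ->.
    by rewrite dvd0z => /eqP.
  have [j0|j0] := eqVneq (dd j) 0.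
    have jA : j \in A0 by rewrite inE j0.
    by have := H0 (enum_rank_in jA j); rewrite enum_rankK_in // => ->; rewrite dvdz0.
  have := dd2 j j0; rewrite dvdzE dvdn_divisors // !inE => /orP[] /eqP h.
    by rewrite dvdzE h dvd1n.
  have jA : j \in A2 by rewrite inE h.
  by have := H2 (enum_rank_in jA j); rewrite enum_rankK_in // A2E.
exists #|A0|, #|A2|.
have psiB u v : psi (u - v) = psi u - psi v by rewrite /psi mulmxBl phiM.
have Z2E (x : 'Z_2) : (x : nat)%:Z%:~R = x by rewrite -[LHS]/((x : nat)%:R) natr_Zp.
have even2 (x : int) : (x%:~R == 0 :> 'Z_2) = (2 %| x)%Z.
  by rewrite (dvdz_pcharf (R := 'Z_2) (p := 2)).
have enB u v j : en (u - v) j = en u j - en v j by rewrite /en !mxE.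
apply: (@isomorphic_of_bij _ _ (psi \o w)) => [x y|x y /= e|y] /=.
- apply/eqP; rewrite -psiB -subr_eq0 -psiB; apply/eqP/divE; split=> t.
    by rewrite !enB !w0 !mxE; ring.
  rewrite !enB !w2 -even2 !rmorphB /= !Z2E.
  by rewrite !mxE subrr.
- have /divE[H0 H2] : psi (w x - w y) = 0 by rewrite psiB e subrr.
  case: x y e H0 H2 => [a b] [a' b'] e H0 H2; congr pair; apply/rowP => t.
    by have := H0 t; rewrite enB !w0 => /eqP; rewrite subr_eq0 => /eqP.
  have := H2 t; rewrite enB !w2 -even2 rmorphB /= !Z2E.
  by rewrite subr_eq0 => /eqP.
have [v vy] := phiS y; pose u := v *m invmx R.
exists (\row_t en u (enum_val t), \row_t (en u (enum_val t))%:~R).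
have -> : y = psi u by rewrite /psi /u mulmxKV.
apply/eqP; rewrite -subr_eq0 -psiB; apply/eqP/divE; split=> t.
  by rewrite enB w0 mxE subrr.
by rewrite enB w2 -even2 rmorphB /= Z2E mxE subrr.
Qed.

Lemma has_torsion_summand_two (M : zmodType) p r :
  (forall n (x : M), (0 < n)%N -> x *+ n = 0 -> x *+ 2 = 0) ->
  prime p -> (0 < r)%N -> has_torsion_summand M p r -> (p ^ r = 2)%N.
Proof.
move=> tors pp r0 [N [f fB]]; have [g fK gK] := fB.
have q1 : (1 < p ^ r)%N by rewrite -(exp1n r) ltn_exp2r // prime_gt1.
pose x := g (1, 0).
have fx k : f (x *+ k) = (k%:R, 0).
  rewrite raddfMn /= gK; elim: k => [|k IHk] //; rewrite mulrS IHk.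
  by congr pair; rewrite /= ?addr0 // -natr1 addrC.
have xq : x *+ (p ^ r) = 0.
  apply: (can_inj fK); rewrite fx raddf0; congr pair.
  by apply: val_inj; rewrite /= val_Zp_nat // modnn.
have := fx 2; rewrite (tors _ _ _ xq) ?(ltnW q1) // raddf0.
move/(congr1 fst) => /= /(congr1 (@nat_of_ord _)).
rewrite val_Zp_nat //= => h.
have q2 : (p ^ r %| 2)%N by rewrite /dvdn -h.
by have := @dvdn_leq _ 2 isT q2; lia.
Qed.

(** * Thin Khovanov homology *)

Lemma dsumMn (R : nzRingType) (K : Type) (M : K -> lmodType R) (x : dsum M) n k :
  (x *+ n) k = x k *+ n.
Proof. by elim: n => [|n IHn]; rewrite ?mulr0n // !mulrS -IHn. Qed.

(** * Finite generation: classes in all bidegrees from one cocycle of the total complex *)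

Section FiniteGeneration.
Variables (D : link_diagram) (i1 i2 : int).
Local Notation N := #|{: state D}|.
Local Notation d := (@dmx D).
Local Notation range := {i : int | i1 <= i <= i2}.
Variables (k : nat) (G : 'M[int]_(k, N)).
Hypothesis GP : forall v : 'rV[int]_N, v *m d = 0 <-> exists u : 'rV[int]_k, v = u *m G.

Lemma row_cocycle i j (u : 'rV[int]_k) :
  restrict i j (u *m G) \in ker_pred (@differential D int i (i + 1) j).
Proof.
rewrite inE; apply/eqP; have := @restrict_diff D i (i + 1) j (u *m G) erefl.
rewrite (_ : u *m G *m d = 0); last by apply/GP; exists u.
by move=> e; rewrite [LHS]e; apply/ffunP => h; rewrite !ffunE mxE.
Qed.

Implicit Type u : 'rV[int]_k.

Definition comb_class i j u : Kh D int i j :=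
  homology_class (@differential D int (i - 1) i j) (Cocycle (row_cocycle i j u)).

Lemma comb_classB i j u (v : 'rV[int]_k) : comb_class i j (u - v) = comb_class i j u - comb_class i j v.
Proof.
apply/eqP; rewrite eq_sym subr_eq -homology_classD; apply/eqP; congr homology_class.
apply: val_inj; rewrite /= mulmxBl; apply/ffunP => h.
by rewrite !ffunE !mxE subrK.
Qed.

Lemma comb_class_support i j u : comb_class i j u != 0 ->
  exists l : 'I_N, hdeg l = i /\ qdeg l = j.
Proof.
move=> nz; case: (pickP (fun l : 'I_N => (hdeg l == i) && (qdeg l == j))) => [l /andP[]|no].
  by move=> /eqP hl /eqP ql; exists l.
case/eqP: nz; apply/homology_class_eq0; exists 0; rewrite linear0 /=.
apply/ffunP => g; have := no (gen_index g).
by rewrite gen_index_hdeg gen_index_qdeg !eqxx.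
Qed.

Lemma comb_row_finite i u : finite_set [set j | comb_class i j u != 0]%classic.
Proof.
apply: (@sub_finite_set _ _ [set qdeg l | l in [set: 'I_N]]%classic).
  by move=> j /= /comb_class_support[l [_ <-]]; exists l.
exact/finite_image/finite_finset.
Qed.
Definition comb_row i u : Kh_row D int i := DSum (comb_row_finite i u).

Lemma comb_range_finite u :
  finite_set [set i : range | comb_row (val i) u != 0]%classic.
Proof.
apply: (@sub_finite_set _ _ (val @^-1` [set hdeg l | l in [set: 'I_N]])%classic).
  move=> i /=; apply: contra_neqP => nl; apply: dsumP => j /=.
  by apply: contra_notP nl => /eqP/comb_class_support[l [hl _]]; exists l.
apply: finite_preimage; first by move=> ? ? _ _; apply: val_inj.
exact/finite_image/finite_finset.
Qed.
Definition comb_range u : Kh_range D int i1 i2 := DSum (comb_range_finite u).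

Lemma comb_rangeB : zmod_morphism comb_range.
Proof.
by move=> u v; apply: dsumP => i; apply: dsumP => j; apply: comb_classB.
Qed.

(** Representatives from all bidegrees in the range are assembled into one vector, 0 outside the
    range. It is a cocycle because [d] respects bidegrees; [valP'] is consistent because an index
    determines its bidegree and generator. *)
Lemma comb_range_surj (x : Kh_range D int i1 i2) : exists u, comb_range u = x.
Proof.
have valP' (l : 'I_N) : exists v : int,
    (forall (i : range) j (g : generator D (val i) j), gen_index g = l ->
       val (repr (x i j)) g = v) /\ (~~ (i1 <= hdeg l <= i2) -> v = 0).
  have [[i [j [g gl]]]|no] := pselect (exists (i : range) j,
      exists g : generator D (val i) j, gen_index g = l); last first.
    by exists 0; split=> // i j g gl; case: no; exists i, j, g.
  exists (val (repr (x i j)) g); split; last first.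
    by rewrite -gl gen_index_hdeg (valP i).
  move=> i' j' g' gl'.
  have ii' : i' = i by apply: val_inj; rewrite /= -(gen_index_hdeg g') gl' -gl gen_index_hdeg.
  have jj' : j' = j by rewrite -(gen_index_qdeg g') gl' -gl gen_index_qdeg.
  move: ii' jj' g' gl' => -> -> g' gl'.
  by rewrite (gen_index_inj (etrans gl' (esym gl))).
have [F FP] := choice valP'; pose f : 'rV[int]_N := \row_l F l.
have fE (i : range) j : restrict (val i) j f = val (repr (x i j)).
  apply/ffunP => g; rewrite ffunE mxE.
  by have [FE _] := FP (gen_index g); rewrite (FE i j g).
have fd : f *m d = 0.
  apply/rowP => l; rewrite [RHS]mxE.
  have [h hl] := @gen_indexP D (hdeg l - 1 + 1) (qdeg l) l (esym (subrK _ _)) erefl.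
  have := congr1 (fun c : cochain D int _ _ => c h)
    (@restrict_diff D (hdeg l - 1) (hdeg l - 1 + 1) (qdeg l) f erefl).
  rewrite [RHS]ffunE hl => <-.
  have [ir|nr] := boolP (i1 <= hdeg l - 1 <= i2).
    pose i : range := exist _ (hdeg l - 1) ir.
    rewrite (fE i); have /eqP zc := cocycle_closed (repr (x i (qdeg l))).
    have zc' : differential (hdeg l - 1 + 1) (val (repr (x i (qdeg l)))) = 0 := zc.
    by rewrite zc' ffunE.
  rewrite ffunE big1 // => g _; rewrite ffunE mxE.
  have [_ ->] := FP (gen_index g); first by rewrite mul0r.
  by rewrite gen_index_hdeg.
have [u fu] := (GP f).1 fd; exists u.
apply: dsumP => i; apply: dsumP => j /=.
rewrite /comb_class -[RHS]homology_class_repr; congr homology_class.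
by apply: val_inj; rewrite /= -fu fE.
Qed.

End FiniteGeneration.

Lemma Kh_range_fg (D : link_diagram) (i1 i2 : int) :
  finitely_generated (Kh_range D int i1 i2).
Proof.
have SS : submodule (fun v : 'rV[int]_#|{: state D}| => v *m @dmx D = 0).
  split=> [|a u v ud vd]; first exact: mul0mx.
  by rewrite mulmxDl -scalemxAl ud vd scaler0 addr0.
have [k [G GP]] := submodule_generators SS.
exists k, (comb_range i1 i2 GP); split; first exact: comb_rangeB.
exact: comb_range_surj.
Qed.

(** The argument for row [i] uses thinness in row [i - 1] and so starts at [i1 + 1]; row [i1] is
    settled by torsion-freeness. *)
Lemma Kh_row_two_torsion (D : link_diagram) (i1 i2 s : int) :
  thin_over_with D i1 i2 s -> torsion_free (Kh_row D int i1) ->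
  forall i, i1 <= i <= i2 -> forall n (x : Kh_row D int i),
  (0 < n)%N -> x *+ n = 0 -> x *+ 2 = 0.
Proof.
move=> thin tf i ii n x n0 xn; have [e|ne] := eqVneq i i1.
  by move: x xn; rewrite e => x xn; rewrite (tf n x n0 xn) mul0rn.
apply: dsumP => j; rewrite dsumMn; apply: (Kh_torsion thin _ n0).
  by rewrite lt_neqAle eq_sym ne.
by rewrite -dsumMn xn.
Qed.

Theorem theorem4p7 (D : link_diagram) (i1 i2 s : int)
  (lt_i1_i2 : i1 < i2)
  (thin : thin_over_with D i1 i2 s)
  (dim_eq : forall p : nat, prime p -> odd p ->
     dimension (Kh_row D rat i1) = dimension (Kh_row D 'F_p i1))
  (tors_free : torsion_free (Kh_row D int i1))
  (vanish : forall j : int, j <= 2 * i1 - s - 3 ->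
     trivial_module (Kh D int (i1 - 1) j)) :
  (forall i : int, i1 <= i <= i2 ->
     forall p r : nat, prime p -> (0 < r)%N ->
     has_torsion_summand (Kh_row D int i) p r -> (p ^ r = 2)%N) /\
  (exists k l : nat,
     isomorphic (Kh_range D int i1 i2) ('rV[int]_k * 'rV['Z_2]_l)%type).
Proof.
split=> [i ii p r|].
  exact/has_torsion_summand_two/(Kh_row_two_torsion thin tors_free ii).
apply: two_torsion_structure; first exact: Kh_range_fg.
move=> n x n0 xn; apply: dsumP => i; rewrite dsumMn.
apply: (Kh_row_two_torsion thin tors_free (valP i) n0).
by have := dsumMn x n i; rewrite xn => <-.
Qed.
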